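(* Suppose we have a finitely generated group $G=N\rtimes\mathbb{Z}$ with $N$ abelian. Regard $N$ as a $\mathbb{Z}[x]$-module, with $x$ acting as conjugation by a chosen generator of $\mathbb{Z}$. For any prime $p$ let $r(p)$ be the $\mathbb{F}_p[x]$-torsion-free rank of $N/pN$, and write $$\mathbb{Q}\otimes_{\mathbb{Z}}N\cong_{\mathbb{Q}[x]}\Big(\bigoplus_{j=1}^{s(0)}\mathbb{Q}[x]/(a_j)\Big)\oplus\mathbb{Q}[x]^{r(0)},$$ where the $a_j\in\mathbb{Q}[x]$ are not units and $a_1\mid a_2\mid\cdots\mid a_{s(0)}$, as provided by the structure theorem for finitely generated modules over a PID. Let $d=s(0)+r(0)$ and $r_{\max}=\max_p\{r(p)\}$. Then $$m_n(G)\text{ has growth type }\begin{cases}n^{d}&\text{if } d>r_{\max},\\ n^{d+1}&\text{if } d=r_{\max}=r(0),\\ n^{r_{\max}+1}/\log(n)&\text{otherwise.}\end{cases}$$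
   Context: For a finitely generated group $G$, $m_n(G)$ denotes the number of maximal subgroups of $G$ of index $n$. Growth type: let $g$ be an (increasing and eventually positive) function whose domain is a subset of the positive integers of the form $\{k,k+1,k+2,\ldots\}$. A function $f:\{1,2,3,\ldots\}\to\mathbb{R}$ has growth type at most $g$ if there is a constant $C$ with $|f(n)|\le Cg(n)$ for all large $n$; it has growth type at least $g$ if there is a constant $C>0$ with $Cg(n)\le f(n)$ for infinitely many $n$; and it has growth type $g$ if both hold.
   Formalization: The case d = r_max = 0 (N finite) is excluded, since there m_n(G) ≤ 1 for large n and growth type n fails (e.g. G = Z); the free part of the decomposition of Q⊗N may be Q[x]^{r(0)} or Q[x,1/x]^{r(0)}, the latter being what occurs when r(0) > 0. *)

(* Defs.v *)
From HB Require Import structures.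
From mathcomp Require Import all_boot all_order all_algebra finmap.
From mathcomp Require Import all_classical all_reals exp.
From mathcomp Require Import generic_quotient ring_quotient.

Set Implicit Arguments.
Unset Strict Implicit.
Unset Printing Implicit Defensive.

Import Order.TTheory GRing.Theory Num.Theory.

Local Open Scope classical_set_scope.
Local Open Scope quotient_scope.
Local Open Scope ring_scope.

Section Groups.
Local Open Scope group_scope.
Variable G : groupType.
Implicit Types (H K : set G) (g t : G).

Definition zpow t (k : int) : G :=
  match k with Posz n => t ^+ n | Negz n => t ^- n.+1 end.

Definition subgroup H : Prop := group_closed [in H].

Definition finitely_generated : Prop :=
  exists s : seq G, forall H, subgroup H -> [set` s] `<=` H -> H = setT.

Definition lcoset g H : set G := [set g * h | h in H].

Definition has_index H (n : nat) : Prop :=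
  ([set lcoset g H | g in [set: G]] #= `I_n)%card.

Definition maximal_subgroup H : Prop :=
  [/\ subgroup H, H != setT &
      forall K, subgroup K -> H `<=` K -> K = H \/ K = setT].

(* [fset_set] sends an infinite set to the empty one; this does not happen
   here when G is finitely generated. *)
Definition max_subgroup_count (n : nat) : nat :=
  #|` fset_set [set H | maximal_subgroup H /\ has_index H n] |.

(* G is the internal semidirect product of the image of iota, an abelian normal
   subgroup (written additively as N), by the infinite cyclic subgroup generated
   by t, and t acts on N by conjugation as phi. Uniqueness in [sdZ_decomp]
   forces t to have infinite order. *)
Record semidirect_by_Z (N : zmodType) (iota : N -> G) (t : G)
    (phi : {additive N -> N}) : Prop := {
  sdZ_morph : forall a b : N, iota (a + b)%R = iota a * iota b;
  sdZ_inj : injective iota;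
  sdZ_normal : forall g (a : N), exists b : N, g * iota a * g^-1 = iota b;
  sdZ_decomp : forall g, exists! ak : N * int, g = iota ak.1 * zpow t ak.2;
  sdZ_conj : forall a : N, t * iota a * t^-1 = iota (phi a)
}.

End Groups.
Arguments finitely_generated : clear implicits.

(* The R-module V, as an R[x]-module on which x acts by phi. *)
Section PolyModule.
Variables (R : nzRingType) (V : lmodType R) (phi : {linear V -> V}).

Definition polymod (f : {linear V -> V}) : Type := V.

HB.instance Definition _ := GRing.Zmodule.on (polymod phi).

Definition polymod_scale (p : {poly R}) (v : polymod phi) : polymod phi :=
  \sum_(i < size p) p`_i *: iter i phi (v : V).

Let iter_add n : {morph iter n phi : u v / u + v}.
Proof. by move=> u v; elim: n => //= n ->; rewrite linearD. Qed.

Let scale_widen n (p : {poly R}) (v : V) : (size p <= n)%N ->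
  polymod_scale p v = \sum_(i < n) p`_i *: iter i phi v.
Proof.
move=> le_pn; rewrite /polymod_scale (big_ord_widen n (fun i => p`_i *: iter i phi v)) //.
rewrite big_mkcond; apply: eq_bigr => i _; case: ltnP => // hi.
by rewrite nth_default ?scale0r.
Qed.

Let scaleDl v : {morph polymod_scale^~ v : p q / p + q}.
Proof.
move=> p q; pose n := maxn (size p) (size q).
rewrite !(@scale_widen n) ?leq_maxl ?leq_maxr ?size_polyD // -big_split /=.
by apply: eq_bigr => i _; rewrite coefD scalerDl.
Qed.

Let scaleDr p : {morph polymod_scale p : u v / u + v}.
Proof.
move=> u v; rewrite -big_split /=.
by apply: eq_bigr => i _; rewrite iter_add scalerDr.
Qed.

Lemma polymod_scaleC c v : polymod_scale c%:P v = c *: (v : V).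
Proof.
by rewrite (@scale_widen 1) ?size_polyC_leq1 // big_ord1 coefC.
Qed.

Lemma polymod_scaleMX p v : polymod_scale (p * 'X) v = polymod_scale p (phi v).
Proof.
rewrite (@scale_widen (size p).+1); last first.
  by rewrite (leq_trans (size_polyMleq _ _)) // size_polyX addn2.
rewrite big_ord_recl coefMX scale0r add0r; apply: eq_bigr => i _.
by rewrite coefMX /= -iterSr.
Qed.

Let scaleCM c p v : polymod_scale (c%:P * p) v = c *: (polymod_scale p v : V).
Proof.
rewrite (@scale_widen (size p)); last by rewrite mul_polyC size_scale_leq.
by rewrite scaler_sumr; apply: eq_bigr => i _; rewrite coefCM scalerA.
Qed.

Let scale_phi p v : polymod_scale p (phi v) = phi (polymod_scale p v : V).
Proof.
rewrite /polymod_scale linear_sum; apply: eq_bigr => i _.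
by rewrite linearZ -iterSr.
Qed.

Let scaleA p q v : polymod_scale p (polymod_scale q v) = polymod_scale (p * q) v.
Proof.
elim/poly_ind: p => [|p c IHp].
  by rewrite mul0r /polymod_scale size_poly0 !big_ord0.
rewrite mulrDl !scaleDl polymod_scaleC scaleCM -mulrA -commr_polyX mulrA !polymod_scaleMX.
by rewrite scale_phi IHp -scale_phi.
Qed.

Let scale1 : left_id 1 polymod_scale.
Proof. by move=> v; rewrite polymod_scaleC scale1r. Qed.

HB.instance Definition _ :=
  @GRing.Zmodule_isLmodule.Build {poly R} (polymod phi) polymod_scale
    scaleA scale1 scaleDr scaleDl.

Lemma polymodX (v : polymod phi) : 'X *: v = phi v.
Proof.
rewrite -['X]mul1r; apply: etrans (polymod_scaleMX 1 v) _.
exact: scale1r.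
Qed.

End PolyModule.

(* F[x]/(a), as an F[x]-module. *)
Section PolyQuotient.
Variables (F : fieldType) (a : {poly F}).

Definition poly_ideal : {pred {poly F}} := fun u => a %| u.

Let poly_ideal_closed : zmod_closed poly_ideal.
Proof.
split=> [|u v]; rewrite !unfold_in /poly_ideal ?dvdp0 // => ? ?.
exact: dvdp_sub.
Qed.

HB.instance Definition _ :=
  GRing.isZmodClosed.Build {poly F} poly_ideal poly_ideal_closed.

Definition polyquo : Type := {ideal_quot poly_ideal}.

HB.instance Definition _ := GRing.Zmodule.on polyquo.

Definition polyquo_pi (u : {poly F}) : polyquo := \pi_{ideal_quot poly_ideal} u.

Definition polyquo_scale (c : {poly F}) (u : polyquo) : polyquo :=
  polyquo_pi (c * repr u).

Lemma polyquo_piD u v : polyquo_pi (u + v) = polyquo_pi u + polyquo_pi v.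
Proof. by rewrite /polyquo_pi !piE. Qed.

Lemma polyquo_piK (u : polyquo) : polyquo_pi (repr u) = u.
Proof. exact: reprK. Qed.

Lemma polyquo_scaleE c v : polyquo_scale c (polyquo_pi v) = polyquo_pi (c * v).
Proof.
apply/eqP; rewrite /polyquo_scale -Quotient.idealrBE -mulrBr.
have : repr (polyquo_pi v) - v \in poly_ideal by rewrite Quotient.idealrBE reprK.
by rewrite !unfold_in /poly_ideal => ?; apply: dvdp_mull.
Qed.

Let scaleA b c v : polyquo_scale b (polyquo_scale c v) = polyquo_scale (b * c) v.
Proof. by rewrite -[v]polyquo_piK !polyquo_scaleE mulrA. Qed.
Let scale1 : left_id 1 polyquo_scale.
Proof. by move=> v; rewrite -[v]polyquo_piK !polyquo_scaleE mul1r. Qed.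
Let scaleDr : right_distributive polyquo_scale +%R.
Proof.
move=> c u v; rewrite -[u]polyquo_piK -[v]polyquo_piK.
by rewrite !polyquo_scaleE -!polyquo_piD !polyquo_scaleE mulrDr.
Qed.
Let scaleDl v : {morph polyquo_scale^~ v : b c / b + c}.
Proof. by move=> b c; rewrite -[v]polyquo_piK !polyquo_scaleE -polyquo_piD mulrDl. Qed.

HB.instance Definition _ :=
  @GRing.Zmodule_isLmodule.Build {poly F} polyquo polyquo_scale
    scaleA scale1 scaleDr scaleDl.

End PolyQuotient.

Section DirectSum.
Variables (R : nzRingType) (J : finType) (M : J -> lmodType R).

Definition dirsum : Type := forall j, M j.

HB.instance Definition _ := Choice.on dirsum.

Implicit Types u v w : dirsum.

Definition dirsum_add u v : dirsum := fun j => u j + v j.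
Definition dirsum_opp u : dirsum := fun j => - u j.
Definition dirsum_scale (c : R) u : dirsum := fun j => c *: u j.

Let addA : associative dirsum_add.
Proof. by move=> u v w; apply: functional_extensionality_dep => j; apply: addrA. Qed.
Let addC : commutative dirsum_add.
Proof. by move=> u v; apply: functional_extensionality_dep => j; apply: addrC. Qed.
Let add0 : left_id (fun j => 0 : M j) dirsum_add.
Proof. by move=> u; apply: functional_extensionality_dep => j; apply: add0r. Qed.
Let addN : left_inverse (fun j => 0 : M j) dirsum_opp dirsum_add.
Proof. by move=> u; apply: functional_extensionality_dep => j; apply: addNr. Qed.

HB.instance Definition _ := GRing.isZmodule.Build dirsum addA addC add0 addN.

Let scaleA a b u : dirsum_scale a (dirsum_scale b u) = dirsum_scale (a * b) u.
Proof. by apply: functional_extensionality_dep => j; apply: scalerA. Qed.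
Let scale1 : left_id 1 dirsum_scale.
Proof. by move=> u; apply: functional_extensionality_dep => j; apply: scale1r. Qed.
Let scaleDr : right_distributive dirsum_scale +%R.
Proof. by move=> c u v; apply: functional_extensionality_dep => j; apply: scalerDr. Qed.
Let scaleDl u : {morph dirsum_scale^~ u : a b / a + b}.
Proof. by move=> a b; apply: functional_extensionality_dep => j; apply: scalerDl. Qed.

HB.instance Definition _ :=
  @GRing.Zmodule_isLmodule.Build R dirsum dirsum_scale scaleA scale1 scaleDr scaleDl.

End DirectSum.

(* The tensor product of R and N over the integers: formal sums of pure tensors
   modulo the bilinear relations. *)
Section Tensor.
Variables (R : nzRingType) (N : zmodType).
Implicit Types (s : seq (R * N)).

Inductive tensor_eq : seq (R * N) -> seq (R * N) -> Prop :=
| tensor_refl s : tensor_eq s s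
| tensor_sym s1 s2 : tensor_eq s1 s2 -> tensor_eq s2 s1
| tensor_trans s1 s2 s3 : tensor_eq s1 s2 -> tensor_eq s2 s3 -> tensor_eq s1 s3
| tensor_cat s1 s2 s3 s4 :
    tensor_eq s1 s2 -> tensor_eq s3 s4 -> tensor_eq (s1 ++ s3) (s2 ++ s4)
| tensor_catC s1 s2 : tensor_eq (s1 ++ s2) (s2 ++ s1)
| tensor_0l v : tensor_eq [:: (0, v)] [::]
| tensor_Dl a b v : tensor_eq [:: (a + b, v)] [:: (a, v); (b, v)]
| tensor_Dr a u v : tensor_eq [:: (a, u + v)] [:: (a, u); (a, v)].

Definition tensor_eqb s1 s2 : bool := `[< tensor_eq s1 s2 >].

Lemma tensor_eqb_equiv : equiv_class_of tensor_eqb.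
Proof.
split=> [s|s1 s2|s2 s1 s3].
- by apply/asboolP; apply: tensor_refl.
- by apply: asbool_equiv_eq; split; apply: tensor_sym.
- by move=> /asboolP h1 /asboolP h2; apply/asboolP; apply: tensor_trans h1 h2.
Qed.

Canonical tensor_equiv := EquivRelPack tensor_eqb_equiv.
Canonical tensor_encModRel := defaultEncModRel tensor_eqb.

Definition tensor : Type := {eq_quot tensor_eqb}.

HB.instance Definition _ := Choice.on tensor.
HB.instance Definition _ : EqQuotient _ tensor_eqb tensor := EqQuotient.on tensor.

Definition tensor_sum s : tensor := \pi_tensor s.

Lemma tensor_sumP s1 s2 : tensor_sum s1 = tensor_sum s2 <-> tensor_eq s1 s2.
Proof. by split=> [/eqquotP/asboolP//|h]; apply/eqquotP/asboolP. Qed.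

Lemma tensor_sumK (u : tensor) : tensor_sum (repr u) = u.
Proof. exact: reprK. Qed.

Lemma tensor_repr s : tensor_eq (repr (tensor_sum s)) s.
Proof. by apply/tensor_sumP; rewrite tensor_sumK. Qed.

Definition tensor_add (u v : tensor) : tensor := tensor_sum (repr u ++ repr v).

Lemma tensor_addE s1 s2 :
  tensor_add (tensor_sum s1) (tensor_sum s2) = tensor_sum (s1 ++ s2).
Proof. by apply/tensor_sumP; apply: tensor_cat; apply: tensor_repr. Qed.

Definition tmap (f : R -> R) (g : N -> N) s := [seq (f x.1, g x.2) | x <- s].

Lemma tmap_eq (f : {additive R -> R}) (g : {additive N -> N}) s1 s2 :
  tensor_eq s1 s2 -> tensor_eq (tmap f g s1) (tmap f g s2).
Proof.
elim=> //= *.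
- exact: tensor_refl.
- exact: tensor_sym.
- by apply: tensor_trans; eassumption.
- by rewrite /tmap !map_cat; apply: tensor_cat.
- by rewrite /tmap !map_cat; apply: tensor_catC.
- by rewrite raddf0; apply: tensor_0l.
- by rewrite raddfD; apply: tensor_Dl.
- by rewrite raddfD; apply: tensor_Dr.
Qed.

Definition tensor_map (f : R -> R) (g : N -> N) (u : tensor) : tensor :=
  tensor_sum (tmap f g (repr u)).

Lemma tensor_mapE (f : {additive R -> R}) (g : {additive N -> N}) s :
  tensor_map f g (tensor_sum s) = tensor_sum (tmap f g s).
Proof. by apply/tensor_sumP/tmap_eq/tensor_repr. Qed.

Let addA : associative tensor_add.
Proof.
move=> u v w; rewrite -[u]tensor_sumK -[v]tensor_sumK -[w]tensor_sumK.
by rewrite !tensor_addE catA.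
Qed.
Let addC : commutative tensor_add.
Proof.
move=> u v; rewrite -[u]tensor_sumK -[v]tensor_sumK !tensor_addE.
by apply/tensor_sumP/tensor_catC.
Qed.
Let add0 : left_id (tensor_sum [::]) tensor_add.
Proof. by move=> u; rewrite -[u]tensor_sumK tensor_addE. Qed.
Let addN : left_inverse (tensor_sum [::]) (tensor_map -%R id) tensor_add.
Proof.
move=> u; rewrite -[u]tensor_sumK (tensor_mapE -%R idfun) tensor_addE.
apply/tensor_sumP; elim: (repr u) => [|[a v] s IHs] /=; first exact: tensor_refl.
rewrite -[(a, v) :: s]cat1s -cat_cons -[(- a, v) :: _]cat1s.
apply: tensor_trans (_ : tensor_eq (([:: (- a, v)] ++ [:: (a, v)]) ++
  (tmap -%R idfun s ++ s)) _).
  rewrite -!catA; apply: tensor_cat; first exact: tensor_refl.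
  rewrite !catA; apply: tensor_cat; last exact: tensor_refl.
  exact: tensor_catC.
rewrite -[[::]](@cats0 _ [::]); apply: tensor_cat IHs.
apply: tensor_trans (tensor_0l v); rewrite -(addNr a).
exact/tensor_sym/tensor_Dl.
Qed.

HB.instance Definition _ := GRing.isZmodule.Build tensor addA addC add0 addN.

Lemma tensor_sumD s1 s2 :
  tensor_sum (s1 ++ s2) = tensor_sum s1 + tensor_sum s2.
Proof. by rewrite -tensor_addE. Qed.

Definition tensor_scale (c : R) : tensor -> tensor := tensor_map ( *%R c) id.

Lemma tensor_scaleE c s : tensor_scale c (tensor_sum s) = tensor_sum (tmap ( *%R c) id s).
Proof. exact: (tensor_mapE (c \*o idfun) idfun). Qed.

Let scaleA a b u : tensor_scale a (tensor_scale b u) = tensor_scale (a * b) u.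
Proof.
rewrite -[u]tensor_sumK !tensor_scaleE /tmap -map_comp; congr tensor_sum.
by apply: eq_map => x /=; rewrite mulrA.
Qed.
Let scale1 : left_id 1 tensor_scale.
Proof.
move=> u; rewrite -[u]tensor_sumK tensor_scaleE; congr tensor_sum.
by rewrite -[RHS]map_id; apply: eq_map => -[a v] /=; rewrite mul1r.
Qed.
Let scaleDr : right_distributive tensor_scale +%R.
Proof.
move=> c u v; rewrite -[u]tensor_sumK -[v]tensor_sumK -tensor_sumD !tensor_scaleE.
by rewrite -tensor_sumD /tmap map_cat.
Qed.
Let scaleDl u : {morph tensor_scale^~ u : a b / a + b}.
Proof.
move=> a b; rewrite -[u]tensor_sumK !tensor_scaleE.
elim: (repr u) => [|[c v] s IHs] /=; first by rewrite -tensor_sumD.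
rewrite -!(cat1s _ (tmap _ _ _)) !tensor_sumD IHs addrACA; congr (_ + _).
by rewrite -tensor_sumD mulrDl; apply/tensor_sumP/tensor_Dl.
Qed.

HB.instance Definition _ :=
  @GRing.Zmodule_isLmodule.Build R tensor tensor_scale scaleA scale1 scaleDr scaleDl.

Definition pure_tensor (c : R) (v : N) : tensor := tensor_sum [:: (c, v)].

End Tensor.

Section TensorMap.
Variables (R : nzRingType) (N : zmodType) (phi : {additive N -> N}).

Definition id_tensor : tensor R N -> tensor R N := tensor_map id phi.

Let id_tensor_linear : linear id_tensor.
Proof.
move=> c u v; rewrite -[u]tensor_sumK -[v]tensor_sumK.
have idE s : id_tensor (tensor_sum s) = tensor_sum (tmap idfun phi s).
  exact: (tensor_mapE idfun phi).
have ZE s : c *: tensor_sum s = tensor_sum (tmap ( *%R c) id s) :> tensor R N.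
  exact: tensor_scaleE.
rewrite ZE -tensor_sumD !idE ZE -tensor_sumD /tmap map_cat.
by rewrite -!map_comp.
Qed.

HB.instance Definition _ :=
  GRing.isLinear.Build R (tensor R N) (tensor R N) *:%R id_tensor id_tensor_linear.

End TensorMap.
Arguments id_tensor R {N} phi u.

(* N/pN as an F_p-vector space; primality makes 'F_p the ring Z/pZ. *)
Section ModP.
Variables (N : zmodType) (p : nat) (p_pr : prime p).

Definition pmultiples : {pred N} := fun v => `[< exists w : N, v = w *+ p >].

Let pmultiples_closed : zmod_closed pmultiples.
Proof.
split=> [|u v /asboolP[u' ->] /asboolP[v' ->]]; apply/asboolP.
  by exists 0; rewrite mul0rn.
by exists (u' - v'); rewrite mulrnBl.
Qed.

HB.instance Definition _ := GRing.isZmodClosed.Build N pmultiples pmultiples_closed.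

Definition fpquo (pr : prime p) : Type := {ideal_quot pmultiples}.

HB.instance Definition _ := GRing.Zmodule.on (fpquo p_pr).

Definition fpquo_pi (v : N) : fpquo p_pr := \pi_{ideal_quot pmultiples} v.

Lemma fpquo_piD u v : fpquo_pi (u + v) = fpquo_pi u + fpquo_pi v.
Proof. by rewrite /fpquo_pi !piE. Qed.

Lemma fpquo_pi0 : fpquo_pi 0 = 0.
Proof. by rewrite /fpquo_pi !piE. Qed.

Lemma fpquo_piMn u n : fpquo_pi (u *+ n) = fpquo_pi u *+ n.
Proof. by elim: n => [|n IHn]; rewrite ?mulr0n ?fpquo_pi0 // !mulrS fpquo_piD IHn. Qed.

Lemma fpquo_piK (u : fpquo p_pr) : fpquo_pi (repr u) = u.
Proof. exact: reprK. Qed.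

Let fpquo_mulp (v : fpquo p_pr) : v *+ p = 0.
Proof.
rewrite -[v]fpquo_piK -fpquo_piMn -fpquo_pi0; apply/eqP; rewrite -Quotient.idealrBE subr0.
by apply/asboolP; exists (repr v).
Qed.

Let fpquo_mul_mod (v : fpquo p_pr) n : v *+ (n %% p) = v *+ n.
Proof.
by rewrite [in RHS](divn_eq n p) mulrnDr mulnC mulrnA fpquo_mulp mul0rn add0r.
Qed.

Let mod_Fp (v : fpquo p_pr) n : v *+ (n %% (Zp_trunc (pdiv p)).+2) = v *+ n.
Proof. by rewrite Fp_cast // fpquo_mul_mod. Qed.

Definition fpquo_scale (c : 'F_p) (v : fpquo p_pr) : fpquo p_pr := v *+ (c : nat).

Let scaleA a b v : fpquo_scale a (fpquo_scale b v) = fpquo_scale (a * b) v.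
Proof.
by rewrite /fpquo_scale /= mod_Fp mulnC mulrnA.
Qed.
Let scale1 : left_id 1 fpquo_scale.
Proof. by move=> v; rewrite /fpquo_scale /= modn_small ?mulr1n. Qed.
Let scaleDr : right_distributive fpquo_scale +%R.
Proof. by move=> c u v; rewrite /fpquo_scale mulrnDl. Qed.
Let scaleDl v : {morph fpquo_scale^~ v : a b / a + b}.
Proof.
by move=> a b; rewrite /fpquo_scale /= mod_Fp mulrnDr.
Qed.

HB.instance Definition _ :=
  @GRing.Zmodule_isLmodule.Build 'F_p (fpquo p_pr) fpquo_scale
    scaleA scale1 scaleDr scaleDl.

Variable phi : {additive N -> N}.

Definition fpquo_map (v : fpquo p_pr) : fpquo p_pr := fpquo_pi (phi (repr v)).

Lemma fpquo_mapE u : fpquo_map (fpquo_pi u) = fpquo_pi (phi u).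
Proof.
apply/eqP; rewrite -Quotient.idealrBE -raddfB.
have : repr (fpquo_pi u) - u \in pmultiples.
  by rewrite Quotient.idealrBE reprK.
by move=> /asboolP[w ->]; apply/asboolP; exists (phi w); rewrite raddfMn.
Qed.

Let fpquo_map_linear : linear fpquo_map.
Proof.
move=> c u v; rewrite -[u]fpquo_piK -[v]fpquo_piK.
by rewrite /GRing.scale /= /fpquo_scale -fpquo_piMn -fpquo_piD !fpquo_mapE -fpquo_piMn -fpquo_piD raddfD raddfMn.
Qed.

HB.instance Definition _ :=
  GRing.isLinear.Build 'F_p (fpquo p_pr) (fpquo p_pr) *:%R fpquo_map
    fpquo_map_linear.

End ModP.
Arguments fpquo_pi {N p} p_pr v.
Arguments fpquo_map {N p} p_pr phi v.

(* The Laurent polynomial ring F[x, 1/x], as an F[x]-module: finitely supported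
   coefficient functions, on which x acts by the shift. *)
Section Laurent.
Variable F : fieldType.

Definition finsupp : {pred (int -> F^o)} :=
  fun f => `[< finite_set [set n | f n != 0] >].

Let finsupp_closed : submod_closed finsupp.
Proof.
split=> [|c f g /asboolP hf /asboolP hg]; apply/asboolP.
  by apply: sub_finite_set (finite_set0 _) => n /=; rewrite eqxx.
apply: (@sub_finite_set _ _ ([set n | f n != 0] `|` [set n | g n != 0])).
  move=> n /= nz; apply: contrapT => /not_orP[/negP + /negP].
  rewrite !negbK => /eqP f0 /eqP g0; move: nz; rewrite -[(_ + _) n]/(c *: f n + g n).
  by rewrite f0 g0 scaler0 addr0 eqxx.
by rewrite finite_setU.
Qed.

HB.instance Definition _ :=
  GRing.isSubmodClosed.Build F (int -> F^o) finsupp finsupp_closed.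

Record laurent_coefs :=
  LaurentCoefs { laurent_val : int -> F^o; _ : laurent_val \in finsupp }.

HB.instance Definition _ := [isSub for laurent_val].
HB.instance Definition _ := [Choice of laurent_coefs by <:].
HB.instance Definition _ := [SubChoice_isSubZmodule of laurent_coefs by <:].
HB.instance Definition _ := [SubZmodule_isSubLmodule of laurent_coefs by <:].

Let shift_subproof (f : laurent_coefs) :
  (fun n : int => laurent_val f (n - 1)) \in finsupp.
Proof.
apply/asboolP; have /asboolP fin_f := valP f.
apply: sub_finite_set (finite_image (fun n : int => n + 1) fin_f) => n /= fn.
by exists (n - 1); rewrite ?subrK.
Qed.

Definition laurent_shift f : laurent_coefs := LaurentCoefs (shift_subproof f).

Let laurent_shift_linear : linear laurent_shift.
Proof. by move=> c f g; apply: val_inj. Qed.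

HB.instance Definition _ :=
  GRing.isLinear.Build F laurent_coefs laurent_coefs *:%R laurent_shift
    laurent_shift_linear.

Definition laurent : lmodType {poly F} := polymod laurent_shift.

End Laurent.

(* The largest size of a linearly independent family.
   The supremum of an unbounded set of naturals is by convention 0; the sets of
   naturals below are bounded when N comes from a finitely generated group. *)
Definition torsion_free_rank (R : idomainType) (M : lmodType R) : nat :=
  supremum 0%N [set k | exists v : 'I_k -> M,
    forall c : 'I_k -> R, \sum_(i < k) c i *: v i = 0 -> forall i, c i = 0].

Section Invariants.
Variables (N : zmodType) (phi : {additive N -> N}).

Definition rank_mod (p : nat) (p_pr : prime p) : nat :=
  torsion_free_rank (polymod (fpquo_map p_pr phi)).

Definition rank_max : nat :=
  supremum 0%N [set k | exists (p : nat) (p_pr : prime p), k = rank_mod p_pr].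

(* The Q[x]-module isomorphism of [tensor rat N], on which x acts as 1 (x) phi,
   with the sum of the Q[x]/(a j) and of r copies of L. L is meant to be Q[x] or
   Q[x, 1/x]. As phi is invertible, L = Q[x] forces r = 0, whereas the structure
   theorem over Q[x, 1/x], over which [tensor rat N] is finitely generated,
   always provides such an isomorphism with L = Q[x, 1/x]. *)
Definition rational_decomposition (L : lmodType {poly rat})
    (s r : nat) (a : 'I_s -> {poly rat}) : Prop :=
  exists f : {linear polymod (id_tensor rat phi) ->
                     (dirsum (fun j => polyquo (a j) : lmodType _)
                      * dirsum (fun _ : 'I_r => L))%type},
    bijective f.

End Invariants.

Section Growth.
Variable R : realType.
Implicit Types f g : nat -> R.

Definition growth_at_most f g : Prop :=
  exists (C : R) (k : nat), forall n, (k <= n)%N -> `|f n| <= C * g n.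

Definition growth_at_least f g : Prop :=
  exists2 C : R, 0 < C & infinite_set [set n | C * g n <= f n].

Definition growth_type f g : Prop := growth_at_most f g /\ growth_at_least f g.

End Growth.

(* Main.v *)
Require Import Defs.
From HB Require Import structures.
From mathcomp Require Import all_boot all_order all_algebra all_field finmap.
From mathcomp Require Import all_classical all_reals exp zify ring lra.
From mathcomp Require Import generic_quotient ring_quotient.
Import Order.TTheory GRing.Theory Num.Theory.
Local Open Scope classical_set_scope.
Local Open Scope ring_scope.

(** A maximal subgroup of finite index n of G = N x| <t> either contains N, and
    there are at most n of those, or is a supplement M of N. In the second case
    K = M cap N is a maximal submodule of the Z[x]-module N, of index n, and M is
    determined by K together with the class modulo K of an element b such that
    iota b * t lies in M (maximal_adjoin, eq_adjoin). The simple module N/K is a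
    field F_p[x]/(f), so n = p^k is a prime power and, once a field A with p^k
    elements has been fixed, K is the kernel of some nonzero additive map
    psi : N -> A such that psi (phi v) = c * psi v for a root c of f
    (simple_quotient).

    So supplements correspond to triples (c, psi, b), with c a generator of A over
    F_p, psi a nonzero homomorphism for which x acts on A as c, and b in A. Two
    triples give the same supplement exactly when they differ by a power of the
    Frobenius automorphism and a nonzero scalar, so that, with q = p^k, the number
    of supplements of index q is (supplements_count)

      q / (k (q - 1)) * \sum_c (#|Hom_c(N, A)| - 1).

    It remains to know the sizes of the groups Hom_c(N, A). They are q^e as soon as
    there is a family of e elements of N which becomes a basis of N/pN once the
    polynomials that do not vanish at c have been inverted (scard_homs). This is
    used twice.

    - For a fixed p, a maximal independent family of N/pN becomes such a basis once
      one nonzero polynomial g has been inverted. If k is at least the size of g,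
      then g does not vanish at any generator c of A. Hence #|Hom_c| = q^r(p) for
      every c (scard_homs_small), and the number of supplements is at most of the
      order of q^(r(p)+1) / k, and exactly of this order for prime k if r(p) > 0;
      here k is log q up to the constant log p.

    - The decomposition of Q (x) N gives, after clearing denominators, elements
      u_j (j < s) and w_l (l < r) of N and integer polynomials b_j such that, up to
      an integer M and powers of x, N is the sum of the modules Z[x]/(b_j) generated
      by the u_j and of the free module on the w_l (rational_data). For all but
      finitely many p this survives reduction modulo p: #|Hom_c| is q^(s+r) if c is
      a common root of the b_j, at most q^(s+r) at the boundedly many roots of some
      b_j, and at most q^r at every other c. This gives O(q^(s+r) + q^(r+1))
      supplements (supplements_large).

    The upper bounds follow by comparing exponents. For the lower bounds, if
    d > r_max then s > 0, and n is taken to be one of the infinitely many primes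
    modulo which b_0 has a root (primes_with_root); if d = r_max = r then s = 0, and
    n runs through all large primes; otherwise n = p^k, where p is a prime with
    r(p) = r_max and k runs through the primes, so that almost all elements of A
    are generators (card_aperiodic_prime). *)

Set Implicit Arguments.
Unset Strict Implicit.
Unset Printing Implicit Defensive.

(** * Counting by fibres *)

Section Counting.
Implicit Types T U : choiceType.

(** It is 0 on infinite sets, which is why the lemmas below also deliver finiteness. *)
Definition scard T (D : set T) : nat := #|` fset_set D|.

Lemma scard_seq T (D : set T) (s : seq T) :
  uniq s -> (forall x, D x <-> x \in s) -> finite_set D /\ scard D = size s.
Proof.
move=> us Ds; have finD : finite_set D by apply/finite_seqP; exists s; apply/seteqP; split=> x /=; rewrite Ds.
split=> //; apply/perm_size/uniq_perm => // x.
rewrite in_fset_set //; apply/idP/idP; first by rewrite inE => /Ds.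
by rewrite inE => /Ds.
Qed.

Lemma finite_enum T (D : set T) : finite_set D ->
  exists2 s : seq T, uniq s & forall x, D x <-> x \in s.
Proof.
move=> finD; exists (fset_set D) => // x.
by rewrite in_fset_set // inE.
Qed.

Lemma scard_le T (D E : set T) : finite_set E -> D `<=` E -> (scard D <= scard E)%N.
Proof.
move=> finE sDE; have finD := sub_finite_set sDE finE.
apply: fsubset_leq_card; apply/fsubsetP => x.
by rewrite !in_fset_set // !inE; apply: sDE.
Qed.

Lemma scard_image T U (f : T -> U) (D : set T) :
  finite_set D -> (forall x y, D x -> D y -> f x = f y -> x = y) ->
  finite_set (f @` D) /\ scard (f @` D) = scard D.
Proof.
move=> /finite_enum[s us Ds] injf.
have [_ ->] := scard_seq us Ds; rewrite -(size_map f); apply: scard_seq.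
  by rewrite map_inj_in_uniq // => x y /Ds Dx /Ds Dy; apply: injf.
move=> y; split=> [[x /Ds Dx <-]|/mapP[x /Ds Dx ->]]; first exact: map_f.
by exists x.
Qed.

Lemma scard_setT (F : finType) : scard [set: F] = #|F|.
Proof.
have [_ ->] := @scard_seq F setT (enum F) (enum_uniq _) (fun x => conj (fun=> mem_enum F x) (fun=> I)).
by rewrite -cardE.
Qed.

Lemma scard_setX T U (D : set T) (E : set U) : finite_set D -> finite_set E ->
  scard (D `*` E) = (scard D * scard E)%N.
Proof.
move=> /finite_enum[s us Ds] /finite_enum[r ur Er].
have [_ ->] := scard_seq us Ds; have [_ ->] := scard_seq ur Er.
rewrite -(size_allpairs pair); apply scard_seq.
  by rewrite allpairs_uniq // => -[a b] [c d].
move=> [x y]; split=> [[/= /Ds Dx /Er Ey]|/allpairsP[[a b] [/= /Ds Da /Er Eb [-> ->]]]].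
  by apply/allpairsP; exists (x, y).
by [].
Qed.

Lemma scard_inj T U (f : T -> U) (D : set T) (E : set U) :
  finite_set E -> (forall x, D x -> E (f x)) ->
  (forall x y, D x -> D y -> f x = f y -> x = y) ->
  finite_set D /\ (scard D <= scard E)%N.
Proof.
move=> finE fDE injf.
have injf' : {in D &, injective f}.
  by move=> x y; rewrite !inE => Dx Dy; apply: injf.
have sDE : f @` D `<=` E by move=> _ [x Dx <-]; apply: fDE.
have finD : finite_set D.
  have fin_im := sub_finite_set sDE finE.
  by rewrite -(eq_finite_set (inj_card_eq injf')).
split=> //; have [_ <-] := scard_image finD injf; exact: scard_le.
Qed.

Lemma scard_fibers T U (D : set T) (f : T -> U) (Y : seq U) :
  finite_set D -> uniq Y -> (forall x, D x -> f x \in Y) ->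
  scard D = (\sum_(y <- Y) scard (D `&` [set x | f x = y]))%N.
Proof.
move=> /finite_enum[s us Ds] uY fDY.
have [_ ->] := scard_seq us Ds.
have fibE y : scard (D `&` [set x | f x = y]) = count (fun x => f x == y) s.
  rewrite -size_filter.
  have := @scard_seq _ (D `&` [set x | f x = y]) _ (filter_uniq (fun x => f x == y) us).
  case=> // x; rewrite mem_filter; split=> [[/Ds -> /= ->]|/andP[/eqP <- /Ds]] //.
  by rewrite eqxx.
rewrite (eq_bigr _ (fun y _ => fibE y)) {fibE}.
have {}fDY x : x \in s -> f x \in Y by move=> /Ds /fDY.
elim: s {us Ds} fDY => [|x s IH] fDY /=; first by rewrite big1.
rewrite big_split /= -IH; last by move=> z zs; apply: fDY; rewrite inE zs orbT.
rewrite (bigD1_seq (f x)) //=; last by apply: fDY; rewrite mem_head.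
rewrite eqxx big1 ?addn0 // => y ne; apply/eqP.
by rewrite eqb0 eq_sym.
Qed.

Lemma scard_fibers_le T U (f : T -> U) (D : set T) (B : set U) b :
  finite_set D -> finite_set B -> (forall x, D x -> B (f x)) ->
  (forall y, B y -> scard (D `&` [set x | f x = y]) <= b)%N ->
  (scard D <= scard B * b)%N.
Proof.
move=> finD finB fDB fib; have [s us Bs] := finite_enum finB.
have [_ ->] := scard_seq us Bs.
rewrite (scard_fibers (f := f) finD us); last by move=> x /fDB/Bs.
rewrite mulnC -iter_addn_0 -count_predT -big_const_seq big_seq [leqRHS]big_seq.
by apply: leq_sum => y /Bs; apply: fib.
Qed.

(** As all fibres over B are nonempty, B inherits finiteness from D. *)
Lemma scard_fibers_ge T U (f : T -> U) (D : set T) (B : set U) b :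
  finite_set D -> (0 < b)%N ->
  (forall y, B y -> b <= scard (D `&` [set x | f x = y]))%N ->
  finite_set B /\ (scard B * b <= scard D)%N.
Proof.
move=> finD b_gt0 fib.
have finB : finite_set B.
  apply: sub_finite_set (finite_image f finD) => y /fib lb.
  have : scard (D `&` [set x | f x = y]) != 0%N by rewrite -lt0n (leq_trans b_gt0).
  rewrite /scard; apply: contraNP => h; rewrite cardfs_eq0; apply/eqP/fsetP => x.
  rewrite in_fset_set; last exact: finite_setIl.
  rewrite [RHS]inE; apply/negbTE/negP; rewrite inE => -[Dx /= fx]; apply: h.
  by exists x.
split; first exact: finB.
have [s us Bs] := finite_enum finB.
have [_ ->] := scard_seq us Bs.
pose D' := D `&` [set x | B (f x)].
have finD' : finite_set D' by apply: finite_setIl.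
apply: (@leq_trans (scard D')); last by apply: scard_le => // x [].
rewrite (scard_fibers (f := f) finD' us); last by move=> x [_ /Bs].
rewrite mulnC -iter_addn_0 -count_predT -big_const_seq big_seq [leqRHS]big_seq.
apply: leq_sum => y /Bs By; apply: leq_trans (fib _ By) _.
apply: scard_le => [|x [Dx /= fx]]; first exact: finite_setIl.
by split=> //; split=> //=; rewrite fx.
Qed.

End Counting.

(** * Z[x]-modules and their homomorphisms to fields *)

Section IntModule.
Variables (N : zmodType) (phi : {additive N -> N}).

Definition int_endo : zmodule N -> zmodule N := phi.

Let int_endo_linear : linear int_endo.
Proof. by move=> c u v; rewrite /int_endo scalezrE raddfD raddfMz. Qed.

HB.instance Definition _ :=
  GRing.isLinear.Build int (zmodule N) (zmodule N) *:%R int_endo int_endo_linear.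

(** N with x acting as phi. Integer polynomials are the only scalars, so that
    homomorphisms to fields of all characteristics, and the rational tensor product,
    are read off from one module. *)
Definition ZXmod : lmodType {poly int} := polymod int_endo.

Implicit Types (u v : ZXmod) (g h : {poly int}).

Lemma ZXmod_X v : 'X *: v = phi v :> ZXmod.
Proof. exact: polymodX. Qed.

Lemma ZXmod_C (c : int) v : c%:P *: v = v *~ c :> ZXmod.
Proof. by rewrite [LHS](@polymod_scaleC _ _ int_endo). Qed.

Lemma ZXmod_Xn n v : 'X^n *: v = iter n phi v :> ZXmod.
Proof.
by elim: n => [|n IH]; rewrite ?expr0 ?scale1r // exprS -scalerA IH ZXmod_X.
Qed.

Lemma ZXmod_nat (n : nat) v : n%:R *: v = v *+ n :> ZXmod.
Proof. by rewrite scaler_nat. Qed.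

(** Congruences modulo pN are kept as membership in pN rather than as equations in
    the quotient. *)
Definition pmult (p : nat) v := exists w : ZXmod, v = w *+ p.

Lemma pmult0 p : pmult p 0.
Proof. by exists 0; rewrite mul0rn. Qed.

Lemma pmultD p u v : pmult p u -> pmult p v -> pmult p (u + v).
Proof. by move=> [a ->] [b ->]; exists (a + b); rewrite mulrnDl. Qed.

Lemma pmultZ p g v : pmult p v -> pmult p (g *: v).
Proof. by move=> [a ->]; exists (g *: a); rewrite scalerMnr. Qed.

Lemma pmultN p v : pmult p v -> pmult p (- v).
Proof. by move=> [a ->]; exists (- a); rewrite mulNrn. Qed.

Lemma pmultB p u v : pmult p u -> pmult p v -> pmult p (u - v).
Proof. by move=> pu /pmultN; apply: pmultD. Qed.

End IntModule.

Section EvalInt.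
Variable A : comNzRingType.

Definition evz (c : A) : {poly int} -> A := horner_eval c \o map_poly intr.
HB.instance Definition _ c := GRing.RMorphism.copy (evz c) (horner_eval c \o map_poly intr).

Lemma evzX c : evz c 'X = c.
Proof. by rewrite /evz /= map_polyX /horner_eval hornerX. Qed.

Lemma evzC c (z : int) : evz c z%:P = z%:~R.
Proof. by rewrite /evz /= map_polyC /horner_eval hornerC. Qed.

End EvalInt.

Section Homs.
Variables (N : zmodType) (phi : {additive N -> N}) (A : fieldType) (p : nat).
Hypothesis charA : p \in [pchar A].
Local Notation M := (ZXmod phi).
Implicit Types (c : A) (psi : M -> A).

(** Z[x]-module homomorphisms from N to the field A on which x acts as
    multiplication by c. When c generates A, the kernels of the nonzero ones are the
    maximal submodules K for which N/K is isomorphic to A with x corresponding to c. *)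
Definition homs c : set (M -> A) :=
  [set psi : M -> A | (forall u v : M, psi (u + v) = psi u + psi v) /\
             forall v : M, psi (phi v) = c * psi v].

Section OneHom.
Variables (c : A) (psi : M -> A).
Hypothesis hpsi : homs c psi.

Lemma hom0 : psi 0 = 0.
Proof. by apply: (addrI (psi 0)); rewrite -hpsi.1 !addr0. Qed.

Lemma homN v : psi (- v) = - psi v.
Proof. by apply: (addrI (psi v)); rewrite -hpsi.1 !subrr hom0. Qed.

Lemma homB u v : psi (u - v) = psi u - psi v.
Proof. by rewrite hpsi.1 homN. Qed.

Lemma hom_sum (I : Type) (r : seq I) (F : I -> M) :
  psi (\sum_(i <- r) F i) = \sum_(i <- r) psi (F i).
Proof.
by elim/big_rec2: _ => [|i y x _ <-]; rewrite ?hom0 // hpsi.1.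
Qed.

Lemma homMn v n : psi (v *+ n) = psi v *+ n.
Proof. by elim: n => [|n IH]; rewrite ?mulr0n ?hom0 // !mulrS hpsi.1 IH. Qed.

Lemma homMz v (z : int) : psi (v *~ z) = psi v *~ z.
Proof.
case: z => n; first by rewrite -!pmulrn homMn.
by rewrite NegzE !mulrNz homN -!pmulrn homMn.
Qed.

Lemma homZ g v : psi (g *: v) = evz c g * psi v.
Proof.
elim/poly_ind: g v => [|g z IH] v; first by rewrite scale0r hom0 rmorph0 mul0r.
rewrite scalerDl hpsi.1 -scalerA ZXmod_X IH hpsi.2 ZXmod_C homMz.
by rewrite rmorphD rmorphM /= evzX evzC mulrDl mulrA mulrzl.
Qed.

Lemma hom_pmult v : pmult p v -> psi v = 0.
Proof. by case=> w ->; rewrite homMn -mulr_natl (pcharf0 charA) mul0r. Qed.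

End OneHom.

Section Frames.
Variable I : finType.
Implicit Type y : I -> M.

(** Together, spanning_at and free_at say that y is a basis of N/pN after inverting
    the polynomials not vanishing at c; such denominators are harmless, because a
    homomorphism in homs c sees a polynomial only through its value at c. *)
Definition spanning_at c y := forall v : M, exists (g : {poly int}) (h : I -> {poly int}),
  evz c g != 0 /\ pmult p (g *: v - \sum_i h i *: y i).

Definition free_at c y := forall h : I -> {poly int},
  pmult p (\sum_i h i *: y i) -> forall i, evz c (h i) = 0.

Lemma hom_ext c y psi psi' : spanning_at c y -> homs c psi -> homs c psi' ->
  (forall i, psi (y i) = psi' (y i)) -> psi = psi'.
Proof.
move=> span_y hpsi hpsi' eq_y; apply: funext => v.
have [g [h [g_nz /[dup] /(hom_pmult hpsi)/eqP + /(hom_pmult hpsi')/eqP]]] := span_y v.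
rewrite (homB hpsi) (homB hpsi') !subr_eq0 (homZ hpsi) (homZ hpsi') (hom_sum hpsi) (hom_sum hpsi').
move=> /eqP E /eqP E'; apply: (mulfI g_nz); rewrite E E'.
by apply: eq_bigr => i _; rewrite (homZ hpsi) (homZ hpsi') eq_y.
Qed.

(** The value of psi at v is (\sum_i h_i(c) a_i) / g(c) whenever g v is congruent to
    \sum_i h_i y_i modulo p; freeness makes it independent of the choices. *)
Lemma hom_exists c y (a : I -> A) : spanning_at c y -> free_at c y ->
  exists2 psi, homs c psi & forall i, psi (y i) = a i.
Proof.
move=> span_y free_y.
pose rel (v : M) (b : A) := exists (g : {poly int}) (h : I -> {poly int}),
  [/\ evz c g != 0, pmult p (g *: v - \sum_i h i *: y i) &
      b = (\sum_i evz c (h i) * a i) / evz c g].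
have relE v b b' : rel v b -> rel v b' -> b = b'.
  move=> [g [h [g_nz gh ->]]] [g' [h' [g'_nz gh' ->]]].
  apply/eqP; rewrite eqr_div //; apply/eqP.
  have /free_y E : pmult p (\sum_i (h i * g' - h' i * g) *: y i).
    rewrite (_ : \sum_i _ = g *: (g' *: v - \sum_i h' i *: y i) - g' *: (g *: v - \sum_i h i *: y i)).
      by apply: pmultB; apply: pmultZ.
    rewrite !scalerBr !scalerA [g' * g]mulrC opprB addrC subrKA !scaler_sumr -sumrB.
    apply: eq_bigr => i _; rewrite !scalerA scalerBl.
    by rewrite [g' * _]mulrC [g * _]mulrC.
  rewrite !mulr_suml; apply: eq_bigr => i _; rewrite mulrAC [RHS]mulrAC; congr (_ * _).
  apply/eqP; rewrite -subr_eq0 -!rmorphM -rmorphB; exact/eqP/E.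
have rel_ex (v : M) : exists b, rel v b.
  by have [g [h [gnz gh]]] := span_y v; eexists; exists g, h.
have {rel_ex}[psi psiP] : {psi : M -> A & forall v, rel v (psi v)} := choice rel_ex.
exists psi; first split=> [u v|v].
- apply: relE (psiP _) _.
  have [g [h [g_nz gh ->]]] := psiP u; have [g' [h' [g'_nz gh' ->]]] := psiP v.
  exists (g * g'), (fun i => g' * h i + g * h' i); split.
  + by rewrite rmorphM mulf_neq0.
  + rewrite (_ : _ - _ = g' *: (g *: u - \sum_i h i *: y i) + g *: (g' *: v - \sum_i h' i *: y i)).
      by apply: pmultD; apply: pmultZ.
    rewrite scalerDr !scalerBr !scalerA [g' * g]mulrC addrACA -opprD; congr (_ - _).
    rewrite !scaler_sumr -big_split; apply: eq_bigr => i _.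
    by rewrite scalerDl !scalerA.
  + rewrite rmorphM addf_div //; congr (_ / _); rewrite !mulr_suml -big_split.
    apply: eq_bigr => i _; rewrite rmorphD !rmorphM mulrDl.
    by rewrite [evz c g' * _]mulrC [evz c g * _]mulrC !(mulrAC _ (a i)).
- apply: relE (psiP _) _.
  have [g [h [g_nz gh ->]]] := psiP v; exists g, (fun i => 'X * h i); split=> //.
    rewrite -ZXmod_X scalerA mulrC -scalerA.
    rewrite (eq_bigr (fun i => 'X *: (h i *: y i))) => [|i _]; last by rewrite scalerA.
    by rewrite -scaler_sumr -scalerBr; apply: pmultZ.
  rewrite mulrA mulr_sumr; congr (_ / _); apply: eq_bigr => i _.
  by rewrite rmorphM /= evzX mulrA.
- move=> i; apply: relE (psiP _) _; exists 1, (fun j => (j == i)%:R); split.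
  + by rewrite rmorph1 oner_eq0.
  + rewrite (bigD1 i) //= eqxx big1 ?addr0 ?subrr; first exact: pmult0.
    by move=> j /negPf ->; rewrite scale0r.
  + rewrite rmorph1 divr1 (bigD1 i) //= eqxx rmorph1 mul1r big1 ?addr0 //.
    by move=> j /negPf ->; rewrite rmorph0 mul0r.
Qed.

End Frames.
End Homs.
Arguments homs {N} phi {A} c.

Section CountHoms.
Variables (N : zmodType) (phi : {additive N -> N}) (A : finFieldType) (p : nat).
Hypothesis charA : p \in [pchar A].
Variables (c : A) (I : finType) (y : I -> ZXmod phi).
Hypothesis span_y : spanning_at p c y.

Let f (psi : ZXmod phi -> A) : {ffun I -> A} := [ffun i => psi (y i)].

Let f_inj psi psi' : homs phi c psi -> homs phi c psi' -> f psi = f psi' -> psi = psi'.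
Proof.
move=> hpsi hpsi' /ffunP E; apply: (hom_ext charA span_y) => // i.
by have := E i; rewrite !ffunE.
Qed.

Lemma scard_homs_le : finite_set (homs phi c) /\ (scard (homs phi c) <= #|A| ^ #|I|)%N.
Proof.
rewrite -card_ffun -scard_setT.
by apply: (scard_inj (f := f)) f_inj => //; exact: finite_finset.
Qed.

Lemma scard_homs : free_at p c y -> scard (homs phi c) = (#|A| ^ #|I|)%N.
Proof.
move=> free_y; have [fin_homs _] := scard_homs_le.
have [_ <-] := scard_image fin_homs f_inj; rewrite -card_ffun -scard_setT; congr scard.
apply/seteqP; split=> // a _.
have [psi hpsi psi_a] := hom_exists a span_y free_y.
by exists psi => //; apply/ffunP => i; rewrite ffunE.
Qed.

End CountHoms.

(** * Finite fields *)

Lemma size_XnsubX (R : nzRingType) n : (1 < n)%N -> size ('X^n - 'X : {poly R}) = n.+1.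
Proof. by move=> n1; rewrite size_polyDl size_polyXn // size_polyN size_polyX ltnS. Qed.

Section Reduction.
Variables (p : nat) (p_pr : prime p).
Implicit Types g h : {poly int}.

Definition redp g : {poly 'F_p} := map_poly intr g.
HB.instance Definition _ := GRing.RMorphism.copy redp (map_poly intr).

(** A section of redp. It is not a morphism, but in characteristic p the value of a
    polynomial depends only on its reduction (evz_redp), so it can be computed with
    as if it were one. *)
Definition liftp (f : {poly 'F_p}) : {poly int} :=
  \poly_(i < size f) ((f`_i)%R : nat)%:Z.

Lemma liftpK : cancel liftp redp.
Proof.
move=> f; apply/polyP => i; rewrite coef_map coef_poly.
case: ltnP => hi; last by rewrite nth_default // rmorph0.
exact: natr_Zp.
Qed.

Lemma size_liftp_le f : (size (liftp f) <= size f)%N.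
Proof. exact: size_poly. Qed.

Let coef_charE (A : nzRingType) (charA : p \in [pchar A]) g :
  (map_poly intr g == 0 :> {poly A}) = [forall i : 'I_(size g), (p %| g`_i)%Z].
Proof.
apply/eqP/forallP => [E i|E].
  by rewrite (dvdz_pcharf charA) -coef_map E coef0.
apply/polyP => i; rewrite coef_map coef0; apply/eqP.
rewrite -(dvdz_pcharf charA); case: (ltnP i (size g)) => hi; first exact: (E (Ordinal hi)).
by rewrite nth_default.
Qed.

(** Whether p divides all coefficients can be tested in any ring of characteristic p. *)
Lemma redp_eq0 (A : nzRingType) (charA : p \in [pchar A]) g :
  (map_poly intr g == 0 :> {poly A}) = (redp g == 0).
Proof. by rewrite (coef_charE charA) -(coef_charE (pchar_Fp p_pr)). Qed.

Lemma redp0P g : redp g = 0 -> exists h, g = h *+ p.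
Proof.
move/eqP; rewrite coef_charE ?pchar_Fp // => /forallP dv.
exists (\poly_(i < size g) (g`_i %/ p)%Z); apply/polyP => i.
rewrite coefMn coef_poly; case: ltnP => hi; last by rewrite nth_default ?mul0rn.
by rewrite -[in LHS](divzK (dv (Ordinal hi))) /= -mulr_natr natz.
Qed.

Lemma redp_nat : redp p%:R = 0.
Proof. by rewrite rmorph_nat /= -(rmorph_nat polyC) pcharf0 ?pchar_Fp. Qed.

Lemma redp_XnsubX n : (1 < n)%N -> redp ('X^n - 'X) != 0.
Proof.
move=> n1; rewrite rmorphB /= rmorphXn /= /redp map_polyX -size_poly_eq0.
by rewrite size_XnsubX.
Qed.

Variable (A : fieldType).
Hypothesis charA : p \in [pchar A].

Lemma evz_redp (c : A) g h : redp g = redp h -> evz c g = evz c h.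
Proof.
move=> E; have /redp0P[u D] : redp (g - h) = 0 by rewrite rmorphB /= E subrr.
by apply/eqP; rewrite -subr_eq0 -rmorphB /= D rmorphMn /= -mulr_natl (pcharf0 charA) mul0r.
Qed.

Lemma evz_redp0 (c : A) g : redp g = 0 -> evz c g = 0.
Proof. by move=> E; rewrite (@evz_redp _ _ 0) ?rmorph0. Qed.

Lemma evz_roots g (s : seq A) :
  redp g != 0 -> uniq s -> (forall c, c \in s -> evz c g = 0) -> (size s < size g)%N.
Proof.
move=> nz us roots; have := max_poly_roots _ _ us.
move=> /(_ (map_poly intr g)); rewrite redp_eq0 // => /(_ nz) bd.
apply: leq_trans (size_poly _ _); apply: bd.
by apply/allP => c /roots E; rewrite rootE; apply/eqP.
Qed.

End Reduction.

Section FiniteField.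
Variables (p k : nat) (A : finFieldType).
Hypotheses (p_pr : prime p) (k_gt0 : (0 < k)%N) (cardA : #|A| = (p ^ k)%N).

Lemma charA : p \in [pchar A].
Proof. exact: card_finPcharP cardA p_pr. Qed.

Let Frob : {rmorphism A -> A} := pFrobenius_aut charA.

Lemma frobE i (x : A) : iter i Frob x = x ^+ (p ^ i).
Proof.
elim: i => [|i IH]; first by rewrite expr1.
by rewrite iterS IH /Frob /= pFrobenius_autE -exprM -expnSr.
Qed.

Lemma frob_inj i : injective (fun x : A => x ^+ (p ^ i)).
Proof.
move=> x y; rewrite -!frobE; elim: i => //= i IH /fmorph_inj; exact: IH.
Qed.

Lemma frobD i (x y : A) : (x + y) ^+ (p ^ i) = x ^+ (p ^ i) + y ^+ (p ^ i).
Proof. by rewrite -!frobE; elim: i => //= i ->; rewrite rmorphD. Qed.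

Lemma evz_frob i (c : A) g : evz (c ^+ (p ^ i)) g = evz c g ^+ (p ^ i).
Proof.
rewrite -!frobE; elim: i => //= i <-.
rewrite /evz /= /horner_eval -horner_map -map_poly_comp; congr (_.[_]).
by apply: eq_map_poly => z /=; rewrite rmorph_int.
Qed.

(** The k conjugates of c under Frobenius are distinct; in a field with p^k elements
    this says that c generates the field over F_p (evz_surj, aperiodicP). *)
Definition aperiodic (c : A) := forall j, (0 < j < k)%N -> c ^+ (p ^ j) != c.

Lemma frob_orbit_inj c i j : aperiodic c -> (i < k)%N -> (j < k)%N ->
  c ^+ (p ^ i) = c ^+ (p ^ j) -> i = j.
Proof.
move=> apc; wlog lt_ij : i j / (i < j)%N.
  move=> th; case: (ltngtP i j) => // ij ik jk E; first exact: th.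
  by apply/esym; apply: th.
move=> _ jk E; suff /eqP : c ^+ (p ^ (j - i)) = c.
  by rewrite (negPf (apc _ _)) // subn_gt0 lt_ij (leq_ltn_trans (leq_subr _ _)).
apply: (@frob_inj i).
by rewrite /= -exprM -expnD subnK 1?ltnW.
Qed.

(** A polynomial over F_p that vanishes at c vanishes at its k conjugates. *)
Lemma evz_aperiodic c g : aperiodic c -> redp p g != 0 -> (size g <= k)%N -> evz c g != 0.
Proof.
move=> apc nz sz; apply/negP => /eqP E.
have := evz_roots p_pr charA nz (s := [seq c ^+ (p ^ i) | i <- iota 0 k]).
rewrite size_map size_iota ltnNge sz => /(_ _ _)/negP; apply=> //.
  rewrite map_inj_in_uniq ?iota_uniq // => i j; rewrite !mem_iota !add0n.
  exact: frob_orbit_inj.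
move=> _ /mapP[i _ ->]; rewrite evz_frob E expr0n expn_eq0.
by case: p p_pr.
Qed.

Let polyval n (a : {ffun 'I_n -> 'F_p}) : {poly int} := liftp (\poly_(i < n) (if insub i is Some i' then a i' else 0)).

Let polyval_inj n (a b : {ffun 'I_n -> 'F_p}) :
  redp p (polyval a - polyval b) = 0 -> a = b.
Proof.
rewrite rmorphB /= !liftpK => /eqP; rewrite subr_eq0 => /eqP/polyP E.
by apply/ffunP => i; have := E i; rewrite !coef_poly ltn_ord valK.
Qed.

Let size_polyval n (a b : {ffun 'I_n -> 'F_p}) : (size (polyval a - polyval b)%R <= n)%N.
Proof.
apply: leq_trans (size_polyD _ _) _; rewrite size_polyN geq_max.
by rewrite !(leq_trans (size_liftp_le _)) ?size_poly.
Qed.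

(** The polynomials of size at most k over F_p take distinct values at c, and there
    are as many of them as elements of A. *)
Lemma evz_surj c : aperiodic c -> forall y, exists g, evz c g = y.
Proof.
move=> apc y.
pose f (a : {ffun 'I_k -> 'F_p}) := evz c (polyval a).
have f_inj : injective f.
  move=> a b /eqP; rewrite -subr_eq0 -rmorphB /= => E.
  apply: polyval_inj; apply/eqP; move: E; apply: contraTT => nz.
  exact: evz_aperiodic.
have := inj_card_onto f_inj; rewrite card_ffun card_Fp // card_ord cardA leqnn.
by move=> /(_ isT y)/codomP[a ->]; exists (polyval a).
Qed.

(** There are more polynomials of size at most k.+1 over F_p than elements of A, so
    two of them agree at c. *)
Lemma evz_annul (c : A) : exists2 g, redp p g != 0 & (size g <= k.+1)%N /\ evz c g = 0.
Proof.
pose f (a : {ffun 'I_k.+1 -> 'F_p}) := evz c (polyval a).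
have /injectivePn[a [b neq E]] : ~~ injectiveb f.
  apply/injectiveP => /leq_card; rewrite card_ffun card_Fp // card_ord cardA.
  by rewrite leqNgt ltn_exp2l ?prime_gt1 // ltnSn.
exists (polyval a - polyval b).
  by apply: contraNN neq => /eqP/polyval_inj ->.
by split=> //; rewrite rmorphB /=; apply/eqP; rewrite subr_eq0; apply/eqP.
Qed.

(** These are the Frobenius conjugates of c. *)
Definition conjugates (c : A) : set A := [set c' | forall g, evz c g = 0 -> evz c' g = 0].

Lemma card_conjugates (c : A) : (scard (conjugates c) <= k)%N.
Proof.
have [g nz [sz gc]] := evz_annul c.
have [s us Ds] := finite_enum (@finite_finset A (conjugates c)).
have [_ ->] := scard_seq us Ds; rewrite -ltnS (leq_trans _ sz) //.
by apply: (evz_roots p_pr charA nz us) => c' /Ds; apply.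
Qed.

(** An element fixed by the j-th power of Frobenius generates a subring fixed by it,
    which has at most p^j elements. *)
Lemma aperiodicP (c : A) : (forall y, exists g, evz c g = y) -> aperiodic c.
Proof.
move=> surj j /andP[j0 jk]; apply/negP => /eqP E.
have fixed (y : A) : y ^+ (p ^ j) = y by have [g <-] := surj y; rewrite -evz_frob E.
have pj1 : (1 < p ^ j)%N by rewrite -(exp1n j) ltn_exp2r ?prime_gt1.
have nz := @redp_XnsubX p _ pj1.
have := evz_roots p_pr charA nz (enum_uniq A).
rewrite -cardE cardA size_XnsubX // ltnS leq_exp2l ?prime_gt1 // leqNgt jk => h.
suff: false by []. apply: h => c' _.
by rewrite rmorphB rmorphXn /= evzX fixed subrr.
Qed.

Lemma aperiodic1 c : k = 1%N -> aperiodic c.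
Proof. by move=> k1 [|[|j]]; rewrite k1. Qed.

(** If c is fixed by the j-th power of Frobenius for some 0 < j < k, then it is also
    fixed by the k-th one, and j and k are coprime; hence c^p = c. *)
Lemma aperiodic_prime c : prime k -> c ^+ p != c -> aperiodic c.
Proof.
move=> k_pr cp j /andP[j0 jk]; apply: contraNN cp => /eqP E.
have Ek : c ^+ (p ^ k) = c by rewrite -cardA expf_card.
have per i m : c ^+ (p ^ i) = c -> c ^+ (p ^ (m * i)) = c.
  by move=> Ei; elim: m => [|m IH]; rewrite ?expr1 // mulSn expnD exprM Ei IH.
have cop : coprime j k.
  by rewrite coprime_sym prime_coprime // gtnNdvd.
have [u v D _] := egcdnP k j0.
move: cop; rewrite /coprime => /eqP G; rewrite G in D.
have : c ^+ (p ^ (u * j)) = c ^+ p by rewrite D expnD expn1 exprM per.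
by move=> <-; rewrite per.
Qed.

Lemma card_aperiodic_prime : prime k ->
  (p ^ k <= scard [set c : A | aperiodic c] + p)%N.
Proof.
move=> k_pr.
pose F := [set c : A | c ^+ p = c].
have nz := @redp_XnsubX p _ (prime_gt1 p_pr).
have [s us Ds] := finite_enum (@finite_finset A F).
have sp : (size s <= p)%N.
  rewrite -ltnS -(@size_XnsubX int p) ?prime_gt1 //; apply: (evz_roots p_pr charA nz us).
  by move=> c' /Ds /= E; rewrite rmorphB rmorphXn /= evzX E subrr.
rewrite -cardA -scard_setT.
have [r ur Dr] := finite_enum (@finite_finset A [set c : A | aperiodic c]).
have [_ ->] := scard_seq ur Dr; have [_ E] := @scard_seq _ setT (enum A) (enum_uniq _) (fun x => conj (fun=> mem_enum A x) (fun=> I)).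
rewrite E; apply: leq_trans (leq_add (leqnn _) sp).
rewrite -size_cat; apply: uniq_leq_size; first exact: enum_uniq.
move=> c _; rewrite mem_cat; case: (eqVneq (c ^+ p) c) => [/Ds ->|ne]; first by rewrite orbT.
by apply/orP; left; apply/Dr; apply: aperiodic_prime.
Qed.

Section RootOfIrreducible.
Variable f : {poly 'F_p}.
Hypotheses (f_irr : irreducible_poly f) (f_monic : f \is monic) (szf : size f = k.+1).

(** Fermat in the field F_p[x]/(f), applied to the class of x. *)
Let f_dvd_Xq : f %| 'X^(p ^ k) - 'X.
Proof.
pose hI : monic_irreducible_poly f := (f_irr, f_monic).
have := @expf_card {poly %/ f with hI} (in_qpoly f 'X).
rewrite card_qfpoly szf /= card_Fp // => E.
have : in_qpoly f ('X^(p ^ k) - 'X) = 0.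
  by rewrite rmorphB rmorphXn; apply/eqP; rewrite subr_eq0; apply/eqP; exact: E.
move/(congr1 (fun u : {poly %/ f} => u : {poly 'F_p})).
by rewrite /= mk_monicE // => E0; rewrite /dvdp Pdiv.IdomainMonic.modpE // E0.
Qed.

(** The polynomial X^(p^k) - X vanishes on the whole of A and is a multiple of f; the
    cofactor is too small to account for all p^k roots. *)
Lemma irreducible_root : exists c : A, forall g, (f %| redp p g) = (evz c g == 0).
Proof.
have [c rc] : exists c : A, evz c (liftp f) = 0.
  apply: contrapT => /forallNP noroot.
  have [h D] := dvdpP _ _ f_dvd_Xq.
  have pk1 : (1 < p ^ k)%N by rewrite -(exp1n k) ltn_exp2r ?prime_gt1.
  have nz : 'X^(p ^ k) - 'X != 0 :> {poly 'F_p} by rewrite -size_poly_eq0 size_XnsubX.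
  have h_nz : redp p (liftp h) != 0.
    by rewrite liftpK; apply: contraNneq nz => h0; rewrite D h0 mul0r.
  have := evz_roots p_pr charA h_nz (enum_uniq A).
  rewrite -cardE cardA => /(_ _)/leq_trans -/(_ (p ^ k)%N).
  rewrite ltnn => /(_ _ _)/negP; apply=> //.
    move=> c _; have /eqP : evz c (liftp h * liftp f) = 0.
      rewrite (@evz_redp _ p_pr _ charA _ _ ('X^(p ^ k) - 'X)).
        by rewrite rmorphB rmorphXn /= evzX -cardA expf_card subrr.
      by rewrite rmorphM rmorphB rmorphXn /= !liftpK /redp map_polyX D.
    by rewrite rmorphM mulf_eq0 /= => /orP[/eqP //|/eqP /noroot].
  apply: leq_trans (size_liftp_le _) _.
  have : size ('X^(p ^ k) - 'X : {poly 'F_p}) = (p ^ k).+1 by rewrite size_XnsubX.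
  rewrite liftpK in h_nz.
  rewrite D (size_mul h_nz (monic_neq0 f_monic)) szf addnS /= => E.
  by rewrite -ltnS -E -addn1 leq_add2l.
exists c => g; apply/idP/eqP => [/dvdpP[h D]|E].
  rewrite (@evz_redp _ p_pr _ charA _ _ (liftp h * liftp f)) ?rmorphM /= ?rc ?mulr0 //.
  by rewrite !liftpK.
apply: contraT => ndv; have : coprimep f (redp p g) by rewrite irreducible_poly_coprime.
case/Bezout_eq1_coprimepP => -[u v] /= D.
have /eqP : evz c (liftp u * liftp f + liftp v * g) = evz c 1.
  by apply: (evz_redp p_pr charA); rewrite rmorphD !rmorphM !rmorph1 /= !liftpK.
by rewrite rmorphD !rmorphM rmorph1 /= rc E !mulr0 addr0 eq_sym oner_eq0.
Qed.

End RootOfIrreducible.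
End FiniteField.

(** * Submodules of N extended by a complement *)

Section Index.
Local Open Scope group_scope.
Variable G : groupType.
Implicit Types (H : set G) (g h t : G).

Lemma subgroupP H : subgroup H <->
  H 1 /\ forall g h, H g -> H h -> H (g * h^-1).
Proof.
split=> [[H1 HB]|[H1 HB]]; split=> [|g h].
- by rewrite inE in H1.
- by move=> Hg Hh; have := HB g h; rewrite !inE; apply.
- by rewrite inE.
- by rewrite !inE; apply: HB.
Qed.

Section Subgroup.
Variable H : set G.
Hypothesis sH : subgroup H.

Lemma subgroup1 : H 1. Proof. by have /subgroupP[] := sH. Qed.
Lemma subgroupV g : H g -> H g^-1.
Proof. by move=> Hg; have /subgroupP[H1 /(_ _ _ H1 Hg)] := sH; rewrite mul1g. Qed.
Lemma subgroupM g h : H g -> H h -> H (g * h).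
Proof. by move=> Hg /subgroupV Hh; have /subgroupP[_ /(_ _ _ Hg Hh)] := sH; rewrite invgK. Qed.
Lemma subgroupMl g h : H g -> H (g * h) <-> H h.
Proof.
move=> Hg; split=> [|/(subgroupM Hg) //].
by move/(subgroupM (subgroupV Hg)); rewrite mulKg.
Qed.
Lemma subgroupMr g h : H g -> H (h * g) <-> H h.
Proof.
move=> Hg; split=> [/subgroupM/(_ (subgroupV Hg))|Hh]; first by rewrite mulgK.
exact: subgroupM.
Qed.

Lemma eq_lcoset g h : lcoset g H = lcoset h H <-> H (g^-1 * h).
Proof.
split=> [E|Hgh].
  have : lcoset h H h by exists 1; rewrite ?mulg1 //; exact: subgroup1.
  by rewrite -E => -[x Hx <-]; rewrite mulKg.
apply/seteqP; split=> _ [x Hx <-].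
  exists ((g^-1 * h)^-1 * x); last by rewrite invgM invgK mulgA mulVKg.
  by apply: subgroupM => //; apply: subgroupV.
exists (g^-1 * h * x); first exact: subgroupM.
by rewrite -mulgA mulVKg.
Qed.

(** An index is handled through a labelling of the cosets. *)
Lemma index_fun n : has_index H n <->
  exists2 e : G -> 'I_n, (forall g h, e g = e h <-> H (g^-1 * h)) & forall i, exists g, e g = i.
Proof.
split=> [/card_set_bijP[f [fI f_inj f_surj]]|[e eE e_surj]].
  have lt_f g : (f (lcoset g H) < n)%N by apply: fI; exists g.
  exists (fun g => Ordinal (lt_f g)).
    move=> g h; rewrite -eq_lcoset; split=> [[]|E].
      by move/f_inj; apply; rewrite inE; eexists.
    by apply: val_inj; rewrite /= E.
  move=> i; have /f_surj[_ [g _ <-] fi] : `I_n i by exact: ltn_ord.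
  by exists g; apply: val_inj.
apply/card_set_bijP.
pose f (C : set G) := if pselect (exists g, C = lcoset g H) is left P then val (e (projT1 (cid P))) else 0%N.
have fE g : f (lcoset g H) = e g.
  rewrite /f; case: pselect => [P|[]]; last by exists g.
  by congr val; apply/eE; apply/eq_lcoset; rewrite -(projT2 (cid P)).
exists f; split.
- by move=> _ [g _ <-]; rewrite fE /=.
- move=> C D; rewrite !inE => -[g _ <-] [h _ <-]; rewrite !fE => E.
  by apply/eq_lcoset/eE/val_inj.
- move=> i /= lt_in; have [g eg] := e_surj (Ordinal lt_in).
  by exists (lcoset g H); [exists g|rewrite fE eg].
Qed.

End Subgroup.

Lemma zpow0 t : zpow t 0 = 1. Proof. by []. Qed.

Lemma zpowS t (k : int) : zpow t (k + 1)%R = zpow t k * t.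
Proof.
case: k => n; first by rewrite -PoszD addn1 /= expgSr.
rewrite NegzE; case: n => [|n]; first by rewrite addNr /= expg1 mulVg.
rewrite -[n.+2]addn1 PoszD opprD subrK -opprD -PoszD addn1 -!NegzE.
change (t ^- n.+1 = t ^- n.+2 * t).
by rewrite [t ^+ n.+2]expgS invgM mulgVK.
Qed.

Lemma zpowB1 t (k : int) : zpow t (k - 1)%R = zpow t k * t^-1.
Proof. by rewrite -{2}[k](subrK 1%R) zpowS mulgK. Qed.

Lemma int_rect_step (P : int -> Prop) :
  P 0%R -> (forall k, P k -> P (k + 1)%R) -> (forall k, P k -> P (k - 1)%R) -> forall k, P k.
Proof.
move=> P0 PS PB; elim/int_ind => // n; first by rewrite -addn1 PoszD; apply: PS.
by rewrite -addn1 PoszD opprD; apply: PB.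
Qed.

Lemma zpowD t (j k : int) : zpow t (j + k)%R = zpow t j * zpow t k.
Proof.
elim/int_rect_step: k => [|k IH|k IH]; first by rewrite addr0 mulg1.
  by rewrite addrA !zpowS IH mulgA.
by rewrite addrA !zpowB1 IH mulgA.
Qed.

Lemma zpowN t (k : int) : zpow t (- k)%R = (zpow t k)^-1.
Proof. by apply: (mulgI (zpow t k)); rewrite -zpowD subrr mulgV. Qed.

Lemma subgroup_zpow H t k : subgroup H -> H t -> H (zpow t k).
Proof.
move=> sH Ht; elim/int_rect_step: k => [|k Hk|k Hk]; first exact: subgroup1.
  by rewrite zpowS; apply: subgroupM.
by rewrite zpowB1; apply: subgroupM => //; apply: subgroupV.
Qed.

End Index.

Section Semidirect.
Local Open Scope group_scope.
Variables (G : groupType) (N : zmodType) (iota : N -> G) (phi : {additive N -> N}).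

(** The Z[x, 1/x]-submodules of N; the equivalence in the last clause stands for
    closure under the inverse of phi. *)
Definition phi_stable (W : set N) : Prop :=
  [/\ W 0%R, forall u v, W u -> W v -> W (u - v)%R & forall v, W (phi v) <-> W v].

Section Invariant.
Variable W : set N.
Hypothesis hW : phi_stable W.
Lemma stable0 : W 0%R. Proof. by case: hW. Qed.
Lemma stableB u v : W u -> W v -> W (u - v)%R. Proof. by case: hW => _ + _; apply. Qed.
Lemma stableN v : W v -> W (- v)%R.
Proof. by move=> Wv; rewrite -sub0r; apply: stableB => //; apply: stable0. Qed.
Lemma stableD u v : W u -> W v -> W (u + v)%R.
Proof. by move=> Wu /stableN; rewrite -{2}[v]opprK; apply: stableB. Qed.
Lemma stable_phi v : W (phi v) <-> W v. Proof. by case: hW. Qed.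
End Invariant.

(** For a stable W, the subgroup generated by the image of W and by t. *)
Definition adjoin (W : set N) (t : G) : set G :=
  [set g | exists v k, W v /\ g = iota v * zpow t k].

(** The index is stated through a labelling e of the classes modulo K. *)
Definition maximal_stable (K : set N) (n : nat) : Prop :=
  [/\ phi_stable K, K != setT,
      forall W, phi_stable W -> K `<=` W -> W = K \/ W = setT &
      exists2 e : N -> 'I_n, (forall u v, e u = e v <-> K (u - v)%R) & forall i, exists v, e v = i].

Variable t : G.
Hypothesis sd : semidirect_by_Z iota t phi.

Lemma embD u v : iota (u + v)%R = iota u * iota v. Proof. exact: sdZ_morph sd _ _. Qed.
Lemma emb0 : iota 0%R = 1.
Proof. by apply: (mulgI (iota 0%R)); rewrite -embD addr0 mulg1. Qed.
Lemma embN v : iota (- v)%R = (iota v)^-1.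
Proof. by apply: (mulgI (iota v)); rewrite -embD subrr emb0 mulgV. Qed.

Lemma t_iota v : t * iota v = iota (phi v) * t.
Proof. by rewrite -(sdZ_conj sd) mulgVK. Qed.

Lemma tV_iota v : t^-1 * iota (phi v) = iota v * t^-1.
Proof. by apply: (mulgI t); rewrite mulVKg mulgA t_iota mulgK. Qed.

Lemma phi_surj v : exists u, phi u = v.
Proof.
have [u E] := sdZ_normal sd t^-1 v; exists u; apply: (sdZ_inj sd).
by rewrite -(sdZ_conj sd) -E invgK !mulgA mulgV mul1g mulgK.
Qed.

(** The element v' is the k-th iterate of phi at v. That it lies in the same stable
    subgroups as v is all that matters, and avoids negative iterates. *)
Lemma zpow_iota k v : exists2 v', zpow t k * iota v = iota v' * zpow t k &
  forall W, phi_stable W -> W v' <-> W v.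
Proof.
elim/int_rect_step: k v => [|k IH|k IH] v.
- by exists v; rewrite ?zpow0 ?mul1g ?mulg1.
- have [v' E h] := IH (phi v); exists v'.
    by rewrite zpowS -mulgA t_iota mulgA E mulgA.
  by move=> W hW; rewrite h // stable_phi.
- have [u <-] := phi_surj v; have [v' E h] := IH u; exists v'.
    by rewrite zpowB1 -mulgA tV_iota mulgA E mulgA.
  by move=> W hW; rewrite h // stable_phi.
Qed.


Lemma adjoin_subgroup W : phi_stable W -> subgroup (adjoin W t).
Proof.
move=> hW; apply/subgroupP; split.
  by exists 0%R, 0%R; rewrite zpow0 emb0 mulg1; split=> //; exact: stable0.
move=> _ _ [u [j [Wu ->]]] [v [k [Wv ->]]].
have [v' E h] := zpow_iota (j - k) (- v)%R.
exists (u + v')%R, (j - k)%R; split.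
  by apply: stableD => //; apply/h => //; apply: stableN.
by rewrite embD -[RHS]mulgA -E embN zpowD zpowN invgM !mulgA.
Qed.

Lemma decomp_inj u j v k : iota u * zpow t j = iota v * zpow t k -> u = v /\ j = k.
Proof.
move=> E; have [[w l] [_ uniq]] := sdZ_decomp sd (iota u * zpow t j).
by have := uniq (u, j) erefl; rewrite (uniq (v, k) E) => -[-> ->].
Qed.

Lemma decomp_ex g : exists u k, g = iota u * zpow t k.
Proof. by have [[w l] [E _]] := sdZ_decomp sd g; exists w, l. Qed.

Lemma adjoinE W u k : adjoin W t (iota u * zpow t k) <-> W u.
Proof. by split=> [[v [j [Wv /decomp_inj[-> _]]]]|Wu] //; exists u, k. Qed.

Lemma adjoin_iota W u : adjoin W t (iota u) <-> W u.
Proof. by rewrite -(adjoinE W u 0) zpow0 mulg1. Qed.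

Lemma adjoinT : adjoin setT t = setT.
Proof. by apply/seteqP; split=> // g _; have [u [k ->]] := decomp_ex g; apply/adjoinE. Qed.

Lemma stable_restrict (H : set G) : subgroup H -> H t -> phi_stable [set v | H (iota v)].
Proof.
move=> sH Ht; split=> [|u v Hu Hv|v] /=; rewrite ?emb0.
- exact: subgroup1.
- by rewrite embD embN; apply: subgroupM => //; apply: subgroupV.
- by rewrite -(sdZ_conj sd) subgroupMr ?subgroupMl //; apply: subgroupV.
Qed.

Lemma adjoin_restrict (H : set G) : subgroup H -> H t -> H = adjoin [set v | H (iota v)] t.
Proof.
move=> sH Ht; apply/seteqP; split=> g; have [u [k ->]] := decomp_ex g.
  by move=> /(subgroupMr sH (iota u) (subgroup_zpow k sH Ht)) Hu; apply/adjoinE.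
by move/adjoinE=> /= Hu; apply: subgroupM => //; apply: subgroup_zpow.
Qed.

(** A subgroup containing t is determined by its intersection with N, so that its
    maximality can be tested on submodules; and the class of iota v * t^j modulo
    adjoin K t is given by the class of v modulo K. *)
Lemma adjoin_maximal K n : maximal_stable K n ->
  maximal_subgroup (adjoin K t) /\ has_index (adjoin K t) n.
Proof.
move=> [hK KT maxK [e eE e_surj]]; split; first split.
- exact: adjoin_subgroup.
- apply: contra_neq KT => E; apply/seteqP; split=> // v _.
  by apply/adjoin_iota; rewrite E.
- move=> H sH sKH.
  have Ht : H t by apply: sKH; exists 0%R, 1%R; rewrite emb0 mul1g /= expg1; split=> //; exact: stable0.
  rewrite (adjoin_restrict sH Ht).
  case: (maxK _ (stable_restrict sH Ht)) => [v Kv|->|->].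
  + by apply: sKH; apply/adjoin_iota.
  + by left.
  + by right; exact: adjoinT.
- apply/index_fun; first exact: adjoin_subgroup.
  pose part g := projT1 (cid (decomp_ex g)).
  have partE g : exists k, g = iota (part g) * zpow t k by exact: projT2 (cid (decomp_ex g)).
  have part_iota u : part (iota u) = u.
    by have [k] := partE (iota u); rewrite -{1}[iota u]mulg1 -(zpow0 t) => /decomp_inj[].
  exists (e \o part) => [g h /=|i]; last first.
    by have [v <-] := e_surj i; exists (iota v); rewrite /= part_iota.
  have [j gE] := partE g; have [k hE] := partE h; rewrite eE {2}gE {2}hE.
  set u := part g; set v := part h.
  have -> : (iota u * zpow t j)^-1 * (iota v * zpow t k) = zpow t (- j) * iota (v - u)%R * zpow t k.
    by rewrite invgM -zpowN -!mulgA [(v - u)%R]addrC embD embN !mulgA.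
  have [w -> hw] := zpow_iota (- j) (v - u)%R.
  rewrite -mulgA -zpowD adjoinE hw //; split=> /(stableN hK); by rewrite opprB.
Qed.

End Semidirect.

(** * Maximal subgroups of a semidirect product *)

Section MaximalSubgroups.
Local Open Scope group_scope.
Variables (G : groupType) (N : zmodType) (iota : N -> G) (phi : {additive N -> N}) (t : G).
Hypothesis sd : semidirect_by_Z iota t phi.

Lemma zpow_iotaM b k : exists w, zpow (iota b * t) k = iota w * zpow t k.
Proof.
elim/int_rect_step: k => [|k [w E]|k [w E]].
- by exists 0%R; rewrite !zpow0 (emb0 sd) mulg1.
- have [b' E' _] := zpow_iota sd k b.
  by exists (w + b')%R; rewrite !zpowS E (embD sd) mulgA -[_ * iota b]mulgA E' !mulgA.
- have [b' E' _] := zpow_iota sd (k - 1) (- b)%R.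
  exists (w + b')%R; rewrite zpowB1 E (embD sd) -[iota w * iota b' * _]mulgA -E' zpowB1.
  by rewrite (embN sd) invgM !mulgA.
Qed.

(** As N is abelian, conjugation by iota b * t is still phi, so everything proved for t
    holds for iota b * t. *)
Lemma semidirect_change b : semidirect_by_Z iota (iota b * t) phi.
Proof.
have wP k : exists w, zpow (iota b * t) k = iota w * zpow t k := zpow_iotaM b k.
pose w k := projT1 (cid (wP k)).
have wE k : zpow (iota b * t) k = iota (w k) * zpow t k := projT2 (cid (wP k)).
split; [exact: sdZ_morph sd|exact: sdZ_inj sd|exact: sdZ_normal sd| |].
- move=> g; have [u [k ->]] := decomp_ex sd g.
  exists ((u - w k)%R, k); split=> [|[v j]] /=.
    by rewrite wE (embD sd) (embN sd) -mulgA mulKg.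
  by rewrite wE mulgA -(embD sd) => /(decomp_inj sd)[-> ->]; rewrite addrK.
- move=> a; rewrite -[_ * iota a]mulgA (t_iota sd) invgM !mulgA mulgK -(embD sd) addrC.
  by rewrite (embD sd) mulgK.
Qed.

(** The quotient of iota b * t by iota b' * t is the image of b - b'. *)
Lemma eq_adjoin K K' b b' : phi_stable phi K -> phi_stable phi K' ->
  adjoin iota K (iota b * t) = adjoin iota K' (iota b' * t) <-> K = K' /\ K (b - b')%R.
Proof.
move=> hK hK'; have sd1 := semidirect_change b; have sd2 := semidirect_change b'.
have t_in L c : phi_stable phi L -> adjoin iota L (iota c * t) (iota c * t).
  move=> hL; exists 0%R, 1%R; split; first exact: stable0 hL.
  by rewrite (emb0 sd) mul1g /= expg1.
have sH := adjoin_subgroup sd1 hK.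
split=> [E|[<- Kb]].
  have EK : K = K'.
    by apply/seteqP; split=> v /=; [move/(adjoin_iota sd1); rewrite E|move/(adjoin_iota sd2); rewrite -E];
      [move/(adjoin_iota sd2)|move/(adjoin_iota sd1)].
  split=> //; apply/(adjoin_iota sd1).
  have -> : iota (b - b')%R = (iota b * t) * (iota b' * t)^-1.
    by rewrite invgM !mulgA mulgK (embD sd) (embN sd).
  apply: (subgroupM sH); first exact: t_in.
  by rewrite E; apply: subgroupV; [exact: (adjoin_subgroup sd2)|exact: t_in].
rewrite (adjoin_restrict sd2 sH).
  by congr adjoin; apply/seteqP; split=> v /=; [move/(adjoin_iota sd1)|move=> ?; apply/(adjoin_iota sd1)].
have -> : iota b' * t = (iota (b - b')%R)^-1 * (iota b * t).
  by rewrite -(embN sd) opprB mulgA -(embD sd) subrK.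
apply: (subgroupM sH); last exact: t_in.
by apply: (subgroupV sH); apply/(adjoin_iota sd1).
Qed.

(** As N is normal and M is maximal, M N = G, so M contains some iota b * t and is
    generated by it and by K = M cap N. A stable subgroup W between K and N gives the
    subgroup W M between M and G, which makes K maximal. *)
Lemma maximal_adjoin M n : maximal_subgroup M -> has_index M n ->
  ~ (forall v, M (iota v)) ->
  exists K b, maximal_stable phi K n /\ M = adjoin iota K (iota b * t).
Proof.
move=> [sM MT maxM] iM notN.
have prod_sub W : (forall g v, M g -> W v -> exists2 w, g * iota v * g^-1 = iota w & W w) ->
    W 0%R -> (forall u v, W u -> W v -> W (u - v)%R) ->
    subgroup [set g | exists v m, [/\ W v, M m & g = iota v * m]].
  move=> nW W0 WB; apply/subgroupP; split.
    by exists 0%R, 1; rewrite (emb0 sd) mulg1; split=> //; apply: subgroup1.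
  move=> _ _ [u [m [Wu Mm ->]]] [v [m' [Wv Mm' ->]]].
  have Mq : M (m * m'^-1) by apply: subgroupM => //; apply: subgroupV.
  have [w Ew Ww] := nW (m * m'^-1) v Mq Wv.
  exists (u - w)%R, (m * m'^-1); split=> //; first exact: WB.
  by rewrite (embD sd) (embN sd) -Ew invgM !invgM !invgK !mulgA !(mulgVK, mulgK).
have sub_prod W : W 0%R -> M `<=` [set g | exists v m, [/\ W v, M m & g = iota v * m]].
  by move=> W0 m Mm; exists 0%R, m; rewrite (emb0 sd) mul1g.
have MN g : exists v m, M m /\ g = iota v * m.
  have sMN := prod_sub setT.
  have [||] := maxM _ (sMN _ I (fun _ _ _ _ => I)) (sub_prod _ I).
  - by move=> h v _ _; have [w E] := sdZ_normal sd h v; exists w.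
  - move=> E; case: notN => v; rewrite -E; exists v, 1; rewrite mulg1; split=> //.
    exact: subgroup1.
  - by move=> E; have : [set: G] g := I; rewrite -E => -[v [m [_ Mm ->]]]; exists v, m.
have [c [m [Mm tE]]] := MN t.
have mE : m = iota (- c)%R * t by rewrite tE (embN sd) mulKg.
have Mt : M (iota (- c)%R * t) by rewrite -mE.
have sd' := semidirect_change (- c)%R.
pose K := [set v | M (iota v)].
have hK : phi_stable phi K := stable_restrict sd' sM Mt.
exists K, (- c)%R; split; last exact: (adjoin_restrict sd').
split=> // [|W hW sKW|].
- by apply: contra_not_neq notN => E v; have : K v by rewrite E.
- have := maxM [set g | exists v m, [/\ W v, M m & g = iota v * m]].
  case=> [|||E].
  + apply: prod_sub; [|exact: stable0 hW|exact: stableB hW].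
    move=> g v _ Wv; have [u [k ->]] := decomp_ex sd g.
    have [w E Ww] := zpow_iota sd k v; exists w; last exact/Ww.
    rewrite invgM -!mulgA [zpow t k * _]mulgA E !mulgA mulgK.
    by rewrite -!(embD sd) -(embN sd) -(embD sd) addrAC subrr add0r.
  + exact/sub_prod/(stable0 hW).
  + move=> E; left; apply/seteqP; split=> // v Wv; rewrite /K /= -E.
    by exists v, 1; rewrite mulg1; split=> //; apply: subgroup1.
  + right; apply/seteqP; split=> // v _; have : [set: G] (iota v) := I.
    rewrite -E => -[w [m' [Ww Mm' vE]]]; rewrite -[v](subrK w); apply: (stableD hW) => //.
    apply: sKW; rewrite /K /= addrC (embD sd) (embN sd) vE mulKg; exact: Mm'.
- have /(index_fun sM)[e eE e_surj] := iM; exists (e \o iota) => [u v /=|i].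
    rewrite eE -(embN sd) -(embD sd).
    by split=> [/(stableN hK)|/(stableN hK)] ; rewrite /K /= opprD opprK // addrC.
  have [g <-] := e_surj i; have [v [m' [Mm' ->]]] := MN g.
  by exists v; apply/eE; rewrite mulKg.
Qed.

(** Such a subgroup is determined by the least positive j for which it contains t^j,
    and j <= n because two of the cosets of 1, t, ..., t^n coincide. (There is in
    fact at most one such subgroup.) *)
Lemma over_N_count n :
  let X := [set M | [/\ maximal_subgroup M, has_index M n & forall v, M (iota v)]] in
  finite_set X /\ (scard X <= n)%N.
Proof.
move=> X.
pose f (M : set G) := find (fun j => `[< M (t ^+ j.+1) >]) (seq.iota 0 n).
have fP M : X M -> [/\ (f M < n)%N, M (t ^+ (f M).+1) &
    forall j, (j < f M)%N -> ~ M (t ^+ j.+1)].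
  move=> [[sM _ _] /(index_fun sM)[e eE _] _].
  have hasM : has (fun j => `[< M (t ^+ j.+1) >]) (seq.iota 0 n).
    have /injectivePn[j [i ne]] : ~~ injectiveb (fun i : 'I_n.+1 => e (t ^+ i)).
      by apply/injectiveP => /leq_card; rewrite !card_ord ltnn.
    wlog lt_ij : i j ne / (i < j)%N.
      move=> th; case: (ltngtP i j) => [/th|/th h E|/val_inj E]; first exact.
        by apply: h => //; rewrite eq_sym.
      by rewrite E eqxx in ne.
    move/esym => /eE; rewrite -{1}(subnKC (ltnW lt_ij)) expgnDr mulKg => Mij.
    apply/hasP; exists (j - i).-1; last by apply/asboolP; rewrite prednK // subn_gt0.
    rewrite mem_iota /= add0n; have := ltn_ord j; lia.
  have lt_f : (f M < n)%N by rewrite /f -[X in (_ < X)%N](size_iota 0) -has_find.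
  split=> //; first by have /asboolP := nth_find 0%N hasM; rewrite nth_iota.
  move=> j lt_j; have /asboolPn := negbT (before_find 0%N lt_j).
  by rewrite nth_iota // (ltn_trans lt_j).
have memE M : X M -> forall k, M (zpow t k) <-> ((f M).+1 %| k)%Z.
  move=> XM k; have [_ Mf minf] := fP M XM; have [[sM _ _] _ _] := XM.
  have Mz q : M (zpow t ((f M).+1%:Z * q)).
    elim/int_rect_step: q => [|q IH|q IH]; first by rewrite mulr0; exact: subgroup1.
      by rewrite mulrDr mulr1 zpowD; apply: subgroupM.
    by rewrite mulrBr mulr1 zpowD zpowN; apply: subgroupM => //; apply: subgroupV.
  rewrite {1}(divz_eq k (f M).+1) mulrC zpowD; split=> [/(subgroupMl sM _ (Mz _))|dv].
    have := ltz_pmod k (isT : 0 < (f M).+1%:Z); have := modz_ge0 k (isT : (f M).+1%:Z != 0).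
    case E : (k %% (f M).+1)%Z => [[|j]|j] // _ lt_j Mj.
      by apply/dvdz_mod0P; rewrite E.
    by case: (minf j) => //; rewrite -ltnS.
  apply: subgroupM => //; move/dvdz_mod0P: dv => ->; exact: subgroup1.
have [finI <-] : finite_set `I_n /\ scard `I_n = n.
  have [|finI ->] := @scard_seq _ `I_n (seq.iota 0 n) (iota_uniq _ _); last by rewrite size_iota.
  by move=> j; rewrite mem_iota add0n.
apply: (scard_inj (f := f)) => // [M /fP[]//|M M' XM XM' E].
have [[[sM _ _] _ MN] [[sM' _ _] _ MN']] := (XM, XM').
apply/seteqP; split=> g; have [u [k ->]] := decomp_ex sd g.
  by move/(subgroupMl sM _ (MN u))/(memE _ XM); rewrite E => /(memE _ XM')/(subgroupMl sM' _ (MN' u)).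
by move/(subgroupMl sM' _ (MN' u))/(memE _ XM'); rewrite -E => /(memE _ XM)/(subgroupMl sM _ (MN u)).
Qed.

Lemma module_generators : finitely_generated G ->
  exists m (v : 'I_m -> N), forall W, phi_stable phi W -> (forall i, W (v i)) -> W = setT.
Proof.
move=> [s gen].
have pP g : exists u, exists k, g = iota u * zpow t k := decomp_ex sd g.
pose part g := projT1 (cid (pP g)).
have partE g : exists k, g = iota (part g) * zpow t k := projT2 (cid (pP g)).
exists (size s), (fun i => part (nth 1 s i)) => W hW Wv.
have E : adjoin iota W t = setT.
  apply: gen; first exact: (adjoin_subgroup sd).
  move=> g /= /(nthP 1)[i lt_i <-]; have [k ->] := partE (nth 1 s i).
  exact/(adjoinE sd)/(Wv (Ordinal lt_i)).
by apply/seteqP; split=> // u _; apply/(adjoin_iota sd); rewrite E.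
Qed.

End MaximalSubgroups.

Section Span.
Variables (N : zmodType) (phi : {additive N -> N}).
Variables (m : nat) (v : 'I_m -> ZXmod phi).
Hypothesis gen : forall W, phi_stable phi W -> (forall i, W (v i)) -> W = setT.

(** The elements that a power of x moves into the Z[x]-span of the generators form a
    stable subgroup. *)
Lemma laurent_span (u : ZXmod phi) :
  exists n (g : 'I_m -> {poly int}), 'X^n *: u = \sum_i g i *: v i.
Proof.
pose W := [set u : ZXmod phi | exists n (g : 'I_m -> {poly int}), 'X^n *: u = \sum_i g i *: v i].
suff WT : W = setT by have : W u by rewrite WT.
apply: gen; last first.
  move=> i; exists 0%N, (fun j => (j == i)%:R); rewrite expr0 scale1r (bigD1 i) //= eqxx scale1r.
  by rewrite big1 ?addr0 // => j /negPf ->; rewrite scale0r.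
split.
- by exists 0%N, (fun=> 0); rewrite scaler0 big1 // => i _; rewrite scale0r.
- move=> a b [n [g E]] [k [h E']]; exists (n + k)%N, (fun i => 'X^k * g i - 'X^n * h i).
  rewrite scalerBr {1}addnC !exprD -!scalerA E E' !scaler_sumr -sumrB.
  by apply: eq_bigr => i _; rewrite scalerBl !scalerA.
- move=> a; split=> -[n [g E]].
    by exists n.+1, g; rewrite exprSr -scalerA ZXmod_X.
  exists n, (fun i => 'X * g i); rewrite -ZXmod_X scalerA mulrC -scalerA E scaler_sumr.
  by apply: eq_bigr => i _; rewrite scalerA.
Qed.

End Span.

(** * Simple quotients of a Z[x]-module *)

Section StableModule.
Variables (N : zmodType) (phi : {additive N -> N}).
Local Notation V := (ZXmod phi).
Variable W : set V.
Hypothesis hW : phi_stable phi W.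

Lemma stableXn n (v : V) : W ('X^n *: v) <-> W v.
Proof.
rewrite ZXmod_Xn; elim: n => //= n IH; split=> [/(stable_phi hW)/IH //|/IH h].
exact/(stable_phi hW).
Qed.

Lemma stableMz (v : V) (z : int) : W v -> W (v *~ z).
Proof.
move=> Wv; have Wn n : W (v *+ n).
  elim: n => [|n IH]; first exact: stable0 hW.
  by rewrite mulrS; apply: (stableD hW).
case: z => n; first exact: Wn.
by rewrite NegzE mulrNz; apply: (stableN hW); exact: Wn.
Qed.

Lemma stableZ (g : {poly int}) (v : V) : W v -> W (g *: v).
Proof.
elim/poly_ind: g v => [|g z IH] v Wv; first by rewrite scale0r; exact: stable0 hW.
rewrite scalerDl -scalerA ZXmod_X ZXmod_C; apply: (stableD hW).
  by apply/IH/(stable_phi hW).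
exact: stableMz.
Qed.

Lemma stable_preim (g : {poly int}) : phi_stable phi [set v : V | W (g *: v)].
Proof.
split=> /= [|u v Wu Wv|v].
- by rewrite scaler0; exact: stable0 hW.
- by rewrite scalerBr; apply: (stableB hW).
- by rewrite -(ZXmod_X (phi := phi)) scalerA mulrC -scalerA -{1}['X]expr1 stableXn.
Qed.

End StableModule.

Section Kernel.
Variables (N : zmodType) (phi : {additive N -> N}) (p k : nat) (A : finFieldType).
Hypotheses (p_pr : prime p) (k_gt0 : (0 < k)%N) (cardA : #|A| = (p ^ k)%N).
Hypothesis phi_surj : forall v, exists u, phi u = v.
Local Notation V := (ZXmod phi).
Variables (c : A) (psi : V -> A).
Hypotheses (apc : aperiodic p k c) (hpsi : homs phi c psi) (psi_nz : exists u, psi u != 0).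

Lemma hom_surj a : exists u, psi u = a.
Proof.
have [u psi_u] := psi_nz; have [g E] := evz_surj p_pr cardA apc (a / psi u).
by exists (g *: u); rewrite (homZ hpsi) E divfK.
Qed.

Lemma hom_c_neq0 : c != 0.
Proof.
have [u] := psi_nz; apply: contraNneq => c0.
by have [w <-] := phi_surj u; rewrite hpsi.2 c0 mul0r.
Qed.

Lemma stable_ker : phi_stable phi [set v : V | psi v = 0].
Proof.
split=> /= [|u v|v]; first exact: hom0 hpsi.
  by rewrite (homB hpsi) => -> ->; rewrite subrr.
rewrite hpsi.2; split=> [/eqP|->]; last by rewrite mulr0.
by rewrite mulf_eq0 (negPf hom_c_neq0) => /eqP.
Qed.

(** The values of polynomials at c exhaust A, so A has no proper submodule. *)
Lemma ker_maximal : maximal_stable phi [set v : V | psi v = 0] (p ^ k).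
Proof.
split; first exact: stable_ker.
- have [u psi_u] := psi_nz; apply/eqP => E; have : [set: V] u := I.
  by rewrite -E /= => psi0; rewrite psi0 eqxx in psi_u.
- move=> W hW sKW; have [sWK|] := pselect (W `<=` [set v : V | psi v = 0]).
    by left; apply/seteqP.
  move=> /existsNP[w /not_implyP[Ww /= /eqP psi_w]]; right; apply/seteqP; split=> // v _.
  have [g E] := evz_surj p_pr cardA apc (psi v / psi w).
  rewrite -[v](subrK (g *: (w : V))); apply: (stableD hW); last exact: stableZ.
  by apply: sKW; rewrite /= (homB hpsi) (homZ hpsi) E divfK ?subrr.
- exists (fun v => cast_ord cardA (enum_rank (psi v))) => [u v|i].
    split=> [/cast_ord_inj/enum_rank_inj E|/= ]; first by rewrite /= (homB hpsi) E subrr.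
    by move/eqP; rewrite (homB hpsi) subr_eq0 => /eqP ->.
  have [u E] := hom_surj (enum_val (cast_ord (esym cardA) i)); exists u.
  by rewrite E enum_valK cast_ordKV.
Qed.

End Kernel.

Lemma subrACA (U : zmodType) (a b c d : U) : (a - b) - (c - d) = (a - c) - (b - d).
Proof. by rewrite !opprB !addrA addrAC [RHS]addrAC; congr (_ + _); rewrite addrAC. Qed.

Section SimpleQuotient.
Variables (N : zmodType) (phi : {additive N -> N}) (n : nat).
Local Notation V := (ZXmod phi).
Variable K : set V.
Hypothesis maxK : maximal_stable phi K n.

Let hK : phi_stable phi K. Proof. by case: maxK. Qed.

(** The form in which the maximality of K is used. *)
Let max_full W (v : V) : phi_stable phi W -> K `<=` W -> W v -> ~ K v -> forall u, W u.
Proof.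
move=> hW sKW Wv nKv u; have [_ _ mx _] := maxK; have [E|->] := mx W hW sKW; last by [].
by rewrite E in Wv.
Qed.

(** Pigeonhole on the classes modulo K. *)
Let collision (f : nat -> V) : exists i j, (i < j)%N /\ K (f i - f j).
Proof.
have [_ _ _ [e eE _]] := maxK.
have /injectivePn[i [j ne E]] : ~~ injectiveb (fun i : 'I_n.+1 => e (f i)).
  by apply/injectiveP => /leq_card; rewrite !card_ord ltnn.
case: (ltngtP i j) => [lt_ij|lt_ji|/val_inj E']; last by rewrite E' eqxx in ne.
  by exists i, j; split=> //; apply/eE.
by exists j, i; split=> //; apply/eE; rewrite E.
Qed.

Let v0_ex : exists v : V, ~ K v.
Proof. by have [_ /eqP KT _ _] := maxK; apply: contrapT => /forallNP h; apply: KT; apply/seteqP; split=> // v _; apply: contrapT. Qed.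

Let v0 : V := projT1 (cid v0_ex).
Let v0P : ~ K v0 := projT2 (cid v0_ex).

(** Two of the classes of v0, x v0, x^2 v0, ... coincide, so some x^l fixes v0 modulo
    K, and the elements that it fixes modulo K form a stable subgroup. *)
Let periodic : exists2 l, (0 < l)%N & forall u : V, K ('X^l *: u - u).
Proof.
have [i [j [lt_ij E]]] := collision (fun i => 'X^i *: v0).
exists (j - i)%N; first by rewrite subn_gt0.
apply: (@max_full [set u : V | K ('X^(j - i) *: u - u)] v0) => //.
- split=> /= [|u v Ku Kv|v].
  + by rewrite scaler0 subr0; exact: stable0 hK.
  + by rewrite scalerBr -subrACA; apply: (stableB hK).
  + rewrite -(ZXmod_X (phi := phi)) scalerA mulrC -scalerA -scalerBr.
    exact: (stableXn hK 1).
- by move=> v Kv; apply: (stableB hK) => //; apply/(stableXn hK).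
- rewrite /=; suff /(stableXn hK) : K ('X^i *: ('X^(j - i) *: v0 - v0)) by [].
  by rewrite scalerBr scalerA -exprD subnKC 1?ltnW // -opprB; apply: (stableN hK); exact: E.
Qed.

(** A priori only x^i u lies in Z[x] v0 modulo K, but x^i is a factor of some power of
    x^l, which acts as the identity. *)
Let span0 (u : V) : exists g, K (u - g *: v0).
Proof.
have [l l_gt0 per] := periodic.
(* The stable subgroup generated by K and v0 consists of these u. *)
have [i [g E]] : exists i g, K ('X^i *: u - g *: v0).
  pose W := [set u : V | exists i g, K ('X^i *: u - g *: v0)].
  apply: (@max_full W v0) => //.
  - split=> [|a b [i [g Ei]] [j [h Ej]]|v].
    + by exists 0%N, 0; rewrite scaler0 scale0r subr0; exact: stable0 hK.
    + exists (i + j)%N, ('X^j * g - 'X^i * h).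
      have := stableB hK (stableZ hK 'X^j Ei) (stableZ hK 'X^i Ej).
      by rewrite !scalerBr !scalerA -!exprD [(j + i)%N]addnC scalerBl subrACA.
    + split=> -[i [g Ei]].
        by exists i.+1, g; rewrite exprSr -scalerA ZXmod_X.
      exists i, ('X * g); rewrite -(ZXmod_X (phi := phi)) scalerA mulrC -!scalerA -scalerBr.
      exact: stableZ.
  - by move=> v Kv; exists 0%N, 0; rewrite expr0 scale1r scale0r subr0.
  - by exists 0%N, 1; rewrite expr0 subrr; exact: stable0 hK.
have perM m (w : V) : K ('X^(l * m) *: w - w).
  elim: m => [|m IH]; first by rewrite muln0 expr0 scale1r subrr; exact: stable0 hK.
  rewrite mulnS exprD -scalerA -(subrK ('X^(l * m) *: w) ('X^l *: _)) -addrA.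
  exact: (stableD hK).
exists ('X^(l * i - i) * g).
have := stableB hK (stableZ hK 'X^(l * i - i) E) (perM i u).
rewrite scalerBr !scalerA -exprD subnK ?leq_pmull // opprB addrC addrA subrK.
by [].
Qed.

(** For l minimal with l v0 in K and p a prime factor of l, the elements v with p v in
    K form a stable subgroup containing (l/p) v0. *)
Let p_ex : exists2 p, prime p & forall v : V, K (v *+ p).
Proof.
have ex_l : exists l, (0 < l)%N && `[< K (v0 *+ l) >].
  have [i [j [lt_ij E]]] := collision (fun i => v0 *+ i).
  exists (j - i)%N; rewrite subn_gt0 lt_ij; apply/asboolP.
  by rewrite mulrnBr 1?ltnW // -opprB; apply: (stableN hK); exact: E.
have [l /andP[l_gt0 /asboolP Kl] minl] := ex_minnP ex_l.
have l_gt1 : (1 < l)%N by case: l l_gt0 Kl {minl} => [|[|]].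
pose p := pdiv l; have p_pr : prime p := pdiv_prime l_gt1.
exists p => //; have lE : (l %/ p * p)%N = l by rewrite divnK // pdiv_dvd.
apply: (@max_full [set v : V | K (v *+ p)] (v0 *+ (l %/ p))) => /=.
- have := stable_preim hK p%:R; congr phi_stable; apply/seteqP.
  by split=> v /=; rewrite ZXmod_nat.
- by move=> v Kv; have := stableMz hK p Kv.
- by rewrite -mulrnA lE.
- move=> Kd; have : (l <= l %/ p)%N.
    by apply: minl; rewrite divn_gt0 ?prime_gt0 // dvdn_leq ?pdiv_dvd //=; apply/asboolP.
  by rewrite leqNgt ltn_Pdiv // prime_gt1.
Qed.

Let p := projT1 (cid2 p_ex).
Let p_pr : prime p. Proof. by rewrite /p; case: cid2. Qed.
Let Kp (v : V) : K (v *+ p). Proof. by move: v; rewrite /p; case: cid2. Qed.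

Let Kred g h (v : V) : redp p g = redp p h -> K (g *: v) -> K (h *: v).
Proof.
move=> E Kg; have /(redp0P p_pr)[u D] : redp p (g - h) = 0 by rewrite rmorphB /= E subrr.
have -> : h = g - u *+ p by rewrite -D opprB addrCA subrr addr0.
by rewrite scalerBl -scalerMnl; apply: (stableB hK).
Qed.

(** The annihilator of v0 in N/K, as a set of polynomials over F_p. *)
Let Kf (f : {poly 'F_p}) := K (liftp f *: v0).

Let min_poly : exists f : {poly 'F_p}, f \is monic /\ forall g, Kf g <-> f %| g.
Proof.
have [l l_gt0 per] := periodic.
have ex_m : exists m, `[< exists f : {poly 'F_p}, [/\ size f = m, f != 0 & Kf f] >].
  exists l.+1; apply/asboolP; exists ('X^l - 1%:P); rewrite size_XnsubC //; split=> //.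
    by rewrite -size_poly_eq0 size_XnsubC.
  apply: (@Kred ('X^l - 1)); last by rewrite scalerBl scale1r.
  by rewrite liftpK rmorphB rmorph1 rmorphXn /= /redp map_polyX.
have [m /asboolP[f [sz f_nz Kff]] minm] := ex_minnP ex_m.
have KM h g : Kf g -> Kf (h * g).
  move=> Kg; apply: (@Kred (liftp h * liftp g)); first by rewrite rmorphM /= !liftpK.
  by rewrite -scalerA; apply: stableZ.
have KB h g : Kf h -> Kf g -> Kf (h - g).
  move=> Kh Kg; apply: (@Kred (liftp h - liftp g)); first by rewrite rmorphB /= !liftpK.
  by rewrite scalerBl; apply: (stableB hK).
have fdvd g : Kf g <-> f %| g.
  split=> [Kg|/dvdpP[h ->]]; last exact: KM.
  apply: contrapT => /negP; rewrite /dvdp => r_nz.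
  have Kr : Kf (g %% f).
    have -> : g %% f = g - g %/ f * f.
      by apply: (addrI (g %/ f * f)); rewrite -divp_eq addrC subrK.
    by apply: KB => //; apply: KM.
  have : (m <= size (g %% f)%R)%N by apply: minm; apply/asboolP; exists (g %% f).
  by rewrite -sz leqNgt ltn_modp f_nz.
exists ((lead_coef f)^-1 *: f); split=> [|g].
  by rewrite monicE lead_coefZ mulVf // lead_coef_eq0.
by rewrite dvdpZl ?invr_eq0 ?lead_coef_eq0.
Qed.

Let f := projT1 (cid min_poly).
Let f_monic : f \is monic. Proof. by rewrite /f; case: cid => ? []. Qed.
Let fP g : Kf g <-> f %| g. Proof. by move: g; rewrite /f; case: cid => ? []. Qed.

(** If f = h q with q of smaller size, then the elements killed by h modulo K form a
    stable subgroup containing q v0, hence also v0, so f divides h. *)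
Let f_irr : irreducible_poly f.
Proof.
have f_nz := monic_neq0 f_monic; split.
  rewrite ltnNge; apply/negP => /size1_polyC fC; apply: v0P.
  have E : f = 1 by move: f_monic; rewrite monicE fC lead_coefC => /eqP ->.
  rewrite -[v0]scale1r; apply: (@Kred (liftp (1 : {poly 'F_p}))); first by rewrite liftpK rmorph1.
  by apply/fP; rewrite E.
move=> q q_sz /[dup] q_dvd /dvdpP[h D].
have q_nz : q != 0 by apply: contraNneq f_nz => q0; rewrite D q0 mulr0.
have h_nz : h != 0 by apply: contraNneq f_nz => h0; rewrite D h0 mul0r.
apply: contraT => neq.
have sz_lt : (size q < size f)%N.
  rewrite ltn_neqAle dvdp_leq // andbT; apply: contraNneq neq => E.
  by rewrite -dvdp_size_eqp ?E.
have : forall u : V, K (liftp h *: u).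
  apply: (@max_full [set u : V | K (liftp h *: u)] (liftp q *: v0)) => /=.
  - exact: stable_preim.
  - by move=> v; apply: stableZ.
  - rewrite scalerA; apply: (@Kred (liftp f)); last exact/fP.
    by rewrite rmorphM /= !liftpK.
  - by move/(fP q)/(dvdp_leq q_nz); rewrite leqNgt sz_lt.
move=> /(_ v0)/(fP h)/(dvdp_leq h_nz); rewrite {1}D size_mul //.
move: q_sz; have := size_poly_gt0 q; rewrite q_nz; have := size_poly_gt0 h; rewrite h_nz.
move: (size q) (size h) => a b; lia.
Qed.

Let k := (size f).-1.
Let k_gt0 : (0 < k)%N.
Proof. by rewrite /k; have [] := f_irr; case: size => [|[]]. Qed.
Let szf : size f = k.+1.
Proof. by rewrite /k prednK // (leq_trans _ f_irr.1). Qed.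

Let small_eq0 (g : {poly 'F_p}) : (size g <= k)%N -> f %| g -> g = 0.
Proof.
move=> sz /dvdp_leq; have [//|nz /(_ isT)] := eqVneq g 0.
by rewrite szf leqNgt ltnS sz.
Qed.

Let row_inj (a b : 'rV['F_p]_k) : f %| rVpoly a - rVpoly b -> a = b.
Proof.
move/small_eq0; rewrite (leq_trans (size_polyD _ _)) ?size_polyN ?geq_max ?size_poly //.
by move=> /(_ isT)/eqP; rewrite subr_eq0 => /eqP/(can_inj rVpolyK).
Qed.

Let card_row : #|'rV['F_p]_k| = (p ^ k)%N.
Proof. by rewrite card_mx card_Fp // mul1n. Qed.

(** Every class modulo K has exactly one representative g v0 with g of smaller size
    than f. *)
Let card_quotient : n = (p ^ k)%N.
Proof.
have [_ _ _ [e eE e_surj]] := maxK.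
pose F (a : 'rV['F_p]_k) := e (liftp (rVpoly a) *: v0).
have F_inj : injective F.
  move=> a b /eE E; apply/row_inj/fP.
  apply: (@Kred (liftp (rVpoly a) - liftp (rVpoly b))); last by rewrite scalerBl; exact: E.
  by rewrite rmorphB /= !liftpK.
rewrite -card_row -(card_codom F_inj) -[LHS](card_ord n); apply: eq_card => i.
rewrite inE; apply/esym/codomP; have [u <-] := e_surj i; have [g Kg] := span0 u.
exists (poly_rV (redp p g %% f)); apply/eE.
rewrite poly_rV_K; last by rewrite -ltnS -szf ltn_modp monic_neq0.
suff : K ((u - g *: v0) + (g - liftp (redp p g %% f)) *: v0).
  by rewrite scalerBl addrA subrK => H; exact: H.
apply: (stableD hK) => //.
have /fP : f %| redp p g - redp p g %% f.
  by rewrite {1}(divp_eq (redp p g) f) addrK dvdp_mull.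
by apply: Kred; rewrite liftpK rmorphB /= liftpK.
Qed.

(** N/K is the field F_p[x]/(f), with v0 as 1; sending v0 to 1 and x to a root c of f
    in A identifies it with A. *)
Lemma simple_quotient : exists p k, [/\ prime p, (0 < k)%N, n = (p ^ k)%N &
  forall A : finFieldType, #|A| = (p ^ k)%N -> exists (c : A) (psi : V -> A),
    [/\ aperiodic p k c, homs phi c psi, exists u, psi u != 0 &
         K = [set u | psi u = 0]]].
Proof.
exists p, k; split=> // A cardA.
have [c cE] := irreducible_root p_pr k_gt0 cardA f_irr f_monic szf.
have KE g : K (g *: v0) <-> evz c g = 0.
  split=> [Kg|/eqP].
    by apply/eqP; rewrite -cE; apply/fP; apply: Kred Kg; rewrite liftpK.
  by rewrite -cE => /fP; apply: Kred; rewrite liftpK.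
pose psi u := evz c (projT1 (cid (span0 u))).
have psiP u g : K (u - g *: v0) -> psi u = evz c g.
  rewrite /psi; case: cid => h /= Kh Kg; apply/eqP; rewrite -subr_eq0 -rmorphB /=; apply/eqP/KE.
  have := stableB hK Kg Kh; rewrite subrACA subrr sub0r opprB scalerBl.
  by [].
exists c, psi; split.
- apply: (aperiodicP p_pr cardA) => y.
  pose F (a : 'rV['F_p]_k) := evz c (liftp (rVpoly a)).
  have F_inj : injective F.
    move=> a b /eqP; rewrite -subr_eq0 -rmorphB /= -cE rmorphB /= !liftpK.
    exact: row_inj.
  have := inj_card_onto F_inj; rewrite card_row cardA leqnn => /(_ isT y)/codomP[a ->].
  by exists (liftp (rVpoly a)).
- split=> [u v|v].
    have [g Kg] := span0 u; have [h Kh] := span0 v.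
    rewrite (psiP _ _ Kg) (psiP _ _ Kh) -rmorphD; apply: psiP.
    by rewrite scalerDl opprD addrACA; apply: (stableD hK).
  have [g Kg] := span0 v; rewrite (psiP _ _ Kg) -[c in c * _](evzX c) -rmorphM.
  apply: psiP; rewrite -(ZXmod_X (phi := phi)) -scalerA -scalerBr.
  exact: stableZ.
- exists v0; rewrite (psiP v0 1) ?rmorph1 ?oner_eq0 // scale1r subrr; exact: stable0 hK.
- apply/seteqP; split=> u /=; have [g Kg] := span0 u; rewrite (psiP _ _ Kg).
    by move=> Ku; apply/KE; rewrite -[_ *: _](subKr u); apply: (stableB hK).
  by move/KE => Kgv; rewrite -[u](subrK (g *: v0)); apply: (stableD hK).
Qed.

End SimpleQuotient.

(** * Counting the supplements of N *)

Lemma scard_setD1 (T : choiceType) (D : set T) x : finite_set D -> D x ->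
  finite_set (D `\ x) /\ scard (D `\ x) = (scard D).-1.
Proof.
move=> /finite_enum[s us Ds] /Ds xs; have [_ ->] := scard_seq us Ds.
rewrite -(size_rem xs); apply: scard_seq; first exact: rem_uniq.
move=> y; rewrite (mem_rem_uniq _ us) inE /=.
by split=> [[/Ds -> /eqP ->]|/andP[/eqP ne /Ds]].
Qed.

Lemma prime_pow_inj p k p' k' : prime p -> prime p' -> (0 < k)%N ->
  (p ^ k = p' ^ k')%N -> p' = p /\ k' = k.
Proof.
move=> p_pr p'_pr k_gt0 E.
have pp' : p' = p.
  apply/eqP; rewrite eq_sym; move: (dvdn_exp k_gt0 (dvdnn p)); rewrite E.
  case: k' {E} => [|k']; last by rewrite Euclid_dvdX // dvdn_prime2 // => /andP[].
  by rewrite dvdn1 => /eqP p1; rewrite p1 in p_pr.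
by move: E; rewrite pp' => /eqP; rewrite eqn_exp2l ?prime_gt1 // => /eqP.
Qed.

Section Count.
Variables (G : groupType) (N : zmodType) (iota : N -> G) (phi : {additive N -> N}) (t : G).
Hypothesis sd : semidirect_by_Z iota t phi.
Local Notation V := (ZXmod phi).
Variables (m : nat) (gens : 'I_m -> V).
Hypothesis genP : forall u : V, exists n (g : 'I_m -> {poly int}), 'X^n *: u = \sum_i g i *: gens i.
Variables (p k : nat) (A : finFieldType).
Hypotheses (p_pr : prime p) (k_gt0 : (0 < k)%N) (cardA : #|A| = (p ^ k)%N).
Implicit Types (c : A) (psi : V -> A).

Let phi_surj := phi_surj sd.
Let chA := charA p_pr cardA.

Definition homs_nz c : set (V -> A) := homs phi c `\ (fun=> 0).

Lemma homs_nzP c psi : homs_nz c psi <-> homs phi c psi /\ exists u, psi u != 0.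
Proof.
split=> [[h ne]|[h [u nz]]]; split=> //.
  apply: contrapT => /forallNP all0; apply: ne; apply: funext => u.
  by apply/eqP/negPn/negP; exact: all0.
by move=> E; rewrite E eqxx in nz.
Qed.

Lemma homs0 c : homs phi c (fun=> 0).
Proof. by split=> *; rewrite ?addr0 ?mulr0. Qed.

Lemma finite_homs c : finite_set (homs phi c).
Proof.
have [c0|c_nz] := eqVneq c 0.
  apply: (@sub_finite_set _ _ [set (fun=> 0)]); last exact: finite_set1.
  move=> psi hpsi; apply: funext => u; have [w <-] := phi_surj u.
  by rewrite hpsi.2 c0 mul0r.
apply: (scard_homs_le chA (y := gens) _).1 => u.
have [n [g E]] := genP u; exists 'X^n, g; split; last by rewrite E subrr; exact: pmult0.
by rewrite rmorphXn /= evzX expf_neq0.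
Qed.

Lemma scard_homs_nz c : finite_set (homs_nz c) /\ scard (homs_nz c) = (scard (homs phi c)).-1.
Proof. by apply: scard_setD1 (homs0 c); exact: finite_homs. Qed.

Definition triples : set (A * ((V -> A) * A)) :=
  [set x | aperiodic p k x.1 /\ homs_nz x.1 x.2.1].

Definition lift_elt psi (b : A) : V := xget 0 [set u | psi u = b].

(** The supplement given by (c, psi, b): the kernel of psi extended by iota u * t for
    any u with psi u = b. *)
Definition triple_group (x : A * ((V -> A) * A)) : set G :=
  adjoin iota [set u | x.2.1 u = 0] (iota (lift_elt x.2.1 x.2.2) * t)%g.

(** A maximal subgroup not containing the normal subgroup N supplements it. *)
Definition supplements : set (set G) :=
  [set M | [/\ maximal_subgroup M, has_index M (p ^ k) & ~ (forall v, M (iota v))]].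

Section Triple.
Variables (c : A) (psi : V -> A).
Hypotheses (apc : aperiodic p k c) (hnz : homs_nz c psi).
Let hpsi : homs phi c psi. Proof. by case/homs_nzP: hnz. Qed.
Let psi_nz : exists u, psi u != 0. Proof. by case/homs_nzP: hnz. Qed.

Lemma lift_eltK b : psi (lift_elt psi b) = b.
Proof.
have [u E] := hom_surj p_pr cardA apc hpsi psi_nz b.
exact: (@xgetI _ _ [set u | psi u = b] u E).
Qed.

Lemma triple_stable : phi_stable phi [set u | psi u = 0].
Proof. exact (stable_ker phi_surj hpsi psi_nz). Qed.

Lemma triple_supplement b : supplements (triple_group (c, (psi, b))).
Proof.
have mx := ker_maximal p_pr cardA phi_surj apc hpsi psi_nz.
have sd' := semidirect_change sd (lift_elt psi b).
have [mT iT] := adjoin_maximal sd' mx.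
split=> // h; have [u psi_u] := psi_nz.
have /(adjoin_iota sd') /= E := h u; by rewrite E eqxx in psi_u.
Qed.

End Triple.

Lemma triple_group_inj c psi b c' psi' b' :
  aperiodic p k c -> homs_nz c psi -> aperiodic p k c' -> homs_nz c' psi' ->
  triple_group (c, (psi, b)) = triple_group (c', (psi', b')) <->
  (forall u, psi u = 0 <-> psi' u = 0) /\ psi' (lift_elt psi b) = b'.
Proof.
move=> ap hnz ap' hnz'.
rewrite /triple_group /= (eq_adjoin sd _ _ (triple_stable hnz) (triple_stable hnz')).
have [hpsi _] := (homs_nzP c psi).1 hnz; have [hpsi' _] := (homs_nzP c' psi').1 hnz'.
have kerE : [set u | psi u = 0] = [set u | psi' u = 0] <-> forall u, psi u = 0 <-> psi' u = 0.
  by split=> [/seteqP[s1 s2] u|E]; [split; [exact: s1|exact: s2]|apply/seteqP; split=> u /= /E].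
rewrite kerE; split=> -[E] /=; last first.
  move=> E'; split=> //; apply/E/eqP.
  by rewrite (homB hpsi') (lift_eltK ap' hnz') E' subrr.
by move/E/eqP; rewrite (homB hpsi') (lift_eltK ap' hnz') subr_eq0 => /eqP ->.
Qed.

Lemma supplement_triple M : supplements M -> exists2 x, triples x & triple_group x = M.
Proof.
move=> [mM iM notN]; have [K [b [mK ->]]] := maximal_adjoin sd mM iM notN.
have [p' [k' [p'_pr k'_gt0 /(prime_pow_inj p_pr p'_pr k_gt0)[-> ->] exA]]] := simple_quotient mK.
have [c [psi [apc hpsi psi_nz KE]]] := exA A cardA.
have hnz : homs_nz c psi by apply/homs_nzP.
exists (c, (psi, psi b)) => //; rewrite /triple_group /= KE.
apply/(eq_adjoin sd _ _ (triple_stable hnz) (triple_stable hnz)); split=> //=.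
by rewrite (homB hpsi) (lift_eltK apc hnz) subrr.
Qed.

Lemma finite_triples : finite_set triples.
Proof.
apply: (@sub_finite_set _ _ ([set: A] `*` ((\bigcup_(c in [set: A]) homs phi c) `*` [set: A]))).
  by move=> [c [psi b]] [_ [h _]]; split=> //; split=> //=; exists c.
apply: finite_setX; first exact: finite_finset.
apply: finite_setX; last exact: finite_finset.
apply: bigcup_finite => [|c _]; first exact: finite_finset.
exact: finite_homs.
Qed.

Lemma scard_triples : scard triples =
  (#|A| * \sum_(c : A | `[< aperiodic p k c >]) (scard (homs phi c)).-1)%N.
Proof.
rewrite (scard_fibers (f := fst) finite_triples (enum_uniq A)); last by move=> x _; rewrite mem_enum.
rewrite big_enum /= big_distrr /= [RHS]big_mkcond /=; apply: eq_bigr => c _.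
have [fin_nz card_nz] := scard_homs_nz c.
case: asboolP => apc; last first.
  rewrite (_ : _ `&` _ = set0) ?/scard ?fset_set0 //.
  by apply/seteqP; split=> // -[c' y] [[/= ap _] /= E]; rewrite E in ap.
rewrite (_ : _ `&` _ = (fun y => (c, y)) @` (homs_nz c `*` [set: A])).
  have fin_X : finite_set (homs_nz c `*` [set: A]) by apply: finite_setX => //; exact: finite_finset.
  have [_ ->] := @scard_image _ _ (fun y : (V -> A) * A => (c, y)) _ fin_X (fun x y _ _ => fun E => congr1 snd E).
  by rewrite scard_setX //; [rewrite card_nz scard_setT mulnC|exact: finite_finset].
apply/seteqP; split=> [[c' [psi b]] [[/= ap h] /= E]|_ [[psi b] [/= h _] <-]].
  by rewrite -E; exists (psi, b).
by [].
Qed.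

Let nz_card : scard [set a : A | a != 0] = (p ^ k).-1.
Proof.
have [|_ ->] := @scard_seq _ [set a : A | a != 0] (rem 0 (enum A)) (rem_uniq _ (enum_uniq A)); last first.
  by rewrite size_rem ?mem_enum // -cardE cardA.
by move=> a; rewrite (mem_rem_uniq _ (enum_uniq A)) inE mem_enum andbT.
Qed.

Section Fibre.
Variables (c : A) (psi : V -> A) (b : A).
Hypotheses (apc : aperiodic p k c) (hnz : homs_nz c psi).
Let hpsi : homs phi c psi. Proof. by case/homs_nzP: hnz. Qed.
Let psi_nz : exists u, psi u != 0. Proof. by case/homs_nzP: hnz. Qed.
Let fibre := triples `&` [set x | triple_group x = triple_group (c, (psi, b))].
Let finite_fibre : finite_set fibre.
Proof. exact: finite_setIl finite_triples. Qed.

(** The triples (c^(p^i), a psi^(p^i), a b^(p^i)) with i < k and a != 0 all define the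
    same subgroup, since the kernel of psi does not change. *)
Lemma fibre_ge : (k * (p ^ k).-1 <= scard fibre)%N.
Proof.
rewrite -nz_card -[k in (k * _)%N]card_ord -scard_setT -scard_setX; try exact: finite_finset.
pose f (x : 'I_k * A) : A * ((V -> A) * A) :=
  (c ^+ (p ^ x.1), (fun u => x.2 * psi u ^+ (p ^ x.1), x.2 * b ^+ (p ^ x.1))).
have [u0 psi_u0] := psi_nz.
have p_neq0 i : (p ^ i != 0)%N by rewrite expn_eq0 negb_and -lt0n prime_gt0.
have twist_nz (i : nat) (a : A) : a != 0 -> aperiodic p k (c ^+ (p ^ i)) /\
    homs_nz (c ^+ (p ^ i)) (fun u => a * psi u ^+ (p ^ i)).
  move=> a_nz; split.
    move=> j jk; have := apc jk; apply: contra_neq => E; apply: (frob_inj p_pr cardA (i := i)).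
    by rewrite /= -[RHS]E -!exprM mulnC.
  apply/homs_nzP; split; last by exists u0; rewrite mulf_neq0 ?expf_neq0.
  split=> [u v|v]; first by rewrite hpsi.1 (frobD p_pr cardA) mulrDr.
  by rewrite hpsi.2 exprMn mulrCA.
have [||_ le //] := @scard_inj _ _ f ([set: 'I_k] `*` [set a : A | a != 0]) fibre finite_fibre.
- move=> [i a] [_ /= a_nz]; have [ap' hnz'] := twist_nz i a a_nz; split=> //=.
  apply/esym/triple_group_inj => //; split=> [u|]; last by rewrite (lift_eltK apc hnz).
  split=> [->|/eqP]; first by rewrite expr0n (negPf (p_neq0 i)) mulr0.
  by rewrite mulf_eq0 (negPf a_nz) expf_eq0 => /andP[_ /eqP].
- move=> [i a] [j a'] [_ /= a_nz] [_ /= _] [Ec Epsi _].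
  have ij : i = j by apply/val_inj/(frob_orbit_inj p_pr cardA apc (ltn_ord i) (ltn_ord j) Ec).
  congr (_, _) => //; move/(congr1 (@^~ u0)): Epsi; rewrite ij => /mulIf; apply.
  by rewrite expf_neq0.
Qed.

(** The kernel of psi determines the ideal of polynomials vanishing at c, hence c up
    to conjugation; and psi is then determined by its value at one element u0 outside
    the kernel, as every v is congruent to a multiple of u0. *)
Lemma fibre_le : (scard fibre <= k * (p ^ k).-1)%N.
Proof.
have [u0 psi_u0] := psi_nz.
apply: (@leq_trans (scard (conjugates c) * scard [set a : A | a != 0])); last first.
  by rewrite nz_card leq_mul2r (card_conjugates p_pr cardA) orbT.
rewrite -scard_setX; try exact: finite_finset.
pose f (x : A * ((V -> A) * A)) := (x.1, x.2.1 u0).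
have fibP x : fibre x -> [/\ aperiodic p k x.1, homs_nz x.1 x.2.1,
    forall u, psi u = 0 <-> x.2.1 u = 0 & x.2.1 (lift_elt psi b) = x.2.2].
  move: x => [c' [psi' b']] [[/= ap' h'] /= E]; split=> //.
    by have [] := (triple_group_inj b b' apc hnz ap' h').1 (esym E).
  by have [] := (triple_group_inj b b' apc hnz ap' h').1 (esym E).
have fin : finite_set (conjugates c `*` [set a : A | a != 0]) by apply: finite_finset.
have [||_ le //] := @scard_inj _ _ f fibre (conjugates c `*` [set a : A | a != 0]) fin.
- move=> [c' [psi' b']] /fibP[/= ap' hnz' kerE _].
  have [hpsi' _] := (homs_nzP c' psi').1 hnz'.
  have nz' : psi' u0 != 0 by apply: contraNneq psi_u0 => /kerE ->.
  split=> //= g gc; apply/eqP; have /eqP := (homZ hpsi' g u0).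
  have -> : psi' (g *: (u0 : V)) = 0 by apply/kerE; rewrite (homZ hpsi) gc mul0r.
  by rewrite eq_sym mulf_eq0 (negPf nz') orbF.
- move=> [c' [psi' b']] [c'' [psi'' b'']] /fibP[/= _ hnz' ker' <-] /fibP[/= _ hnz'' ker'' <-] [E E0].
  rewrite -{c''}E in hnz'' *.
  have [hpsi' _] := (homs_nzP c' psi').1 hnz'; have [hpsi'' _] := (homs_nzP c' psi'').1 hnz''.
  suff -> : psi' = psi'' by [].
  apply: funext => v; have [g gE] := evz_surj p_pr cardA apc (psi v / psi u0).
  have kv : psi (v - g *: (u0 : V)) = 0 by rewrite (homB hpsi) (homZ hpsi) gE divfK ?subrr.
  have /ker'/eqP := kv; rewrite (homB hpsi') (homZ hpsi') subr_eq0 => /eqP ->.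
  have /ker''/eqP := kv; rewrite (homB hpsi'') (homZ hpsi'') subr_eq0 => /eqP ->.
  by rewrite E0.
Qed.

End Fibre.

Lemma supplements_count : finite_set supplements /\
  (scard supplements * (k * (p ^ k).-1) =
   p ^ k * \sum_(c : A | `[< aperiodic p k c >]) (scard (homs phi c)).-1)%N.
Proof.
have b_gt0 : (0 < k * (p ^ k).-1)%N.
  by rewrite muln_gt0 k_gt0 /= -ltnS prednK ?expn_gt0 ?prime_gt0 // -(exp1n k) ltn_exp2r ?prime_gt1.
have [M|fin_s le1] := @scard_fibers_ge _ _ triple_group triples supplements _ finite_triples b_gt0.
  by move=> /supplement_triple[[c [psi b]] [/= apc hnz] <-]; exact: fibre_ge.
split=> //; have := scard_triples; rewrite cardA => <-; apply/eqP; rewrite eqn_leq le1 /=.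
apply: (scard_fibers_le finite_triples fin_s (f := triple_group)).
  by move=> [c [psi b]] [/= apc hnz]; exact: triple_supplement.
by move=> M /supplement_triple[[c [psi b]] [/= apc hnz] <-]; exact: fibre_le.
Qed.

End Count.

(** * Torsion-free ranks modulo p *)

Section Dependence.
Variable R : idomainType.

Lemma fraction_denom (x : {fraction R}) : exists a d : R, d != 0 /\ x * FracField.tofrac d = FracField.tofrac a.
Proof.
elim/quotW: x => r; exists \n_r, \d_r; split; first exact: denom_ratioP.
rewrite -[LHS]/(FracField.mul _ _) !piE; apply/eqmodP => /=.
rewrite FracField.equivfE /FracField.mulf !numden_Ratio ?oner_neq0 ?mulf_neq0 ?denom_ratioP ?oner_neq0 //.
by rewrite !mulr1 mulrC.
Qed.

(** Over the fraction field this is a dimension count; then clear denominators. *)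
Lemma left_kernel k m (P : 'M[R]_(k, m)) : (m < k)%N ->
  exists2 u : 'rV[R]_k, u != 0 & u *m P = 0.
Proof.
move=> lt_mk; pose T : {rmorphism R -> {fraction R}} := @FracField.tofrac R.
have T_inj : injective T by move=> x y /eqP; rewrite tofrac_eq => /eqP.
have : kermx (map_mx T P) != 0.
  by rewrite kermx_eq0 -row_leq_rank -ltnNge (leq_ltn_trans (rank_leq_col _)).
case/rowV0Pn => v /sub_kermxP vP v_nz.
have [a aP] := choice (fun i => fraction_denom (v 0 i)).
have [d dP] := choice aP.
pose D := \prod_i d i.
pose u : 'rV_k := \row_i (a i * \prod_(l | l != i) d l).
have uE : map_mx T u = T D *: v.
  have TM x y : T (x * y) = T x * T y by rewrite rmorphM.
  apply/rowP => i; have DE : D = d i * \prod_(l | l != i) d l by rewrite /D (bigD1 i).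
  rewrite !mxE DE !TM mulrAC [T (d i) * _]mulrC.
  by congr (_ * _); apply/esym; exact: (dP i).2.
have D_nz : D != 0 by apply/prodf_neq0 => i _; exact: (dP i).1.
exists u.
  apply: contraNneq v_nz => u0; have := uE; rewrite u0 map_mx0 => /esym/eqP.
  by rewrite scalemx_eq0 => /orP[|//]; rewrite -(rmorph0 T) (inj_eq T_inj) (negPf D_nz).
have /matrixP E : map_mx T (u *m P) = 0 by rewrite map_mxM uE -scalemxAl vP scaler0.
apply/matrixP => i j; apply: T_inj; have := E i j.
by rewrite mxE [RHS]mxE => ->; rewrite mxE; exact/esym/(rmorph0 T).
Qed.

End Dependence.

Section Supremum.
Implicit Type S : set nat.

Lemma supremum_nat S b : S !=set0 -> (forall k, S k -> (k <= b)%N) ->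
  S (supremum 0%N S) /\ forall k, S k -> (k <= supremum 0%N S)%N.
Proof.
move=> [k0 Sk0] bd.
have exS : exists k, `[< S k >] by exists k0; apply/asboolP.
have bdS k : `[< S k >] -> (k <= b)%N by move/asboolP/bd.
have [M /asboolP SM maxM] := ex_maxnP exS bdS.
have ubM k : S k -> (k <= M)%N by move=> Sk; apply: maxM; apply/asboolP.
suff -> : supremum 0%N S = M by [].
have supM : supremums S M.
  by split=> [k /ubM|k]; [rewrite leEnat|apply].
rewrite /supremum ifF; last by apply/negbTE/set0P; exists k0.
by case: xgetP => [y -> supy|/(_ M)//]; exact: (is_subset1_supremums supy supM).
Qed.

End Supremum.

Section Rank.
Variables (N : zmodType) (phi : {additive N -> N}).
Local Notation V := (ZXmod phi).
Variables (m : nat) (gens : 'I_m -> V).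
Hypothesis genP : forall u : V, exists n (g : 'I_m -> {poly int}), 'X^n *: u = \sum_i g i *: gens i.

(** Linear independence over F_p[x] of the images in N/pN, stated in N. *)
Definition indep_mod p k (w : 'I_k -> V) := forall h : 'I_k -> {poly int},
  pmult p (\sum_i h i *: w i) -> forall i, redp p (h i) = 0.

Section Prime.
Variables (p : nat) (p_pr : prime p).
Local Notation Vp := (polymod (fpquo_map p_pr phi)).

Definition pi_p (v : V) : Vp := @fpquo_pi N p p_pr v.

Lemma pi_pD u v : pi_p (u + v) = pi_p u + pi_p v.
Proof. exact: fpquo_piD. Qed.

Lemma pi_p_sum (I : Type) (r : seq I) (F : I -> V) :
  pi_p (\sum_(i <- r) F i) = \sum_(i <- r) pi_p (F i).
Proof. by elim/big_rec2: _ => [|i y x _ <-]; [exact: fpquo_pi0|exact: pi_pD]. Qed.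

Lemma pi_p_eq0 v : pi_p v = 0 <-> pmult p v.
Proof.
have -> : pi_p v = 0 <-> @fpquo_pi N p p_pr v == @fpquo_pi N p p_pr 0.
  by rewrite fpquo_pi0; split=> [h|/eqP h]; [apply/eqP|]; exact: h.
by rewrite -Quotient.idealrBE subr0; split=> [/asboolP|h]; [|apply/asboolP].
Qed.

Lemma pi_pMn v n : pi_p (v *+ n) = pi_p v *+ n.
Proof. exact: fpquo_piMn. Qed.

Lemma pi_pZ g v : pi_p (g *: v) = redp p g *: pi_p v.
Proof.
elim/poly_ind: g v => [|g z IH] v.
  by rewrite scale0r rmorph0 scale0r; exact: fpquo_pi0.
rewrite scalerDl pi_pD -scalerA ZXmod_X IH rmorphD rmorphM /= scalerDl -scalerA.
have phiE : pi_p (phi v) = redp p 'X *: pi_p v.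
  by rewrite /redp map_polyX polymodX; exact/esym/fpquo_mapE.
rewrite phiE; congr (_ + _).
rewrite /redp map_polyC /= ZXmod_C.
have ZMn (n : nat) : pi_p (v *+ n) = n%:R%:P *: pi_p v.
  by rewrite pi_pMn polyCMn scaler_nat.
have pi_pN u : pi_p (- u) = - pi_p u.
  by apply: (addrI (pi_p u)); rewrite -pi_pD !subrr; exact: fpquo_pi0.
case: z => n; first by rewrite -pmulrn ZMn.
have -> : (Negz n)%:~R = - n.+1%:R :> 'F_p by rewrite NegzE rmorphN.
by rewrite NegzE mulrNz pi_pN -pmulrn ZMn polyCN scaleNr.
Qed.

Lemma pi_p_repr (x : Vp) : exists v, pi_p v = x.
Proof. by exists (repr (x : fpquo N p_pr)); exact: fpquo_piK. Qed.

Lemma rank_setE : [set k | exists v : 'I_k -> Vp, forall c : 'I_k -> {poly 'F_p},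
    \sum_(i < k) c i *: v i = 0 -> forall i, c i = 0] =
  [set k | exists w : 'I_k -> V, indep_mod p w].
Proof.
apply/seteqP; split=> k /= [v indep].
  have [w wP] := choice (fun i => pi_p_repr (v i)); exists w => h /pi_p_eq0.
  rewrite pi_p_sum => E i; apply: (indep (fun i => redp p (h i))).
  by rewrite -[RHS]E; apply: eq_bigr => j _; rewrite pi_pZ wP.
exists (fun i => pi_p (v i)) => c E i; rewrite -[c i]liftpK.
apply: (indep (fun i => liftp (c i))); apply/pi_p_eq0; rewrite pi_p_sum -[RHS]E.
by apply: eq_bigr => j _; rewrite pi_pZ liftpK.
Qed.

(** After multiplication by a power of x, the w i are combinations of m generators,
    and k > m vectors with m coordinates are dependent. *)
Lemma indep_bound k (w : 'I_k -> V) : indep_mod p w -> (k <= m)%N.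
Proof.
move=> indep; rewrite leqNgt; apply/negP => lt_mk.
have [n nP] := choice (fun i => genP (w i)); have [c cP] := choice nP.
pose P := \matrix_(i < k, j < m) redp p ('X^(\sum_(l | l != i) n l) * c i j).
have [u u_nz uP] := left_kernel P lt_mk.
pose h i := liftp (u 0 i) * 'X^(\sum_l n l).
have /indep h0 : pmult p (\sum_i h i *: w i).
  have -> : \sum_i h i *: w i = \sum_j (\sum_i liftp (u 0 i) * ('X^(\sum_(l | l != i) n l) * c i j)) *: gens j.
    under [RHS]eq_bigr do rewrite scaler_suml.
    rewrite exchange_big; apply: eq_bigr => i _.
    have nE : (\sum_l n l = \sum_(l | l != i) n l + n i)%N by rewrite (bigD1 i) // addnC.
    rewrite /h nE exprD mulrA -scalerA cP scaler_sumr.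
    by apply: eq_bigr => j _; rewrite scalerA mulrA.
  apply: (big_ind (pmult p)) => [||j _]; [exact: pmult0|exact: pmultD|].
  have /(redp0P p_pr)[e ->] : redp p (\sum_i liftp (u 0 i) * ('X^(\sum_(l | l != i) n l) * c i j)) = 0.
    have /matrixP/(_ 0 j) := uP; rewrite !mxE => E; rewrite rmorph_sum -[RHS]E.
    by apply: eq_bigr => i _; rewrite rmorphM /= liftpK // mxE.
  by rewrite -scalerMnl; exists (e *: gens j).
move/eqP: u_nz; apply; apply/rowP => i; have /eqP := h0 i.
rewrite /h rmorphM rmorphXn /= liftpK // /redp map_polyX mulf_eq0 expf_eq0 polyX_eq0 andbF orbF.
by rewrite mxE => /eqP.
Qed.

Let rank_sup : (exists w : 'I_(rank_mod phi p_pr) -> V, indep_mod p w) /\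
  forall k (w : 'I_k -> V), indep_mod p w -> (k <= rank_mod phi p_pr)%N.
Proof.
rewrite /rank_mod /torsion_free_rank rank_setE.
have [||Sr maxr] := @supremum_nat [set k | exists w : 'I_k -> V, indep_mod p w] m.
- by exists 0%N, (fun=> 0) => h _ [].
- by move=> k [w]; exact: indep_bound.
by split=> // k w iw; apply: maxr; exists w.
Qed.

Lemma rank_mod_ge k (w : 'I_k -> V) : indep_mod p w -> (k <= rank_mod phi p_pr)%N.
Proof. exact: rank_sup.2. Qed.

Lemma rank_mod_le : (rank_mod phi p_pr <= m)%N.
Proof. by have [[w iw] _] := rank_sup; exact: indep_bound iw. Qed.

(** Adding one generator of N to a maximal independent family makes it dependent, and
    the coefficient of that generator in a relation is nonzero modulo p; g0 is the
    product of these coefficients. *)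
Lemma rank_frame : exists (w : 'I_(rank_mod phi p_pr) -> V) (g0 : {poly int}),
  [/\ indep_mod p w, redp p g0 != 0 & forall u : V, exists n (h : _ -> {poly int}),
    pmult p ((g0 * 'X^n) *: u - \sum_i h i *: w i)].
Proof.
have [[w iw] maxr] := rank_sup.
have dep u : exists g (h : 'I_(rank_mod phi p_pr) -> {poly int}), redp p g != 0 /\ pmult p (g *: u - \sum_i h i *: w i).
  pose w' (i : 'I_(rank_mod phi p_pr).+1) := oapp w u (unlift ord_max i).
  have : ~ indep_mod p w' by move/maxr; rewrite ltnn.
  move=> /existsNP[h /not_implyP[hP /existsNP[i0 hi0]]].
  move: hP; rewrite big_ord_recr /= /w' unlift_none /=.
  have wE (i : 'I_(rank_mod phi p_pr)) : unlift ord_max (widen_ord (leqnSn _) i) = Some i.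
    rewrite -(liftK ord_max i); congr unlift; apply: val_inj => /=.
    by rewrite /bump leqNgt ltn_ord.
  under eq_bigr do rewrite wE /=.
  move=> hP; exists (h ord_max), (fun i => - h (widen_ord (leqnSn _) i)); split.
    apply/eqP => h0; apply: hi0.
    have hw : pmult p (\sum_i h (widen_ord (leqnSn _) i) *: w i).
      have [e hE] := redp0P p_pr h0.
      rewrite -[X in pmult p X](addrK (h ord_max *: u)); apply: pmultB => //.
      by rewrite hE -scalerMnl; exists (e *: u).
    have := iw _ hw; case: (unliftP ord_max i0) => [j ->|-> //] /(_ j) <-.
    congr (redp p (h _)); apply: val_inj => /=; by rewrite /bump leqNgt ltn_ord.
  rewrite -sumrN addrC; congr (pmult p (_ + _)): hP.
  by apply: eq_bigr => i _; rewrite scaleNr opprK.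
have [g gP] := choice (fun j => dep (gens j)); have [h hP] := choice gP.
exists w, (\prod_j g j); split=> //.
  by rewrite rmorph_prod; apply/prodf_neq0 => j _; exact: (hP j).1.
move=> u; have [n [c E]] := genP u; exists n.
exists (fun i => \sum_j (c j * \prod_(l | l != j) g l) * h j i).
pose C j := c j * \prod_(l | l != j) g l.
have -> : \sum_i (\sum_j C j * h j i) *: w i = \sum_j C j *: \sum_i h j i *: w i.
  under eq_bigr do rewrite scaler_suml.
  rewrite exchange_big; apply: eq_bigr => j _; rewrite [RHS]scaler_sumr.
  by apply: eq_bigr => i _; rewrite scalerA.
have -> : (\prod_j g j * 'X^n) *: u = \sum_j C j *: (g j *: gens j).
  rewrite -scalerA E [LHS]scaler_sumr; apply: eq_bigr => j _.
  by rewrite !scalerA /C; congr (_ *: _); rewrite [X in X * _](bigD1 j) //= mulrC [g j * _]mulrC mulrA.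
rewrite -sumrB; apply: (big_ind (pmult p)) => [||j _]; [exact: pmult0|exact: pmultD|].
by rewrite -scalerBr; exact/pmultZ/(hP j).2.
Qed.

End Prime.

Lemma rank_max_attained : exists p (p_pr : prime p), rank_mod phi p_pr = rank_max phi.
Proof.
have [||[p [p_pr E]] _] := @supremum_nat [set k | exists (p : nat) (p_pr : prime p), k = rank_mod phi p_pr] m.
- by exists (rank_mod phi (isT : prime 2)), 2%N, isT.
- by move=> k [p [p_pr ->]]; exact: rank_mod_le.
by exists p, p_pr.
Qed.

Lemma rank_max_ge p (p_pr : prime p) : (rank_mod phi p_pr <= rank_max phi)%N.
Proof.
have [||_] := @supremum_nat [set k | exists (p : nat) (p_pr : prime p), k = rank_mod phi p_pr] m.
- by exists (rank_mod phi (isT : prime 2)), 2%N, isT.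
- by move=> k [q [q_pr ->]]; exact: rank_mod_le.
by apply; exists p, p_pr.
Qed.

(** By rank_frame, the family w is a frame at c unless g0 vanishes at c, which is
    impossible when c has at least size g0 conjugates. The bound 2 on k excludes c = 0. *)
Lemma scard_homs_small p (p_pr : prime p) : exists K, forall k (A : finFieldType) (c : A),
  (K <= k)%N -> #|A| = (p ^ k)%N -> aperiodic p k c ->
  scard (homs phi c) = ((p ^ k) ^ rank_mod phi p_pr)%N.
Proof.
have [w [g0 [iw g0_nz span]]] := rank_frame p_pr.
exists (maxn 2 (size g0)) => k A c; rewrite geq_max => /andP[k2 kg] cardA apc.
have k_gt0 : (0 < k)%N by exact: leq_trans k2.
have chA := charA p_pr cardA.
have c_nz : c != 0.
  have := apc 1%N; rewrite k2 => /(_ isT); apply: contraNneq => ->.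
  by rewrite expr0n expn_eq0 eqn0Ngt prime_gt0.
rewrite -cardA -[rank_mod _ _]card_ord; apply: (scard_homs chA (y := w)) => [u|h hP i].
  have [n [h hP]] := span u; exists (g0 * 'X^n), h; split=> //.
  rewrite rmorphM rmorphXn /= evzX mulf_neq0 ?expf_neq0 //.
  exact: (evz_aperiodic p_pr cardA apc g0_nz kg).
by apply: (evz_redp0 p_pr chA); exact: iw hP i.
Qed.

End Rank.

(** * Clearing denominators in a rational decomposition *)

Local Notation polyQ := (map_poly (intr : int -> rat)).

Section IntegralData.
Variables (V : lmodType {poly int}) (T : lmodType {poly rat}) (io : V -> T).
Hypothesis io_add : forall u v, io (u + v) = io u + io v.
Hypothesis ioZ : forall g v, io (g *: v) = polyQ g *: io v.
Hypothesis io_torsion : forall v, io v = 0 -> exists2 n, (0 < n)%N & v *+ n = 0.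
Hypothesis io_dense : forall z, exists n v, (0 < n)%N /\ z *+ n = io v.
Variables (s r : nat) (a : 'I_s -> {poly rat}) (x : 'I_s -> T) (y : 'I_r -> T).
Hypothesis xy_span : forall z, exists n G H,
  'X^n *: z = \sum_(j < s) G j *: x j + \sum_(l < r) H l *: y l.
Hypothesis xy_rel : forall G H, \sum_(j < s) G j *: x j + \sum_(l < r) H l *: y l = 0 ->
  (forall j, a j %| G j) /\ forall l, H l = 0.
Hypothesis ax0 : forall j, a j *: x j = 0.
Variables (m : nat) (gens : 'I_m -> V).
Hypothesis genP : forall u : V, exists n (g : 'I_m -> {poly int}), 'X^n *: u = \sum_i g i *: gens i.

Let io0 : io 0 = 0.
Proof. by apply: (addrI (io 0)); rewrite -io_add !addr0. Qed.
Let ioN v : io (- v) = - io v.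
Proof. by apply: (addrI (io v)); rewrite -io_add !subrr io0. Qed.
Let ioMn v n : io (v *+ n) = io v *+ n.
Proof. by elim: n => [|n IH]; rewrite ?mulr0n ?io0 // !mulrS io_add IH. Qed.
Let io_sum (I : Type) (q : seq I) (F : I -> V) : io (\sum_(i <- q) F i) = \sum_(i <- q) io (F i).
Proof. by elim/big_rec2: _ => [|i z u _ <-]; rewrite ?io0 ?io_add. Qed.

(** From a presentation of T, an integral one for V: the elements of T that lie in the
    span of the u and w, up to an integer factor and a power of x, are closed under
    all operations, hence exhaust T; as V is finitely generated, one integer M serves
    for all of its elements. *)
Lemma integral_data : exists (M : nat) (u : 'I_s -> V) (w : 'I_r -> V),
  [/\ (0 < M)%N,
      forall v, exists n h h', (M%:R * 'X^n) *: v = \sum_j h j *: u j + \sum_l h' l *: w l,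
      forall h h', \sum_j h j *: u j + \sum_l h' l *: w l = 0 ->
         (forall j, a j %| polyQ (h j)) /\ forall l, h' l = 0 &
      forall j (b : {poly int}), a j %| polyQ b -> exists2 n, (0 < n)%N & (n%:R * b) *: u j = 0].
Proof.
have [mx /choice[u ux]] := choice (fun j => io_dense (x j)).
have [my /choice[w wy]] := choice (fun l => io_dense (y l)).
pose Sp v := exists (h : 'I_s -> {poly int}) (h' : 'I_r -> {poly int}), v = \sum_j h j *: u j + \sum_l h' l *: w l.
have SpD v v' : Sp v -> Sp v' -> Sp (v + v').
  move=> [h [h' ->]] [k [k' ->]]; exists (fun j => h j + k j), (fun l => h' l + k' l).
  by rewrite addrACA -!big_split; congr (_ + _); apply: eq_bigr => i _; rewrite scalerDl.
have SpZ g v : Sp v -> Sp (g *: v).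
  move=> [h [h' ->]]; exists (fun j => g * h j), (fun l => g * h' l).
  rewrite scalerDr !scaler_sumr; congr (_ + _); apply: eq_bigr => i _; by rewrite scalerA.
have Sp0 : Sp 0.
  by exists (fun=> 0), (fun=> 0); rewrite !big1 ?addr0 // => i _; rewrite scale0r.
have Spu j : Sp (u j).
  exists (fun i => (i == j)%:R), (fun=> 0).
  rewrite [X in _ + X]big1 => [|l _]; last by rewrite scale0r.
  rewrite (bigD1 j) //= eqxx scale1r big1 ?addr0 // => i /negPf ->; exact: scale0r.
have Spw l : Sp (w l).
  exists (fun=> 0), (fun i => (i == l)%:R).
  rewrite [X in X + _]big1 => [|j _]; last by rewrite scale0r.
  rewrite (bigD1 l) //= eqxx scale1r big1 ?addr0 ?add0r // => i /negPf ->; exact: scale0r.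
pose W z := exists n D v, [/\ (0 < D)%N, Sp v & ('X^n *: z) *+ D = io v].
have WD z z' : W z -> W z' -> W (z + z').
  move=> [n [D [v [D0 Sv E]]]] [n' [D' [v' [D'0 Sv' E']]]].
  exists (n + n')%N, (D * D')%N, ((D'%:R * 'X^n') *: v + (D%:R * 'X^n) *: v'); split.
  - by rewrite muln_gt0 D0.
  - by apply: SpD; apply: SpZ.
  have key (i i' d d' : nat) (z1 : T) :
      polyQ (d'%:R * 'X^i') *: (('X^i *: z1) *+ d) = ('X^(i + i') *: z1) *+ (d * d').
    rewrite rmorphM rmorph_nat rmorphXn /= map_polyX -scalerA scaler_nat -scalerMnr scalerA.
    by rewrite -exprD addnC -mulrnA.
  by rewrite io_add !ioZ -E -E' !key scalerDr mulrnDl [(n' + n)%N]addnC [(D' * D)%N]mulnC.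
have WZ Q z : W z -> W (Q *: z).
  move=> [n [D [v [D0 Sv E]]]]; have [g [c c_nz QE]] := rat_poly_scale Q.
  have QE' : Q *+ `|c|%N = polyQ (sgz c *: g).
    rewrite QE map_polyZ /= scalerMnl -mulr_natr.
    congr (_ *: _); have -> : (`|c|%N)%:R = (sgz c * c)%:~R :> rat.
      by rewrite -[sgz c * c]abszEsg.
    by rewrite rmorphM /= mulrCA mulVf ?mulr1 // intr_eq0.
  exists n, (D * `|c|)%N, ((sgz c *: g) *: v); split.
  - by rewrite muln_gt0 D0 absz_gt0.
  - exact: SpZ.
  by rewrite ioZ -E -QE' -scalerMnl -scalerMnr !scalerA mulrC mulrnA.
have Wx j : W (x j).
  by have [D0 E] := ux j; exists 0%N, (mx j), (u j); split; rewrite // expr0 scale1r.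
have Wy l : W (y l).
  by have [D0 E] := wy l; exists 0%N, (my l), (w l); split; rewrite // expr0 scale1r.
have W0 : W 0 by exists 0%N, 1%N, 0; split; rewrite // scaler0 mul0rn io0.
have WT z : W z.
  have [n [G [H E]]] := xy_span z.
  have : W ('X^n *: z).
    by rewrite E; apply: (WD); (apply: (big_ind W) => [//|z1 z2|i _]; [exact: WD|exact: WZ]).
  move=> [n' [D [v [D0 Sv E']]]]; exists (n' + n)%N, D, v; split=> //.
  by rewrite exprD -scalerA.
have each v : exists M, (0 < M)%N /\ exists n, Sp ((M%:R * 'X^n) *: v).
  have [n [D [v' [D0 Sv' E]]]] := WT (io v).
  have E' : io (('X^n *: v) *+ D - v') = 0.
    by rewrite io_add ioN ioMn ioZ rmorphXn /= map_polyX E subrr.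
  have [k k0 /eqP] := io_torsion E'; rewrite mulrnBl subr_eq0 => /eqP E''.
  exists (D * k)%N; split; first by rewrite muln_gt0 D0.
  exists n; rewrite -scalerA scaler_nat mulrnA E'' -scaler_nat; exact: SpZ.
have [Mg MgP] := choice (fun i => each (gens i)).
exists (\prod_i Mg i)%N, u, w; split.
- by rewrite prodn_gt0 // => i; have [] := MgP i.
- move=> v; set M := (\prod_i Mg i)%N.
  pose W' v := exists n, Sp ((M%:R * 'X^n) *: v).
  suff [n [h [h' E]]] : W' v by exists n, h, h'.
  have W'D v1 v2 : W' v1 -> W' v2 -> W' (v1 + v2).
    move=> [n S1] [n' S2]; exists (n + n')%N; rewrite scalerDr; apply: SpD.
      by rewrite addnC exprD mulrCA -scalerA; apply: SpZ.
    by rewrite exprD mulrCA -scalerA; apply: SpZ.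
  have W'Z g v1 : W' v1 -> W' (g *: v1).
    by move=> [n S1]; exists n; rewrite scalerA mulrC -scalerA; apply: SpZ.
  have W'g i : W' (gens i).
    have [_ [n S1]] := MgP i; exists n; rewrite /M (bigD1 i) //= mulnC natrM -mulrA -scalerA.
    exact: SpZ.
  have W'0 : W' 0 by exists 0%N; rewrite scaler0.
  have [n [g E]] := genP v.
  have [n' S'] : W' ('X^n *: v) by rewrite E; apply: (big_ind W') => [//|z1 z2|i _]; [exact: W'D|apply: W'Z].
  by exists (n' + n)%N; rewrite exprD mulrA -scalerA.
- move=> h h' /(congr1 io); rewrite io0 io_add !io_sum.
  rewrite (eq_bigr (fun j => (polyQ (h j) *+ mx j) *: x j)); last first.
    by move=> j _; rewrite ioZ -(ux j).2 -scalerMnr scalerMnl.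
  rewrite [X in _ + X](eq_bigr (fun l => (polyQ (h' l) *+ my l) *: y l)); last first.
    by move=> l _; rewrite ioZ -(wy l).2 -scalerMnr scalerMnl.
  move=> /xy_rel[dv eq0]; split=> [j|l].
    have := dv j; have -> : polyQ (h j) *+ mx j = (mx j)%:R *: polyQ (h j) by rewrite scaler_nat.
    by rewrite dvdpZr // pnatr_eq0 -lt0n; have [] := ux j.
  have := eq0 l; have -> : polyQ (h' l) *+ my l = (my l)%:R *: polyQ (h' l) by rewrite scaler_nat.
  move/eqP; rewrite scaler_eq0 pnatr_eq0 eqn0Ngt (wy l).1 /= => /eqP E.
  by apply: (map_inj_poly (f := intr : int -> rat)); rewrite ?rmorph0 //; exact: intr_inj.
- move=> j b /dvdpP[q E]; have : io (b *: u j) = 0.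
    by rewrite ioZ E -(ux j).2 -scalerMnr -scalerA ax0 scaler0 mul0rn.
  by move=> /io_torsion[n n0 E']; exists n => //; rewrite -scalerA scaler_nat.
Qed.

End IntegralData.

(** * The tensor product with the rationals *)

Lemma denq_natE (a : rat) : (`|denq a|%N)%:R = (denq a)%:~R :> rat.
Proof. by rewrite pmulrn absz_denq. Qed.

Section RationalTensor.
Variables (N : zmodType) (phi : {additive N -> N}).
Local Notation V := (ZXmod phi).
Local Notation T := (polymod (id_tensor rat phi)).

Definition rat_tensor (v : V) : T := @pure_tensor rat N 1 v.

Lemma pure_tensorD (c : rat) (u v : N) : pure_tensor c (u + v) = pure_tensor c u + pure_tensor c v.
Proof. by rewrite /pure_tensor -tensor_sumD; apply/tensor_sumP/tensor_Dr. Qed.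

Lemma pure_tensorDl (c d : rat) (v : N) : pure_tensor (c + d) v = pure_tensor c v + pure_tensor d v.
Proof. by rewrite /pure_tensor -tensor_sumD; apply/tensor_sumP/tensor_Dl. Qed.

Lemma pure_tensor0 (c : rat) : pure_tensor c (0 : N) = 0.
Proof. by apply: (addrI (pure_tensor c 0)); rewrite -pure_tensorD !addr0. Qed.

Lemma pure_tensor0l (v : N) : pure_tensor (0 : rat) v = 0.
Proof. by apply: (addrI (pure_tensor 0 v)); rewrite -pure_tensorDl !addr0. Qed.

Lemma pure_tensorN (c : rat) (v : N) : pure_tensor c (- v) = - pure_tensor c v.
Proof. by apply: (addrI (pure_tensor c v)); rewrite -pure_tensorD !subrr pure_tensor0. Qed.

Lemma pure_tensorNl (c : rat) (v : N) : pure_tensor (- c) v = - pure_tensor c v.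
Proof. by apply: (addrI (pure_tensor c v)); rewrite -pure_tensorDl !subrr pure_tensor0l. Qed.

Lemma pure_tensorMn (c : rat) (v : N) n : pure_tensor c (v *+ n) = pure_tensor c v *+ n.
Proof. by elim: n => [|n IH]; rewrite ?mulr0n ?pure_tensor0 // !mulrS pure_tensorD IH. Qed.

Lemma pure_tensorMnl (c : rat) (v : N) n : pure_tensor (c *+ n) v = pure_tensor c v *+ n.
Proof. by elim: n => [|n IH]; rewrite ?mulr0n ?pure_tensor0l // !mulrS pure_tensorDl IH. Qed.

Lemma pure_tensor_swap (z : int) (v : N) : pure_tensor (z%:~R : rat) v = pure_tensor 1 (v *~ z).
Proof.
case: z => n; first by rewrite -!pmulrn pure_tensorMnl pure_tensorMn.
by rewrite NegzE !mulrNz pure_tensorN pure_tensorNl -!pmulrn pure_tensorMnl pure_tensorMn.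
Qed.

Lemma pure_tensorZ (c d : rat) (v : N) : c *: pure_tensor d v = pure_tensor (c * d) v.
Proof. exact: tensor_scaleE. Qed.

Lemma rat_tensorD u v : rat_tensor (u + v) = rat_tensor u + rat_tensor v.
Proof. exact: pure_tensorD. Qed.

Lemma rat_tensor_phi v : rat_tensor (phi v) = 'X *: rat_tensor v.
Proof.
rewrite polymodX; symmetry; exact: (tensor_mapE idfun phi [:: (1, v : N)]).
Qed.

Lemma rat_tensorZ (g : {poly int}) v : rat_tensor (g *: v) = polyQ g *: rat_tensor v.
Proof.
elim/poly_ind: g v => [|g z IH] v.
  by rewrite scale0r rmorph0 scale0r; exact: pure_tensor0.
rewrite scalerDl rat_tensorD -scalerA ZXmod_X IH rmorphD rmorphM /= scalerDl -scalerA.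
rewrite map_polyX rat_tensor_phi; congr (_ + _).
rewrite map_polyC ZXmod_C [RHS](@polymod_scaleC _ _ (id_tensor rat phi)).
by rewrite /rat_tensor -pure_tensor_swap pure_tensorZ mulr1.
Qed.

(** If d is a multiple of all denominators that occur in s, this is an element v of N
    such that 1 (x) v is d times the class of s. *)
Let clear (d : nat) (s : seq (rat * N)) : N := \sum_(x <- s) x.2 *~ numq (d%:R * x.1).

Let denq_int (d : nat) (a : rat) : (`|denq a| %| d)%N -> exists z : int, d%:R * a = z%:~R.
Proof.
move=> /dvdnP[k ->]; exists (k%:Z * numq a).
rewrite natrM -mulrA rmorphM /= denq_natE; congr (_ * _).
by rewrite -[X in _ * X = _](divq_num_den a) mulrCA mulfV ?mulr1 // intr_eq0 denq_neq0.
Qed.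

(** Each generating relation of the tensor product is respected once d is a multiple
    of the denominators it involves. *)
Let clear_eq s1 s2 : tensor_eq s1 s2 ->
  exists2 d0, (0 < d0)%N & forall d, (d0 %| d)%N -> clear d s1 = clear d s2.
Proof.
have den_gt0 (c : rat) : (0 < `|denq c|)%N by rewrite absz_gt0 denq_neq0.
elim=> {s1 s2} [s|s1 s2 _ [d d0 E]|s1 s2 s3 _ [d d0 E] _ [d' d'0 E']|s1 s2 s3 s4 _ [d d0 E] _ [d' d'0 E']|s1 s2|v|a b v|a u v].
- by exists 1%N.
- by exists d => // e /E.
- exists (d * d')%N; first by rewrite muln_gt0 d0.
  move=> e dv; rewrite E ?E' //; first exact: dvdn_trans (dvdn_mull _ (dvdnn _)) dv.
  exact: dvdn_trans (dvdn_mulr _ (dvdnn _)) dv.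
- exists (d * d')%N; first by rewrite muln_gt0 d0.
  move=> e dv; rewrite /clear !big_cat; congr (_ + _).
    by apply: E; exact: dvdn_trans (dvdn_mulr _ (dvdnn _)) dv.
  by apply: E'; exact: dvdn_trans (dvdn_mull _ (dvdnn _)) dv.
- by exists 1%N => // d _; rewrite /clear !big_cat /= addrC.
- by exists 1%N => // d _; rewrite /clear big_seq1 big_nil mulr0 mulr0z.
- exists (`|denq a| * `|denq b|)%N; first by rewrite muln_gt0 !den_gt0.
  move=> d dv; rewrite /clear big_seq1 !big_cons big_nil addr0 /=.
  have [z Ez] := denq_int (dvdn_trans (dvdn_mulr _ (dvdnn _)) dv).
  have [z' Ez'] := denq_int (dvdn_trans (dvdn_mull _ (dvdnn _)) dv).
  by rewrite mulrDr Ez Ez' -rmorphD !numq_int mulrzDr.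
- exists 1%N => // d _; rewrite /clear big_seq1 !big_cons big_nil addr0 /=.
  by rewrite mulrzDl.
Qed.

Lemma rat_tensor_torsion v : rat_tensor v = 0 -> exists2 n, (0 < n)%N & v *+ n = 0.
Proof.
move=> /tensor_sumP/clear_eq[d d0 /(_ d (dvdnn d)) E]; exists d => //.
by move: E; rewrite /clear big_seq1 big_nil /= mulr1 [d%:R]pmulrn numq_int -pmulrn.
Qed.

Lemma rat_tensor_dense (z : T) : exists n v, (0 < n)%N /\ z *+ n = rat_tensor v.
Proof.
rewrite -[z](@tensor_sumK rat N); elim: (repr (z : tensor rat N)) => [|[c v] s [n [u [n0 IH]]]].
  by exists 1%N, 0; split=> //; exact/esym/pure_tensor0.
exists (`|denq c| * n)%N, ((v *~ numq c) *+ n + u *+ `|denq c|); split.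
  by rewrite muln_gt0 n0 absz_gt0 denq_neq0.
rewrite -cat1s tensor_sumD mulrnDl; rewrite rat_tensorD; congr (_ + _).
  rewrite mulrnA [RHS]pure_tensorMn; congr (_ *+ _).
  rewrite -[LHS]pure_tensorMnl -[RHS]pure_tensor_swap; congr pure_tensor.
  rewrite -mulr_natr denq_natE -[X in X * _](divq_num_den c).
  by rewrite divfK // intr_eq0 denq_neq0.
by rewrite mulnC mulrnA IH [RHS]pure_tensorMn.
Qed.

Hypothesis phi_surj : forall v, exists u, phi u = v.

Lemma rat_tensor_divX (z : T) : exists z' : T, 'X *: z' = z.
Proof.
have [psi psiK] := choice phi_surj.
exists (tensor_sum [seq (x.1, psi x.2) | x <- repr (z : tensor rat N)]).
rewrite polymodX [LHS](tensor_mapE idfun phi) /tmap -map_comp.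
rewrite -[RHS](@tensor_sumK rat N); congr tensor_sum.
by rewrite -[RHS]map_id; apply: eq_map => -[c v] /=; rewrite psiK.
Qed.

End RationalTensor.

(** * Integral form of the rational decomposition *)

(** The common property of Q[x] and of Q[x, 1/x] that is used: up to powers of x, L is
    free on l0. *)
Definition rank_one (L : lmodType {poly rat}) (l0 : L) : Prop :=
  (forall g : {poly rat}, g *: l0 = 0 -> g = 0) /\
  forall z : L, exists n (h : {poly rat}), 'X^n *: z = h *: l0.

Lemma rank_one_poly : rank_one (1 : {poly rat}^o).
Proof.
split=> [g|z]; first by rewrite [_ *: _]mulr1.
by exists 0%N, z; rewrite expr0 scale1r [RHS]mulr1.
Qed.

Section LaurentRankOne.
Local Notation L := (laurent rat).

Lemma laurent_coefZ (c : rat) (f : laurent_coefs rat) k :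
  laurent_val (c *: f) k = c * laurent_val f k.
Proof. by []. Qed.

Lemma laurent_coef_iter n (f : laurent_coefs rat) (k : int) :
  laurent_val (iter n (@laurent_shift rat) f) k = laurent_val f (k - n%:Z).
Proof.
elim: n k => [|n IH] k; first by rewrite subr0.
by rewrite iterS /= IH; congr laurent_val; lia.
Qed.

Lemma laurent_coef_scale (g : {poly rat}) (f : L) k :
  laurent_val (g *: f) k = \sum_(i < size g) g`_i * laurent_val f (k - i%:Z).
Proof.
have -> : g *: f = polymod_scale g f by [].
rewrite /polymod_scale (big_morph (fun f : laurent_coefs rat => laurent_val f k) (id1 := 0) (op1 := +%R)) //.
by apply: eq_bigr => i _; rewrite laurent_coefZ laurent_coef_iter.
Qed.

Let delta0 : laurent_coefs rat.
Proof.
exists (fun k : int => (k == 0)%:R); apply/asboolP.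
apply: (@sub_finite_set _ _ [set 0]); last exact: finite_set1.
by move=> k /=; have [->|_] := eqVneq k 0; rewrite ?mulr0n ?eqxx.
Defined.

Let laurent_scale_delta (g : {poly rat}) k :
  laurent_val (g *: (delta0 : L)) k = if k is Posz n then g`_n else 0.
Proof.
rewrite laurent_coef_scale /=.
case: k => n; last first.
  rewrite big1 // => i _; rewrite (_ : (_ == _) = false) ?mulr0 //.
  by apply/negbTE; lia.
case: (ltnP n (size g)) => hn.
  rewrite (bigD1 (Ordinal hn)) //= subrr eqxx mulr1 big1 ?addr0 // => i ne.
  rewrite (_ : (_ == _) = false) ?mulr0 //; apply/negbTE.
  by move: ne; apply: contraNneq => E; apply/eqP/val_inj => /=; lia.
rewrite nth_default // big1 // => i _; rewrite (_ : (_ == _) = false) ?mulr0 //.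
have lt_in : (i < n)%N := leq_trans (ltn_ord i) hn.
apply/negbTE; rewrite subr_eq0 eqz_nat. by rewrite gtn_eqF.
Qed.

Lemma rank_one_laurent : exists l0 : L, rank_one l0.
Proof.
exists (delta0 : L); split=> [g E|z].
  by apply/polyP => n; rewrite -[LHS](laurent_scale_delta g n%:Z) E coef0.
have [n zn] : exists n : nat, forall k : int, laurent_val z k != 0 -> (- n%:Z <= k < n%:Z).
  have /asboolP/finite_fsetP[X XE] := valP (z : laurent_coefs rat).
  exists (\sum_(k <- X) `|k|.+1)%N => k kz.
  have kX : k \in X by have : [set` X] k by rewrite -XE.
  have : (`|k|.+1 <= \sum_(k <- X) `|k|.+1)%N by rewrite (big_fsetD1 k) //= leq_addr.
  move: (bigop.body _ _ _) => S; lia.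
exists n, (\poly_(i < n + n) laurent_val z (i%:Z - n%:Z)).
apply: val_inj; apply: funext => k; rewrite [RHS](laurent_scale_delta _ k).
have zE : laurent_val ('X^n *: z) k = laurent_val z (k - n%:Z).
  rewrite laurent_coef_scale size_polyXn big_ord_recr /= coefXn eqxx mul1r big1 ?add0r // => i _.
  by rewrite coefXn ltn_eqF ?mul0r.
have out (j : int) : ~~ (- n%:Z <= j < n%:Z) -> laurent_val z j = 0.
  by move=> h; apply/eqP; apply: contraNT h => /zn.
apply: etrans zE _.
case: k => k; last by apply: out; rewrite NegzE; lia.
rewrite coef_poly; case: ltnP => // hk; apply: out; lia.
Qed.

End LaurentRankOne.

Section Decomposition.
Variables (N : zmodType) (phi : {additive N -> N}).
Local Notation V := (ZXmod phi).
Local Notation T := (polymod (id_tensor rat phi)).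
Hypothesis phi_surj : forall v, exists u, phi u = v.
Variables (m : nat) (gens : 'I_m -> V).
Hypothesis genP : forall u : V, exists n (g : 'I_m -> {poly int}), 'X^n *: u = \sum_i g i *: gens i.
Variables (s r : nat) (a : 'I_s -> {poly rat}).
Hypothesis a_nonunit : forall j, a j \isn't a GRing.unit.
Hypothesis a_dvd : forall i j : 'I_s, (i <= j)%N -> a i %| a j.

Lemma polyquo_eq0 (F : fieldType) (b g : {poly F}) : polyquo_pi b g = 0 <-> b %| g.
Proof.
have -> : (0 : polyquo b) = polyquo_pi b 0 by rewrite /polyquo_pi !piE.
rewrite (rwP eqP) -Quotient.idealrBE subr0.
by [].
Qed.

Section OneSummand.
Variables (L : lmodType {poly rat}) (l0 : L).
Hypothesis L1 : rank_one l0.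
Hypothesis dec : rational_decomposition phi L r a.

Let D1 := dirsum (fun j => polyquo (a j) : lmodType {poly rat}).
Let D2 := dirsum (fun _ : 'I_r => L).

Let dirsum_sum (J : finType) (Mm : J -> lmodType {poly rat}) (I : Type) (q : seq I) (F : I -> dirsum Mm) j :
  (\sum_(i <- q) F i) j = \sum_(i <- q) F i j.
Proof. by elim/big_rec2: _ => // i u v _ <-. Qed.

(** The preimages of the standard generators of the direct sum. The constant
    coefficient of a j is nonzero because x acts invertibly on N, hence on the
    summand Q[x]/(a j). *)
Lemma decomposition_basis : exists (x : 'I_s -> T) (y : 'I_r -> T),
  [/\ forall z, exists n G H, 'X^n *: z = \sum_(j < s) G j *: x j + \sum_(l < r) H l *: y l,
      forall G H, \sum_(j < s) G j *: x j + \sum_(l < r) H l *: y l = 0 ->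
        (forall j, a j %| G j) /\ forall l, H l = 0,
      forall j, a j *: x j = 0 & forall j, (a j)`_0 != 0].
Proof.
have [f f_bij] := dec; have f_inj := bij_inj f_bij.
have [f' f'K fK] := f_bij.
pose e j : D1 := fun i => polyquo_pi (a i) (i == j)%:R.
pose e' l : D2 := fun i => (i == l)%:R *: l0.
pose x j := f' (e j, 0); pose y l := f' (0, e' l).
have fx j : f (x j) = (e j, 0) by rewrite fK.
have fy l : f (y l) = (0, e' l) by rewrite fK.
have fE (G : 'I_s -> {poly rat}) (H : 'I_r -> {poly rat}) : f (\sum_j G j *: x j + \sum_l H l *: y l) =
    ((fun j => polyquo_pi (a j) (G j)) : D1, (fun l => H l *: l0) : D2).
  have f1 : f (\sum_j G j *: x j) = (\sum_j G j *: e j, 0).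
    rewrite linear_sum (eq_bigr (fun j => (G j *: e j, 0))) => [|j _].
      by elim/big_rec2: _ => // j u v _ ->; congr pair; rewrite addr0.
    by rewrite linearZ fx /=; congr pair; rewrite scaler0.
  have f2 : f (\sum_l H l *: y l) = (0, \sum_l H l *: e' l).
    rewrite linear_sum (eq_bigr (fun l => (0, H l *: e' l))) => [|l _].
      by elim/big_rec2: _ => // l u v _ ->; congr pair; rewrite addr0.
    by rewrite linearZ fy /=; congr pair; rewrite scaler0.
  rewrite linearD f1 f2; congr pair; rewrite ?addr0 ?add0r; apply: functional_extensionality_dep => j.
    apply: (etrans (@dirsum_sum _ (fun j => polyquo (a j) : lmodType {poly rat}) _ _ (fun j => G j *: e j) j)).
    rewrite (bigD1 j) //= big1 ?addr0 => [|i ne].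
      by rewrite -[LHS]/(G j *: polyquo_pi (a j) (j == j)%:R) eqxx [LHS]polyquo_scaleE mulr1.
    rewrite -[LHS]/(G i *: polyquo_pi (a j) (j == i)%:R) eq_sym (negPf ne) [LHS]polyquo_scaleE mulr0.
    by apply/polyquo_eq0; rewrite dvdp0.
  apply: (etrans (@dirsum_sum _ (fun _ : 'I_r => L) _ _ (fun l => H l *: e' l) j)).
  rewrite (bigD1 j) //= big1 ?addr0 => [|i ne].
    by rewrite -[LHS]/(H j *: ((j == j)%:R *: l0)) eqxx scale1r.
  by rewrite -[LHS]/(H i *: ((j == i)%:R *: l0)) eq_sym (negPf ne) scale0r scaler0.
exists x, y; split.
- move=> z; case Ez : (f z) => [X Y].
  have [nY /choice[h hP]] := choice (fun l => L1.2 (Y l)).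
  pose n := (\sum_l nY l)%N.
  exists n, (fun j => 'X^n * repr (X j)), (fun l => 'X^(\sum_(i | i != l) nY i) * h l).
  apply: f_inj; rewrite fE linearZ Ez; congr pair; apply: functional_extensionality_dep => j.
  rewrite -[LHS]/('X^n *: Y j) /n (bigD1 j) //= addnC exprD -!scalerA; congr (_ *: _); exact: hP.
- move=> G H /(congr1 f); rewrite fE linear0 => -[E1 E2]; split=> [j|l].
    by apply/polyquo_eq0; exact: (congr1 (fun u : D1 => u j) E1).
  by apply: L1.1; exact: (congr1 (fun u : D2 => u l) E2).
- move=> j; apply: f_inj; rewrite linearZ linear0 fx; congr pair; last by rewrite /= scaler0.
  apply: functional_extensionality_dep => i; rewrite -[LHS]/(a j *: polyquo_pi (a i) (i == j)%:R).
  rewrite [LHS]polyquo_scaleE; apply/polyquo_eq0; have [->|_] := eqVneq i j.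
    by rewrite mulr1.
  by rewrite mulr0 dvdp0.
- move=> j; have [z zx] := rat_tensor_divX phi_surj (x j).
  have : f ('X *: z) = f (x j) by rewrite zx.
  rewrite linearZ fx; case: (f z) => [X Y] /= [/(congr1 (fun u : D1 => u j)) E _].
  have {}E : 'X *: X j = polyquo_pi (a j) 1 by rewrite [LHS]E /e eqxx.
  have /eqP : polyquo_pi (a j) ('X * repr (X j)) = polyquo_pi (a j) 1.
    by rewrite -E -[in RHS](polyquo_piK (X j)); exact/esym/polyquo_scaleE.
  rewrite -Quotient.idealrBE => /dvdpP[q /(congr1 (fun u : {poly rat} => u`_0))].
  rewrite coefB coefXM coef1 coef0M /= => /eqP; apply: contraTneq => ->.
  by rewrite mulr0 sub0r oppr_eq0 oner_eq0.
Qed.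

End OneSummand.

(** Gauss's lemma: divisibility by the primitive polynomial b over Q implies
    divisibility over Z. *)
Let a_primitive j : exists b : {poly int}, [/\ zprimitive b = b,
  forall g : {poly int}, (a j %| polyQ g) = (b %| g) & exists2 c, c != 0 & a j = c *: polyQ b].
Proof.
have [b [c c_nz E]] := rat_poly_scale (a j).
have b_dvd g : (zprimitive b %| g) = (b %| g).
  have [->|nz] := eqVneq b 0; first by rewrite zprimitive0.
  by rewrite [in RHS](zpolyEprim b) Pdiv.Idomain.dvdpZl ?zcontents_eq0.
exists (zprimitive b); split; first exact: zprimitive_id.
  by move=> g; rewrite E dvdpZl ?invr_eq0 ?intr_eq0 // dvdp_rat_int b_dvd.
have [b0|nz] := eqVneq b 0.
  by exists 1; rewrite ?oner_eq0 // E b0 zprimitive0 rmorph0 !scaler0.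
exists (c%:~R^-1 * (zcontents b)%:~R); first by rewrite mulf_neq0 ?invr_eq0 ?intr_eq0 ?zcontents_eq0.
by rewrite E [in LHS](zpolyEprim b) map_polyZ scalerA.
Qed.

(** Up to finite index and powers of x, N is the direct sum of the Z[x]/(b j), generated
    by the u j, and of the free module on the w l; the u j satisfy b j (u j) = 0 only up
    to the factor M. *)
Lemma rational_data :
    rational_decomposition phi ({poly rat}^o : lmodType {poly rat}) r a \/
    rational_decomposition phi (laurent rat) r a ->
  exists (M : nat) (u : 'I_s -> V) (w : 'I_r -> V) (b : 'I_s -> {poly int}),
  [/\ (0 < M)%N,
      forall v, exists n h h', (M%:R * 'X^n) *: v = \sum_j h j *: u j + \sum_l h' l *: w l,
      forall h h', \sum_j h j *: u j + \sum_l h' l *: w l = 0 ->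
         (forall j, exists e, h j = b j * e) /\ forall l, h' l = 0,
      forall j, (M%:R * b j) *: u j = 0 &
      (forall i j : 'I_s, (i <= j)%N -> exists e, b j = b i * e) /\
      forall j, (1 < size (b j))%N /\ (b j)`_0 != 0].
Proof.
move=> dec.
have [x [y [xy_span xy_rel ax0 a0]]] : exists (x : 'I_s -> T) (y : 'I_r -> T),
  [/\ forall z, exists n G H, 'X^n *: z = \sum_(j < s) G j *: x j + \sum_(l < r) H l *: y l,
      forall G H, \sum_(j < s) G j *: x j + \sum_(l < r) H l *: y l = 0 ->
        (forall j, a j %| G j) /\ forall l, H l = 0,
      forall j, a j *: x j = 0 & forall j, (a j)`_0 != 0].
  have [l0 L1] := rank_one_laurent.
  by case: dec => [/(decomposition_basis rank_one_poly)|/(decomposition_basis L1)].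
have [M [u [w [M0 span rel tor]]]] := integral_data (@rat_tensorD _ phi) (@rat_tensorZ _ phi)
  (@rat_tensor_torsion _ phi) (@rat_tensor_dense _ phi) xy_span xy_rel ax0 genP.
have [b bP] := choice a_primitive.
have tor_b j : exists n, (0 < n)%N /\ (n%:R * b j) *: u j = 0.
  have [prim dv _] := bP j.
  have [|n n0 E] := tor j (b j); last by exists n.
  by rewrite dv Pdiv.Idomain.dvdpp.
have [n nP] := choice tor_b.
exists (M * \prod_j n j)%N, u, w, b; split.
- by rewrite muln_gt0 M0 prodn_gt0 // => j; have [] := nP j.
- move=> v; have [k [h [h' E]]] := span v; exists k.
  exists (fun j => (\prod_j n j)%:R * h j), (fun l => (\prod_j n j)%:R * h' l).
  rewrite mulnC natrM -mulrA -scalerA E scalerDr !scaler_sumr.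
  by congr (_ + _); apply: eq_bigr => i _; rewrite scalerA.
- move=> h h' /rel[dv h'0]; split=> // j; have [prim bdv _] := bP j.
  by have := dv j; rewrite bdv => /dvdpP_int[e]; rewrite prim => ->; exists e.
- move=> j; rewrite (bigD1 j) //= [(n j * _)%N]mulnC mulnA natrM -mulrA -scalerA.
  by rewrite (nP j).2 scaler0.
- split=> [i j le_ij|j].
    have [prim bdv _] := bP i; have [_ _ [c c_nz ajE]] := bP j.
    have : a i %| polyQ (b j) by have := a_dvd le_ij; rewrite ajE dvdpZr.
    by rewrite bdv => /dvdpP_int[e]; rewrite prim => ->; exists e.
  have [_ _ [c c_nz ajE]] := bP j.
  have b0 : (b j)`_0 != 0.
    have := a0 j; rewrite ajE coefZ coef_map mulf_eq0 negb_or => /andP[_].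
    by rewrite intr_eq0.
  split=> //; have := a_nonunit j; rewrite poly_unitE ajE size_scale // size_rat_int_poly.
  rewrite coefZ coef_map unitfE mulf_eq0 negb_or c_nz intr_eq0 b0 andbT.
  have : b j != 0 by apply: contraNneq b0 => ->; rewrite coef0.
  by rewrite -size_poly_gt0; case: size => [|[]].
Qed.

End Decomposition.

(** * Homomorphisms modulo large primes *)

(** If b0 = b(0) and F is a factorial, then b(b0 F y) = b0 (1 + F c) for some integer
    c; for suitable y the second factor is not 1 or -1, and its prime factors do not
    divide F. *)
Lemma primes_with_root (b : {poly int}) B : (1 < size b)%N -> b`_0 != 0 ->
  exists p, [/\ prime p, (B < p)%N & exists z : int, (p%:Z %| b.[z])%Z].
Proof.
move=> b_sz b0_nz; set b0 := b`_0 in b0_nz *.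
pose F : int := (B`!)%:Z.
have F_nz : F != 0 by rewrite eqz_nat -lt0n fact_gt0.
pose pt (y : nat) : int := b0 * F * y%:Z.
have pt_inj : injective pt by move=> y y' /(mulfI (mulf_neq0 b0_nz F_nz)) [].
pose P := (b - b0%:P) * (b + b0%:P).
have nz (c : int) : b + c%:P != 0.
  by apply/eqP => E; move: b_sz; rewrite -(addrK c%:P b) E sub0r size_polyN ltnNge size_polyC_leq1.
have P_nz : P != 0 by rewrite mulf_neq0 // -polyCN nz.
(* b takes the values b0 and - b0 finitely many times. *)
have [y Py] : exists y, P.[pt y] != 0.
  apply: contrapT => /forallNP h.
  have := max_poly_roots P_nz (rs := map pt (iota 0 (size P))).
  rewrite map_inj_uniq ?iota_uniq // size_map size_iota ltnn => /(_ _ isT) h'.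
  suff: false by []; apply: h'; apply/allP => _ /mapP[y _ ->].
  by rewrite rootE; apply/negPn/negP/h.
pose z := pt y.
have [c bE] : exists c, b.[z] = b0 * (1 + F * c).
  pose b' := drop_poly 1 b.
  have -> : b = b0%:P + b' * 'X.
    have := poly_take_drop 1 b; rewrite expr1 => {1}<-; congr (_ + _).
    by apply/polyP => -[|i]; rewrite coef_take_poly coefC.
  exists (y%:Z * b'.[z]); rewrite hornerD hornerC hornerM hornerX {2}/z /pt.
  by rewrite mulrDr mulr1; congr (_ + _); rewrite mulrC -!mulrA.
set t := 1 + F * c in bE.
have t_ne1 : `|t|%N != 1%N.
  apply: contraNneq Py; rewrite hornerM hornerD hornerN hornerD !hornerC -/z bE.
  case: (intP t) => [|n|n] //.
    by rewrite absz_nat => -[->]; rewrite mulr1 subrr mul0r.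
  by rewrite abszN absz_nat => -[->]; rewrite mulrN1 addNr mulr0.
(* If b.[z] = 0, then every prime divides it. *)
have [t0|t_nz] := eqVneq t 0.
  have [p lt_Bp p_pr] := prime_above B; exists p; split=> //.
  by exists z; rewrite bE t0 mulr0 dvdz0.
have t_gt1 : (1 < `|t|)%N by move: t_ne1 t_nz; rewrite -absz_eq0; case: `|t|%N => [|[|]].
have p_pr := pdiv_prime t_gt1; exists (pdiv `|t|); split=> //; last first.
  by exists z; rewrite bE; apply: dvdz_mull; rewrite dvdzE pdiv_dvd.
rewrite ltnNge; apply/negP => le_pB.
have pF : ((pdiv `|t|)%:Z %| F)%Z by rewrite dvdzE dvdn_fact // pdiv_gt0.
have pt' : ((pdiv `|t|)%:Z %| t)%Z by rewrite dvdzE pdiv_dvd.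
have : ((pdiv `|t|)%:Z %| t - F * c)%Z by rewrite rpredB // dvdz_mulr.
have -> : t - F * c = 1 by rewrite /t addrK.
by rewrite dvdzE absz_nat dvdn1 => /eqP p1; move: p_pr; rewrite p1.
Qed.

Section LargePrimes.
Variables (N : zmodType) (phi : {additive N -> N}).
Local Notation V := (ZXmod phi).
Variables (s r M : nat) (u : 'I_s -> V) (w : 'I_r -> V) (b : 'I_s -> {poly int}).
Hypothesis span : forall v, exists n h h',
  (M%:R * 'X^n) *: v = \sum_j h j *: u j + \sum_l h' l *: w l.
Hypothesis rel : forall h h', \sum_j h j *: u j + \sum_l h' l *: w l = 0 ->
  (forall j, exists e, h j = b j * e) /\ forall l, h' l = 0.
Hypothesis tor : forall j, (M%:R * b j) *: u j = 0.

Let uw (i : 'I_s + 'I_r) : V := match i with inl j => u j | inr l => w l end.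

Let sum_uw (h : 'I_s + 'I_r -> {poly int}) :
  \sum_i h i *: uw i = \sum_j h (inl j) *: u j + \sum_l h (inr l) *: w l.
Proof. by rewrite big_sumType. Qed.

Let comb (J : finType) (y : J -> V) (g : {poly int}) (h k : J -> {poly int}) p :
  \sum_j (g * h j - k j *+ p) *: y j = g *: (\sum_j h j *: y j) - (\sum_j k j *: y j) *+ p.
Proof.
rewrite [g *: _]scaler_sumr -sumrMnl -sumrB; apply: eq_bigr => j _.
by rewrite scalerBl scalerA scalerMnl.
Qed.

(** A congruence modulo p between the u and w becomes an equality after multiplication
    by M x^n, since M x^n N lies in the span of the u and w. *)
Let rel_p p (h : 'I_s + 'I_r -> {poly int}) : pmult p (\sum_i h i *: uw i) ->
  exists n k, (forall j, exists e, M%:R * 'X^n * h (inl j) = b j * e + k (inl j) *+ p) /\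
    forall l, M%:R * 'X^n * h (inr l) = k (inr l) *+ p.
Proof.
move=> [z zE]; have [n [k [k' E]]] := span z.
exists n, (fun i => match i with inl j => k j | inr l => k' l end).
have : \sum_j (M%:R * 'X^n * h (inl j) - k j *+ p) *: u j +
       \sum_l (M%:R * 'X^n * h (inr l) - k' l *+ p) *: w l = 0.
  transitivity ((M%:R * 'X^n) *: (\sum_i h i *: uw i) - ((M%:R * 'X^n) *: z) *+ p); last first.
    by rewrite zE scalerMnr subrr.
  rewrite E sum_uw scalerDr mulrnDl opprD addrACA; congr (_ + _).
    exact: (comb u _ (fun j => h (inl j))).
  exact: (comb w _ (fun l => h (inr l))).
move=> /rel[dv eq0]; split=> [j|l].
  by have [e E'] := dv j; exists e; rewrite -E' subrK.
by apply/eqP; rewrite -subr_eq0; apply/eqP/eq0.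
Qed.

Lemma rank_mod_large (m : nat) (gens : 'I_m -> V)
    (genP : forall u : V, exists n (g : 'I_m -> {poly int}), 'X^n *: u = \sum_i g i *: gens i)
    p (p_pr : prime p) : ~~ (p %| M)%N -> (r <= rank_mod phi p_pr)%N.
Proof.
move=> pM; apply: (@rank_mod_ge _ _ _ _ genP p p_pr r w) => h hP l.
pose h1 (i : 'I_s + 'I_r) := if i is inr l then h l else 0.
have /rel_p[n [k [_ /(_ l) E]]] : pmult p (\sum_i h1 i *: uw i).
  by rewrite sum_uw big1 ?add0r // => j _; rewrite scale0r.
have p0 : redp p (k (inr l) *+ p) = 0 by rewrite -mulr_natr rmorphM /= redp_nat // mulr0.
have /eqP := congr1 (redp p) E; rewrite p0 !rmorphM rmorph_nat rmorphXn /= /redp map_polyX.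
rewrite !mulf_eq0 expf_eq0 polyX_eq0 andbF orbF -(rmorph_nat polyC) polyC_eq0.
by rewrite -(dvdn_pcharf (pchar_Fp p_pr)) (negPf pM) /= => /eqP.
Qed.

Section Char.
Variables (A : finFieldType) (p : nat).
Hypotheses (chA : p \in [pchar A]) (pM : ~~ (p %| M)%N).
Variables (c : A).
Hypothesis c_nz : c != 0.

Let M_nz : M%:R != 0 :> A. Proof. by rewrite -(dvdn_pcharf chA). Qed.

Let uw_span : spanning_at p c uw.
Proof.
move=> v; have [n [h [h' E]]] := span v.
exists (M%:R * 'X^n), (fun i => match i with inl j => h j | inr l => h' l end); split.
  by rewrite rmorphM rmorph_nat rmorphXn /= evzX mulf_neq0 ?expf_neq0.
by rewrite sum_uw E subrr; exact: pmult0.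
Qed.

Lemma scard_homs_large_le : (scard (homs phi c) <= #|A| ^ (s + r))%N.
Proof.
have [_] := scard_homs_le chA uw_span.
by rewrite card_sum !card_ord.
Qed.

Lemma scard_homs_large_nonroot : evz c (\prod_j b j) != 0 ->
  (scard (homs phi c) <= #|A| ^ r)%N.
Proof.
move=> bc.
have w_span : spanning_at p c w.
  move=> v; have [n [h [h' E]]] := span v.
  pose B := M%:R * \prod_j b j.
  exists (B * (M%:R * 'X^n)), (fun l => B * h' l); split.
    by rewrite !rmorphM !rmorph_nat rmorphXn /= evzX !mulf_neq0 ?expf_neq0.
  have Bu j : B *: u j = 0.
    by rewrite /B (bigD1 j) // mulrA mulrC -scalerA tor scaler0.
  have Bu0 : B *: \sum_j h j *: u j = 0.
    rewrite [LHS]scaler_sumr big1 // => j _.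
    by rewrite scalerA mulrC -scalerA Bu scaler0.
  have Bw : B *: \sum_l h' l *: w l = \sum_l (B * h' l) *: w l.
    by rewrite [LHS]scaler_sumr; apply: eq_bigr => l _; rewrite scalerA.
  by rewrite -scalerA E scalerDr Bu0 Bw add0r subrr; exact: pmult0.
have [_] := scard_homs_le chA w_span.
by rewrite card_ord.
Qed.

Lemma scard_homs_large_root : (forall j, evz c (b j) = 0) ->
  scard (homs phi c) = (#|A| ^ (s + r))%N.
Proof.
move=> bc; rewrite (scard_homs chA uw_span) ?card_sum ?card_ord // => h /rel_p[n [k [E1 E2]]].
have p0 g : evz c (g *+ p) = 0 by rewrite rmorphMn /= -mulr_natl (pcharf0 chA) mul0r.
have cancel_M g : evz c (M%:R * 'X^n * g) = 0 -> evz c g = 0.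
  rewrite !rmorphM rmorph_nat rmorphXn /= evzX => /eqP.
  by rewrite !mulf_eq0 (negPf M_nz) expf_eq0 (negPf c_nz) andbF => /eqP.
case=> [j|l]; apply: cancel_M; last by rewrite E2 p0.
by have [e ->] := E1 j; rewrite rmorphD rmorphM /= bc mul0r add0r; exact: p0.
Qed.

End Char.
End LargePrimes.

(** * Bounds on the number of supplements *)

Lemma ndvd_of_lt (p n : nat) : (0 < n)%N -> (n < p)%N -> ~~ (p %| n)%N.
Proof. by move=> n0 lt_np; apply/negP => /dvdn_leq; rewrite n0 leqNgt lt_np => /(_ isT). Qed.

Lemma prime_pow_gt1 p k : prime p -> (0 < k)%N -> (1 < p ^ k)%N.
Proof. by move=> p_pr k0; rewrite -(exp1n k) ltn_exp2r ?prime_gt1. Qed.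

(** As q <= 2 (q - 1), the factor q / (q - 1) costs at most 2. *)
Lemma cancel_pred (T k q X : nat) : (1 < q)%N -> (T * (k * q.-1) = q * X)%N -> (T * k <= 2 * X)%N.
Proof.
move=> q1 E; have : (T * k * q.-1 <= 2 * X * q.-1)%N.
  by rewrite -mulnA E mulnAC leq_mul2r; apply/orP; right; lia.
by rewrite leq_pmul2r //; lia.
Qed.

Section Bounds.
Variables (G : groupType) (N : zmodType) (iota : N -> G) (phi : {additive N -> N}) (t : G).
Hypothesis sd : semidirect_by_Z iota t phi.
Local Notation V := (ZXmod phi).
Variables (m : nat) (gens : 'I_m -> V).
Hypothesis genP : forall u : V, exists n (g : 'I_m -> {poly int}), 'X^n *: u = \sum_i g i *: gens i.
Local Notation T2 p k := (scard (supplements iota p k)).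
Local Notation homsum p k A := (\sum_(c : A | `[< aperiodic p k c >]) (scard (homs phi c)).-1)%N.

Let count p k (A : finFieldType) : prime p -> (0 < k)%N -> #|A| = (p ^ k)%N ->
  (T2 p k * (k * (p ^ k).-1) = p ^ k * homsum p k A)%N.
Proof. by move=> p_pr k0 cardA; have [] := supplements_count sd genP p_pr k0 cardA. Qed.

(** x acts surjectively on N, so it can only act as zero through the zero map. *)
Let homs0_card (A : finFieldType) : (scard (homs phi (0%R : A))).-1 = 0%N.
Proof.
pose z : V -> A := fun=> 0.
suff : (scard (homs phi (0%R : A)) <= scard [set z])%N.
  by rewrite {2}/scard fset_set1 cardfs1; case: scard => [|[]].
apply: scard_le; first exact: finite_set1.
move=> psi hpsi; apply: funext => v; have [v' <-] := phi_surj sd v.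
by rewrite hpsi.2 mul0r.
Qed.

Lemma supplements_small p (p_pr : prime p) : exists K, forall k, (K <= k)%N -> (0 < k)%N ->
  (T2 p k * k <= 2 * (p ^ k) ^ (rank_max phi).+1)%N.
Proof.
have [K KP] := scard_homs_small genP p_pr; exists K => k le_K k0.
have [A chA cardA] := pPrimePowerField p_pr k0.
apply: leq_trans (cancel_pred (prime_pow_gt1 p_pr k0) (count p_pr k0 cardA)) _.
rewrite leq_mul2l /= expnS.
have le_r : ((p ^ k) ^ rank_mod phi p_pr <= (p ^ k) ^ rank_max phi)%N.
  by rewrite leq_exp2l ?prime_pow_gt1 // (rank_max_ge genP).
pose Z := (\sum_(c : A) (p ^ k) ^ rank_max phi)%N.
apply: (@leq_trans Z); rewrite /Z; last first.
  by rewrite sum_nat_const cardT -cardE cardA.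
rewrite big_mkcond; apply: leq_sum => c _; case: asboolP => // apc.
by rewrite (KP k A c le_K cardA apc); apply: leq_trans (leq_pred _) le_r.
Qed.

(** For k prime, at least q - p >= q / 2 elements c of the field with q = p^k elements
    are generators; the factor 4 also absorbs q^R <= 2 (q^R - 1). *)
Lemma supplements_fixed_prime : (0 < rank_max phi)%N -> exists2 p, prime p &
  forall L, exists k, [/\ (L < k)%N, (0 < k)%N &
    ((p ^ k) ^ (rank_max phi).+1 <= 4 * k * T2 p k)%N].
Proof.
move=> rm; have [p [p_pr rE]] := rank_max_attained genP.
exists p => // L; have [K KP] := scard_homs_small genP p_pr.
have [k lt_k k_pr] := prime_above (maxn L K).
move: lt_k; rewrite gtn_max => /andP[lt_L lt_K].
exists k; split=> //; first exact: prime_gt0.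
have k0 := prime_gt0 k_pr.
have [A chA cardA] := pPrimePowerField p_pr k0.
have E := count p_pr k0 cardA.
have p2 := prime_gt1 p_pr; have k2 := prime_gt1 k_pr.
rewrite rE in KP; set R := rank_max phi in rm KP *.
have sumE : homsum p k A = (scard [set c : A | aperiodic p k c] * ((p ^ k) ^ R).-1)%N.
  rewrite (eq_bigr (fun=> ((p ^ k) ^ R).-1)%N) => [|c /asboolP apc]; last first.
    by rewrite (KP k A c (ltnW lt_K) cardA apc).
  rewrite sum_nat_const; congr muln.
  have [_ ->] := @scard_seq _ [set c : A | aperiodic p k c] (enum [pred c : A | `[< aperiodic p k c >]]) (enum_uniq _)
    (fun c => conj (fun h => etrans (mem_enum _ c) (asboolT h)) (fun h => asboolW (etrans (esym (mem_enum _ c)) h))).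
  by rewrite -cardE.
have ap := card_aperiodic_prime p_pr cardA k_pr.
set a := scard [set c : A | aperiodic p k c] in ap sumE.
have qp : (2 * p <= p ^ k)%N.
  apply: (@leq_trans (p ^ 2)); last by rewrite leq_exp2l.
  by rewrite expnS expn1 leq_mul2r p2 orbT.
have q2 : (1 < p ^ k)%N := prime_pow_gt1 p_pr k0.
have qR : (p ^ k <= (p ^ k) ^ R)%N by rewrite -{1}(expn1 (p ^ k)) leq_exp2l.
rewrite sumE in E; rewrite expnS.
set q := (p ^ k)%N in E qp q2 qR ap *; set Q := (q ^ R)%N in E qR *.
have h1 : (q <= 2 * a)%N by lia.
have h2 : (Q <= 2 * Q.-1)%N by lia.
have h3 : (q * Q <= 4 * (a * Q.-1))%N by nia.
have : (q * Q * q.-1 <= 4 * k * T2 p k * q.-1)%N.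
  rewrite (_ : 4 * k * T2 p k * q.-1 = 4 * (q * (a * Q.-1)))%N; last by rewrite -E; lia.
  by nia.
by rewrite leq_pmul2r //; lia.
Qed.

Variables (s r M : nat) (u : 'I_s -> V) (w : 'I_r -> V) (b : 'I_s -> {poly int}).
Hypothesis M_gt0 : (0 < M)%N.
Hypothesis span : forall v, exists n h h',
  (M%:R * 'X^n) *: v = \sum_j h j *: u j + \sum_l h' l *: w l.
Hypothesis rel : forall h h', \sum_j h j *: u j + \sum_l h' l *: w l = 0 ->
  (forall j, exists e, h j = b j * e) /\ forall l, h' l = 0.
Hypothesis tor : forall j, (M%:R * b j) *: u j = 0.
Hypothesis b_dvd : forall i j : 'I_s, (i <= j)%N -> exists e, b j = b i * e.
Hypothesis b_size : forall j, (1 < size (b j))%N /\ (b j)`_0 != 0.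

Let B := \prod_j b j.

Let b_nz j : b j != 0.
Proof. by apply: contraNneq (b_size j).2 => ->; rewrite coef0. Qed.

Let B_nz : B != 0. Proof. by apply/prodf_neq0 => j _. Qed.

(** Primes beyond this number divide neither M, nor the leading coefficient of B, nor
    the constant coefficient of B. *)
Let bad := (M + `|(lead_coef B)%R| + `|(B`_0)%R|)%N.

Let redB p (p_pr : prime p) : (bad < p)%N -> redp p B != 0.
Proof.
move=> lt_p; apply/eqP => /(congr1 (fun g : {poly 'F_p} => g`_(size B).-1)).
rewrite coef0 coef_map -lead_coefE => /eqP; rewrite -(dvdz_pcharf (pchar_Fp p_pr)) dvdzE.
apply/negP/ndvd_of_lt; first by rewrite absz_gt0 lead_coef_eq0.
by apply: leq_ltn_trans lt_p; rewrite /bad addnAC leq_addl.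
Qed.

Let pM p : (bad < p)%N -> ~~ (p %| M)%N.
Proof. by move=> lt_p; apply: ndvd_of_lt => //; apply: leq_ltn_trans lt_p; rewrite /bad -addnA leq_addr. Qed.

(** The first term bounds the contribution of the roots of B, the second one that of
    all other c. *)
Lemma supplements_large p k : prime p -> (bad < p)%N -> (0 < k)%N ->
  (T2 p k <= 2 * (size B * (p ^ k) ^ (s + r) + (p ^ k) ^ r.+1))%N.
Proof.
move=> p_pr lt_p k0; have [A chA cardA] := pPrimePowerField p_pr k0.
have E := cancel_pred (prime_pow_gt1 p_pr k0) (count p_pr k0 cardA).
apply: leq_trans (leq_pmulr _ k0) (leq_trans E _).
rewrite leq_mul2l /=.
pose Z := (\sum_(c : A) (if evz c B == 0%R then (p ^ k) ^ (s + r) else 0) + \sum_(c : A) (p ^ k) ^ r)%N.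
apply: (@leq_trans Z); rewrite /Z.
  rewrite -big_split /= big_mkcond /=; apply: leq_sum => c _.
  case: ifP => // _.
  have [->|c_nz] := eqVneq c 0; first by rewrite homs0_card.
  apply: leq_trans (leq_pred _) _; rewrite -cardA.
  have [Bc|Bc] := eqVneq (evz c B) 0.
    exact: leq_trans (scard_homs_large_le span chA (pM lt_p) c_nz) (leq_addr _ _).
  by rewrite add0n; exact: (scard_homs_large_nonroot span tor chA (pM lt_p) c_nz Bc).
rewrite sum_nat_const cardT -cardE cardA -expnS leq_add2r -big_mkcond sum_nat_const.
rewrite leq_mul2r; apply/orP; right; rewrite cardE; apply: ltnW.
apply: (evz_roots p_pr chA (redB p_pr lt_p)); first exact: enum_uniq.
by move=> c; rewrite mem_enum => /eqP.
Qed.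

Lemma free_rank_le_rank_max : (r <= rank_max phi)%N.
Proof.
have [p lt_p p_pr] := prime_above bad.
exact: leq_trans (rank_mod_large span rel genP p_pr (pM lt_p)) (rank_max_ge genP p_pr).
Qed.

(** One common root c of the b j modulo p suffices: b_0 divides all of them. *)
Lemma supplements_root (s_gt0 : (0 < s)%N) L : exists p, [/\ prime p, (L < p)%N &
  (p ^ (s + r) <= T2 p 1)%N].
Proof.
pose j0 := Ordinal s_gt0.
have [sz0 c0] := b_size j0.
have [p [p_pr lt_p [z pz]]] := primes_with_root (maxn bad L) sz0 c0.
move: lt_p; rewrite gtn_max => /andP[lt_p lt_L].
exists p; split=> //.
have [A chA cardA] := pPrimePowerField p_pr (isT : (0 < 1)%N).
have E := count p_pr (isT : (0 < 1)%N) cardA.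
pose c : A := z%:~R.
have evc g : evz c g = (g.[z])%:~R.
  by rewrite /evz /= /horner_eval horner_map.
have bc j : evz c (b j) = 0.
  have [e ->] := b_dvd (leq0n j : (j0 <= j)%N).
  by rewrite rmorphM /= evc; move: pz; rewrite (dvdz_pcharf chA) => /eqP ->; rewrite mul0r.
have c_nz : c != 0.
  apply/eqP => cz; have := bc j0; rewrite evc => /eqP; rewrite -(dvdz_pcharf chA).
  have pz' : (p%:Z %| z)%Z by rewrite (dvdz_pcharf chA); apply/eqP.
  have [g gE] : exists g, (b j0).[z] = (b j0)`_0 + g * z.
    exists (drop_poly 1 (b j0)).[z]; rewrite -{1}(poly_take_drop 1 (b j0)) hornerD hornerM expr1 hornerX.
    congr (_ + _); rewrite -[RHS](hornerC _ z); congr (_.[_]); apply/polyP => -[|i];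
      by rewrite coef_take_poly coefC.
  rewrite gE => dv0; have {dv0} : (p%:Z %| (b j0)`_0)%Z.
    by rewrite -(addrK (g * z) (b j0)`_0) rpredB // dvdz_mull.
  have B0 : B`_0 = \prod_j (b j)`_0.
    by rewrite -horner_coef0 /B horner_prod; apply: eq_bigr => j _; rewrite horner_coef0.
  move=> dv; have : (p%:Z %| B`_0)%Z by rewrite B0 (bigD1 j0) //= dvdz_mulr.
  rewrite dvdzE; apply/negP/ndvd_of_lt.
    rewrite absz_gt0 B0; apply/prodf_neq0 => j _; exact: (b_size j).2.
  by apply: leq_ltn_trans lt_p; rewrite /bad leq_addl.
have hc : scard (homs phi c) = ((p ^ 1) ^ (s + r))%N.
  by rewrite -cardA; exact: (scard_homs_large_root span rel chA (pM lt_p) c_nz bc).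
have apc : aperiodic p 1 c by exact: aperiodic1.
have lb : ((p ^ (s + r)).-1 <= homsum p 1 A)%N.
  by rewrite (bigD1 c) /= ?hc ?expn1 ?leq_addr //; apply/asboolP.
rewrite expn1 mul1n in E.
have p2 := prime_gt1 p_pr.
have pd : (p <= p ^ (s + r))%N by rewrite -{1}(expn1 p) leq_exp2l //; lia.
have : (p ^ (s + r) * p.-1 <= T2 p 1 * p.-1)%N by rewrite E; nia.
by rewrite leq_pmul2r //; lia.
Qed.

Lemma supplements_free (s0 : s = 0%N) (r_gt0 : (0 < r)%N) p : prime p -> (bad < p)%N ->
  (p ^ r.+1 <= 2 * T2 p 1)%N.
Proof.
move=> p_pr lt_p.
have [A chA cardA] := pPrimePowerField p_pr (isT : (0 < 1)%N).
have E := count p_pr (isT : (0 < 1)%N) cardA.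
have p2 := prime_gt1 p_pr.
have lb : (p.-1 * (p ^ r).-1 <= homsum p 1 A)%N.
  pose Z := (\sum_(c : A | c != 0%R) (p ^ r).-1)%N.
  apply: (@leq_trans Z); rewrite /Z.
    rewrite sum_nat_const leq_mul2r; apply/orP; right.
    have := cardC1 (0 : A); rewrite cardA expn1 => <-.
    by apply: subset_leq_card; apply/fintype.subsetP => c.
  rewrite big_mkcond [leqRHS]big_mkcond; apply: leq_sum => c _; case: ifP => // c_nz.
  have apc : aperiodic p 1 c by exact: aperiodic1.
  have -> : `[< aperiodic p 1 c >] = true by apply/asboolP.
  have bc j : evz c (b j) = 0 by have := leq_ltn_trans (leq0n j) (ltn_ord j); rewrite s0.
  by rewrite (scard_homs_large_root span rel chA (pM lt_p) c_nz bc) cardA expn1 s0.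
rewrite expn1 mul1n in E.
have pd : (p <= p ^ r)%N by rewrite -{1}(expn1 p) leq_exp2l //; lia.
have : (p ^ r.+1 * p.-1 <= 2 * T2 p 1 * p.-1)%N.
  rewrite -[leqRHS]mulnA E expnS; have : (p ^ r <= 2 * (p ^ r).-1)%N by lia.
  by move: (p ^ r)%N lb pd => pr lb pd h; nia.
by rewrite leq_pmul2r //; lia.
Qed.

End Bounds.

(** * Growth *)

Lemma infinite_nat_set (S : set nat) :
  (forall L, exists2 n, (L <= n)%N & S n) -> infinite_set S.
Proof.
move=> unbounded /finite_seqP[s SE].
have [n lt_n] := unbounded (\sum_(x <- s) x).+1.
rewrite SE /= => ns; move: lt_n; apply/negP; rewrite -leqNgt.
by rewrite (big_rem n) //= leq_addr.
Qed.

Lemma scard_setU (T : choiceType) (D E : set T) : finite_set D -> finite_set E ->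
  (scard (D `|` E) <= scard D + scard E)%N.
Proof.
move=> finD finE; rewrite /scard fset_setU // cardfsU; exact: leq_subr.
Qed.

Section Totals.
Variables (G : groupType) (N : zmodType) (iota : N -> G) (phi : {additive N -> N}) (t : G).
Hypothesis sd : semidirect_by_Z iota t phi.
Local Notation V := (ZXmod phi).
Variables (m : nat) (gens : 'I_m -> V).
Hypothesis genP : forall u : V, exists n (g : 'I_m -> {poly int}), 'X^n *: u = \sum_i g i *: gens i.
Local Notation count n := (max_subgroup_count G n).
Local Notation T2 p k := (scard (supplements iota p k)).

Let overN n := [set M : set G | [/\ maximal_subgroup M, has_index M n & forall v, M (iota v)]].

Let countE n : count n = scard [set H : set G | maximal_subgroup H /\ has_index H n].
Proof. by []. Qed.

Let finite_supp p k : prime p -> (0 < k)%N -> finite_set (supplements iota p k).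
Proof.
move=> p_pr k0; have [A _ cardA] := pPrimePowerField p_pr k0.
by have [] := supplements_count sd genP p_pr k0 cardA.
Qed.

Let split_supp p k : [set H : set G | maximal_subgroup H /\ has_index H (p ^ k)] =
  overN (p ^ k) `|` supplements iota p k.
Proof.
apply/seteqP; split=> H /= => [[mH iH]|[[mH iH _]|[mH iH _]]] //.
by have [|] := pselect (forall v, H (iota v)); [left|right].
Qed.

Lemma count_le p k : prime p -> (0 < k)%N -> (count (p ^ k) <= p ^ k + T2 p k)%N.
Proof.
move=> p_pr k0; have [finO leO] := over_N_count sd (p ^ k).
rewrite countE split_supp (leq_trans (scard_setU finO (finite_supp p_pr k0))) //.
by rewrite leq_add2r.
Qed.

Lemma count_ge p k : prime p -> (0 < k)%N -> (T2 p k <= count (p ^ k))%N.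
Proof.
move=> p_pr k0; have [finO leO] := over_N_count sd (p ^ k).
rewrite countE split_supp; apply: scard_le; last by right.
by rewrite finite_setU; split=> //; exact: finite_supp.
Qed.

Lemma count_nonpower n : (forall p k, prime p -> (0 < k)%N -> n != (p ^ k)%N) -> (count n <= n)%N.
Proof.
move=> npow; have [finO leO] := over_N_count sd n.
rewrite countE (_ : [set H | _] = overN n) //.
apply/seteqP; split=> H /= [mH iH] //; split=> //; apply: contrapT => notN.
have [K [b [mK _]]] := maximal_adjoin sd mH iH notN.
have [p [k [p_pr k0 nE _]]] := simple_quotient mK.
by have := npow p k p_pr k0; rewrite nE eqxx.
Qed.

Section WithData.
Variables (s r M : nat) (u : 'I_s -> V) (w : 'I_r -> V) (b : 'I_s -> {poly int}).
Hypothesis M_gt0 : (0 < M)%N.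
Hypothesis span : forall v, exists n h h',
  (M%:R * 'X^n) *: v = \sum_j h j *: u j + \sum_l h' l *: w l.
Hypothesis rel : forall h h', \sum_j h j *: u j + \sum_l h' l *: w l = 0 ->
  (forall j, exists e, h j = b j * e) /\ forall l, h' l = 0.
Hypothesis tor : forall j, (M%:R * b j) *: u j = 0.
Hypothesis b_size : forall j, (1 < size (b j))%N /\ (b j)`_0 != 0.

Local Notation d := (s + r)%N.
Local Notation rm := (rank_max phi).

(** The first alternative covers prime powers p^k with p large and numbers that are not
    prime powers. The second one covers the finitely many remaining primes, all at
    most b0, where n <= b0^k says that k is at least of the order of log n. *)
Lemma count_upper : exists D n0 b0, [/\ (1 < b0)%N, (0 < D)%N & forall n, (n0 <= n)%N ->
  (count n <= n + 2 * (D * n ^ d + n ^ r.+1))%N \/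
  exists k, [/\ (0 < k)%N, (n <= b0 ^ k)%N & (count n * k <= n * k + 2 * n ^ rm.+1)%N]].
Proof.
have large := supplements_large sd genP M_gt0 span tor b_size.
move: large; set bad := (M + _ + _)%N => large.
have Kex (p : nat) : exists K, prime p -> forall k, (K <= k)%N -> (0 < k)%N ->
    (T2 p k * k <= 2 * (p ^ k) ^ rm.+1)%N.
  have [p_pr|np] := boolP (prime p); last by exists 0%N.
  by have [K KP] := supplements_small sd genP p_pr; exists K.
have [K KP] := choice Kex.
pose Km := (\sum_(p < bad.+1) K p)%N.
(* For p at most bad, p^k >= bad.+2 ^ Km forces k >= Km. *)
exists (size (\prod_j b j)%R), (bad.+2 ^ Km)%N, bad.+2; split=> //.
  rewrite size_poly_gt0; apply/prodf_neq0 => j _.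
  by apply: contraNneq (b_size j).2 => ->; rewrite coef0.
move=> n le_n.
have [[p [k [p_pr k0 nE]]]|] := pselect (exists p k, [/\ prime p, (0 < k)%N & n = (p ^ k)%N]); last first.
  move=> npow; left; apply: leq_trans (leq_addr _ _); apply: count_nonpower => p k p_pr k0.
  by apply/eqP => nE; apply: npow; exists p, k.
rewrite {n}nE in le_n *; have le1 := count_le p_pr k0.
have [lt_p|le_p] := ltnP bad p.
  left; apply: leq_trans le1 _; rewrite leq_add2l; exact: large.
right; exists k; split=> //; first by rewrite leq_exp2r // (leq_trans le_p) // -addn2 leq_addr.
apply: leq_trans (leq_mul le1 (leqnn k)) _; rewrite mulnDl leq_add2l.
apply: KP => //; have Kp : (K p <= Km)%N.
  by have := ltnS p bad; rewrite le_p => lt_p; rewrite /Km (bigD1 (Ordinal lt_p)) //= leq_addr.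
apply: leq_trans Kp _; rewrite -(leq_exp2l _ _ (isT : (1 < bad.+2)%N)).
by apply: leq_trans le_n _; rewrite leq_exp2r // (leq_trans le_p) // -addn2 leq_addr.
Qed.

End WithData.
End Totals.

Section GrowthBounds.
Variables (R : realType) (f : nat -> nat).
Local Notation fR := (fun n => (f n)%:R : R).

Lemma growth_at_least_pow e c : (0 < c)%N ->
  (forall L, exists2 n, (L <= n)%N & (n ^ e <= c * f n)%N) ->
  growth_at_least fR (fun n => n%:R ^+ e).
Proof.
move=> c0 lower; have cR : 0 < c%:R :> R by rewrite ltr0n.
exists (c%:R^-1); first by rewrite invr_gt0.
apply: infinite_nat_set => L; have [n le_L le_n] := lower L; exists n => //=.
by rewrite ler_pdivrMl // -natrX -natrM ler_nat.
Qed.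

(** For n = p^k, the factor k of the hypothesis is ln n / ln p. *)
Lemma growth_at_least_log e p : (1 < p)%N ->
  (forall L, exists k, [/\ (L < k)%N, (0 < k)%N & ((p ^ k) ^ e <= 4 * k * f (p ^ k))%N]) ->
  growth_at_least fR (fun n => n%:R ^+ e / ln n%:R).
Proof.
move=> p1 lower; have lp : 0 < ln (p%:R : R) by rewrite ln_gt0 // ltr1n.
exists (ln p%:R / 4%:R); first by rewrite divr_gt0.
apply: infinite_nat_set => L; have [k [lt_L k0 le_k]] := lower L.
exists (p ^ k)%N => /=.
  by apply: leq_trans (ltnW lt_L) _; apply: ltnW; apply: ltn_expl.
have kR : 0 < k%:R :> R by rewrite ltr0n.
have -> : ln ((p ^ k)%:R : R) = k%:R * ln p%:R.
  by rewrite natrX lnXn ?ltr0n ?(ltnW p1) // mulr_natl.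
rewrite mulrA ler_pdivrMr ?mulr_gt0 // mulrAC ler_pdivrMr //.
have : ((p ^ k) ^ e)%:R <= (4 * k * f (p ^ k))%:R :> R by rewrite ler_nat.
rewrite !natrM natrX => h.
have h' := ler_wpM2l (ltW lp) h.
by apply: le_trans h' _; rewrite le_eqVlt; apply/orP; left; apply/eqP; lra.
Qed.

Variables (d r rm D n0 b0 : nat).
Hypothesis upper : forall n, (n0 <= n)%N ->
  (f n <= n + 2 * (D * n ^ d + n ^ r.+1))%N \/
  exists k, [/\ (0 < k)%N, (n <= b0 ^ k)%N & (f n * k <= n * k + 2 * n ^ rm.+1)%N].

Let pow_le n e : (0 < n)%N -> (0 < e)%N -> (n <= n ^ e)%N.
Proof. by move=> n1 e0; rewrite -{1}(expn1 n); apply: leq_pexp2l. Qed.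

Lemma growth_at_most_pow e : (0 < e)%N -> (d <= e)%N -> (r < e)%N -> (rm < e)%N ->
  growth_at_most fR (fun n => n%:R ^+ e).
Proof.
move=> e0 de re rme; exists (3 + 2 * D)%:R, (maxn n0 1) => n; rewrite geq_max => /andP[le_n n1].
rewrite ger0_norm ?ler0n // -natrX -natrM ler_nat.
have h1 := pow_le n1 e0.
have h2 : (n ^ d <= n ^ e)%N by apply: leq_pexp2l.
have h3 : (n ^ r.+1 <= n ^ e)%N by apply: leq_pexp2l.
have h4 : (n ^ rm.+1 <= n ^ e)%N by apply: leq_pexp2l.
have [le_f|[k [k0 _ le_f]]] := upper le_n.
  apply: leq_trans le_f _; rewrite mulnDl mulnDr -mulnA [in leqRHS]addnAC.
  have h5 : (D * n ^ d <= D * n ^ e)%N by rewrite leq_mul2l h2 orbT.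
  lia.
have {}le_f : (f n <= n + 2 * n ^ rm.+1)%N.
  rewrite -(leq_pmul2r k0); apply: leq_trans le_f _.
  by rewrite mulnDl leq_add2l leq_pmulr.
apply: leq_trans le_f _; rewrite mulnDl; lia.
Qed.

(** In the second alternative of the hypothesis, 1 / k is at most ln b0 / ln n. *)
Lemma growth_at_most_log : (1 < b0)%N -> (d <= rm)%N -> (r < rm)%N ->
  growth_at_most fR (fun n => n%:R ^+ rm.+1 / ln n%:R).
Proof.
move=> b0_gt1 drm rrm; have rm0 : (0 < rm)%N by exact: leq_ltn_trans rrm.
have lb0 : 0 < ln (b0%:R : R) by rewrite ln_gt0 // ltr1n.
exists ((3 + 2 * D)%:R + 2%:R * ln b0%:R), (maxn n0 2) => n; rewrite geq_max => /andP[le_n n2].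
rewrite ger0_norm ?ler0n //.
have n1 : (0 < n)%N by exact: ltnW.
have nR : 0 < n%:R :> R by rewrite ltr0n.
have ln_n : 0 < ln (n%:R : R) by rewrite ln_gt0 // ltr1n.
have pow_log : (n ^ rm)%:R <= n%:R ^+ rm.+1 / ln n%:R :> R.
  rewrite ler_pdivlMr // exprSr natrX; apply: ler_wpM2l; first by rewrite exprn_ge0 // ltW.
  exact/ltW/ln_sublinear.
pose g : R := n%:R ^+ rm.+1 / ln n%:R; rewrite -/g in pow_log *.
have g0 : 0 <= g by rewrite divr_ge0 ?exprn_ge0 // ltW.
have h1 := pow_le n1 rm0.
have h2 : (n ^ d <= n ^ rm)%N by apply: leq_pexp2l.
have h3 : (n ^ r.+1 <= n ^ rm)%N by apply: leq_pexp2l.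
rewrite mulrDl.
have [le_f|[k [k0 le_k le_f]]] := upper le_n.
  have {}le_f : (f n <= (3 + 2 * D) * n ^ rm)%N.
    apply: leq_trans le_f _; rewrite mulnDl mulnDr -mulnA.
    have h5 : (D * n ^ d <= D * n ^ rm)%N by rewrite leq_mul2l h2 orbT.
    lia.
  apply: (@le_trans _ _ ((3 + 2 * D)%:R * g)); last first.
    by rewrite lerDl; apply: mulr_ge0 => //; apply: mulr_ge0 => //; exact: ltW.
  apply: le_trans (_ : ((3 + 2 * D) * n ^ rm)%:R <= _); first by rewrite ler_nat.
  by rewrite natrM; apply: ler_wpM2l.
have kR : 0 < k%:R :> R by rewrite ltr0n.
have log_k : ln (n%:R : R) <= k%:R * ln b0%:R.
  have b0R : 0 < b0%:R :> R by rewrite ltr0n ltnW.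
  rewrite mulr_natl -lnXn // ler_ln ?posrE ?exprn_gt0 // -natrX ler_nat //.
have {}le_f : (f n)%:R * k%:R <= n%:R * k%:R + 2%:R * n%:R ^+ rm.+1 :> R.
  by rewrite -natrX -!natrM -natrD ler_nat.
have gE : n%:R ^+ rm.+1 = g * ln n%:R :> R by rewrite /g divfK // gt_eqF.
rewrite -(ler_pM2r kR); apply: le_trans le_f _; rewrite [leRHS]mulrDl; apply: lerD.
  apply: ler_wpM2r; first exact: ltW.
  have ng : n%:R <= g by apply: le_trans pow_log; rewrite ler_nat.
  apply: le_trans ng _; rewrite -{1}(mul1r g); apply: ler_wpM2r => //.
  by rewrite ler1n.
have -> : 2%:R * ln b0%:R * g * k%:R = 2%:R * (g * (k%:R * ln b0%:R)) by ring.
by rewrite gE ler_pM2l ?ltr0n //; apply: ler_wpM2l.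
Qed.

End GrowthBounds.

Theorem proposition78 (R : realType) (G : groupType) (N : zmodType)
    (iota : N -> G) (t : G) (phi : {additive N -> N})
    (G_fg : finitely_generated G)
    (G_sd : semidirect_by_Z iota t phi)
    (s0 r0 : nat) (a : 'I_s0 -> {poly rat})
    (a_nonunit : forall j, a j \isn't a GRing.unit)
    (a_dvd : forall i j : 'I_s0, (i <= j)%N -> a i %| a j)
    (QN_dec : rational_decomposition phi ({poly rat}^o : lmodType {poly rat}) r0 a \/
              rational_decomposition phi (laurent rat) r0 a)
    (nondegenerate : (0 < s0 + r0)%N \/ (0 < rank_max phi)%N) :
  let d := (s0 + r0)%N in
  let r_max := rank_max phi in
  growth_type (fun n => (max_subgroup_count G n)%:R : R)
    (if (r_max < d)%N then fun n => n%:R ^+ d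
     else if (d == r_max) && (r_max == r0) then fun n => n%:R ^+ d.+1
     else fun n => n%:R ^+ r_max.+1 / ln n%:R).
Proof.
move=> d r_max.
have [m [gens gensP]] := module_generators G_sd G_fg.
have genP := laurent_span (phi := phi) gensP.
have [M [u [w [b [M0 span rel tor [b_dvd b_size]]]]]] :=
  rational_data (phi_surj G_sd) genP a_nonunit a_dvd QN_dec.
have le_r0 : (r0 <= r_max)%N := free_rank_le_rank_max genP M0 span rel.
have [D [n0 [b0 [b0_gt1 _ upper]]]] := count_upper G_sd genP M0 span tor b_size.
case: (ltnP r_max d) => [lt_rd|le_dr].
  have s_gt0 : (0 < s0)%N by move: lt_rd; rewrite /d; lia.
  split; first by apply: (@growth_at_most_pow R _ _ _ _ _ _ _ upper d) => //; [exact: leq_ltn_trans lt_rd|exact: leq_ltn_trans lt_rd].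
  apply: (@growth_at_least_pow _ _ _ 1) => // L.
  have [p [p_pr lt_p le_p]] := supplements_root G_sd genP M0 span rel b_dvd b_size s_gt0 L.
  exists p; first exact: ltnW.
  rewrite mul1n; apply: leq_trans le_p _.
  by have := count_ge G_sd genP p_pr (isT : (0 < 1)%N); rewrite expn1.
case: ifP => [/andP[/eqP dr /eqP rr]|not_free].
  have s_0 : s0 = 0%N by move: dr; rewrite /d rr; lia.
  have r_gt0 : (0 < r0)%N by case: nondegenerate; rewrite -/r_max ?rr ?s_0.
  split.
    by apply: (@growth_at_most_pow R _ _ _ _ _ _ _ upper d.+1); rewrite // ltnS dr.
  apply: (@growth_at_least_pow _ _ _ 2) => // L.
  have free := supplements_free G_sd genP M0 span rel b_size s_0 r_gt0.
  move: free; set bad := (M + _ + _)%N => free.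
  have [p lt_p p_pr] := prime_above (maxn bad L).
  move: lt_p; rewrite gtn_max => /andP[lt_b lt_L].
  exists p; first exact: ltnW.
  have := free p p_pr lt_b; have := count_ge G_sd genP p_pr (isT : (0 < 1)%N).
  rewrite expn1 dr rr => h1 h2; apply: leq_trans h2 _; by rewrite leq_mul2l h1.
have rm_gt0 : (0 < r_max)%N by case: nondegenerate => // h; exact: leq_trans le_dr.
have lt_r : (r0 < r_max)%N.
  rewrite ltn_neqAle le_r0 andbT; apply: contraFneq not_free => rr.
  by rewrite -rr eqxx andbT; move: le_dr; rewrite -rr /d; lia.
split; first exact: (growth_at_most_log _ upper b0_gt1 le_dr lt_r).
have [p p_pr fixed] := supplements_fixed_prime G_sd genP rm_gt0.
apply: (@growth_at_least_log R _ _ p (prime_gt1 p_pr)) => L.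
have [k [lt_L k0 le_k]] := fixed L; exists k; split=> //.
apply: leq_trans le_k _; rewrite leq_mul2l; apply/orP; right; exact: (count_ge G_sd genP p_pr k0).
Qed.
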